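(* Let $d>6$ and consider a lattice with vertex set $\mathbb{Z}^d$ and edge set $E(\mathbb{Z}^d)$ satisfying the triangle condition $$\sum_{x,y\in\mathbb{Z}^d}\mathbf{P}_{p_c}(0\leftrightarrow x)\,\mathbf{P}_{p_c}(x\leftrightarrow y)\,\mathbf{P}_{p_c}(0\leftrightarrow y)<\infty .$$ Then there exists a constant $C>0$ such that for every integer $r\ge 1$: (i) $\mathbb{E}|B(0,r)|\le Cr$; (ii) $\Gamma(r)\le \dfrac{C}{r}$. In particular, $\mathbf{P}(H(r))\le C/r$ for every integer $r\ge 1$.
   Context: Lattice: a connected graph with vertex set $\mathbb{Z}^d$ and edge set $E(\mathbb{Z}^d)$ that is invariant under translations of $\mathbb{Z}^d$ and has edges of bounded length. Bond percolation with parameter $p$ retains (opens) each edge independently with probability $p$; $\mathbf{P}_p$ is its law and $p_c=p_c(\mathbb{Z}^d)$ is the critical probability of the full lattice. $x\leftrightarrow y$ is the event that $x,y$ are connected by an open path. Throughout $\mathbf{P}=\mathbf{P}_{p_c}$ and $\mathbb{E}$ is the corresponding expectation. For a subgraph given by a set of edges $G\subset E(\mathbb{Z}^d)$, let $G_{p_c}$ be the result of bond percolation on $G$ with parameter $p_c=p_c(\mathbb{Z}^d)$ (always the critical value of the full lattice, not of $G$). Let $d_{G_{p_c}}(x,y)$ be the length of the shortest open path in $G_{p_c}$ between $x$ and $y$, or $\infty$ if there is none. Define the random sets $$B(x,r;G)=\{u: d_{G_{p_c}}(x,u)\le r\},\qquad \partial B(x,r;G)=\{u: d_{G_{p_c}}(x,u)=r\},$$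 the event $H(r;G)=\{\partial B(0,r;G)\ne\emptyset\}$, and $$\Gamma(r)=\sup_{G\subset E(\mathbb{Z}^d)}\mathbf{P}(H(r;G)).$$ When $G$ is the full lattice it is dropped from the notation: $B(x,r)=B(x,r;\mathbb{Z}^d)$, $H(r)=H(r;\mathbb{Z}^d)$. $|\cdot|$ of a set denotes its cardinality (number of vertices). *)

(* Defs.v *)
From HB Require Import structures.
From mathcomp Require Import all_boot all_order all_algebra finmap.
From mathcomp Require Import all_classical all_reals all_analysis.

Set Implicit Arguments.
Unset Strict Implicit.
Unset Printing Implicit Defensive.

Import Order.TTheory GRing.Theory Num.Theory.

Local Open Scope classical_set_scope.
Local Open Scope ring_scope.

Notation Zd d := 'rV[int]_d.

(* [path_between adj x s y]: the sequence x :: s is a path from x to y whose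
   consecutive vertices are related by adj; its length is size s. *)
Definition path_between (V : choiceType) (adj : V -> V -> Prop)
    (x : V) (s : seq V) (y : V) : Prop :=
  path (fun u v => `[< adj u v >]) x s /\ last x s = y.

(* Edges are unordered pairs of distinct vertices. *)
Record lattice (d : nat) := Lattice {
  edge_set : set {fset Zd d} ;
  edge_card2 : forall e, edge_set e -> #|` e| = 2%N ;
  edge_translation : forall x y z : Zd d,
    edge_set [fset x; y]%fset -> edge_set [fset (x + z)%R; (y + z)%R]%fset ;
  edge_bounded : exists M : nat, forall x y : Zd d,
    edge_set [fset x; y]%fset ->
    forall i, (`|x ord0 i - y ord0 i| <= M%:Z)%R ;
  edge_connected : forall x y : Zd d, exists s : seq (Zd d),
    path_between (fun u v => edge_set [fset u; v]%fset) x s y }.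

Definition edge (d : nat) (L : lattice d) : choiceType := set_type (edge_set L).

Section percolation.
Context (d : nat) (L : lattice d).

(* The product sigma-algebra on {0,1}^E, where "true" means "open". *)
Definition coordinate_events : set (set (edge L -> bool)) :=
  [set A | exists (e : edge L) (b : bool), A = [set w | w e = b]].

Definition config := g_sigma_algebraType coordinate_events.

Definition adjacent (G : set (edge L)) (x y : Zd d) : Prop :=
  exists2 e : edge L, G e & val e = [fset x; y]%fset.

(* G_p, as a random set of edges *)
Definition open_edges (G : set (edge L)) (w : config) : set (edge L) :=
  G `&` [set e | w e].

Definition connected_in (G : set (edge L)) (w : config) (x y : Zd d) : Prop :=
  exists s, path_between (adjacent (open_edges G w)) x s y.

Definition connection_event (x y : Zd d) : set config :=
  [set w | connected_in setT w x y].

Definition infinite_cluster_event : set config :=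
  [set w | infinite_set [set u | connected_in setT w 0 u]].

Section with_reals.
Context (R : realType).

(* P p is the product over E of the Bernoulli(p) laws, for every p in [0, 1];
   the equations on finite-dimensional cylinders characterise it. *)
Definition percolation_measures (P : R -> probability config R) : Prop :=
  forall p : R, 0 <= p <= 1 ->
  forall (A : {fset edge L}) (b : edge L -> bool),
    P p [set w | forall e, e \in A -> w e = b e] =
    (\prod_(e <- A) (if b e then p else 1 - p))%:E.

Definition p_c (P : R -> probability config R) : R :=
  sup [set p : R | 0 <= p <= 1 /\ P p infinite_cluster_event = 0%E].

(* Equal to +oo when there is no open path from x to y in G. *)
Definition gdist (G : set (edge L)) (w : config) (x y : Zd d) : \bar R :=
  ereal_inf [set (size s)%:R%:E | s in
    [set s | path_between (adjacent (open_edges G w)) x s y]].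

Definition ball_in (G : set (edge L)) (w : config) (x : Zd d) (r : nat) :
    set (Zd d) :=
  [set u | (gdist G w x u <= r%:R%:E)%E].

Definition sphere_in (G : set (edge L)) (w : config) (x : Zd d) (r : nat) :
    set (Zd d) :=
  [set u | gdist G w x u = r%:R%:E].

Definition H_event (r : nat) (G : set (edge L)) : set config :=
  [set w | sphere_in G w 0 r !=set0].

Definition Gamma (P : probability config R) (r : nat) : \bar R :=
  ereal_sup [set P (H_event r G) | G in [set: set (edge L)]].

Definition expected_ball_size (P : probability config R) (r : nat) : \bar R :=
  (\int[P]_(w in [set: config]) counting (R := R) (ball_in [set: edge L] w 0 r))%E.

Definition triangle_condition (P : probability config R) : Prop :=
  (\esum_(xy in [set: Zd d * Zd d])
     (P (connection_event 0%R xy.1) * P (connection_event xy.1 xy.2) *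
      P (connection_event 0%R xy.2)) < +oo)%E.

End with_reals.
End percolation.

(* Main.v *)
Require Import Defs.
From mathcomp Require Import all_boot all_order all_algebra finmap.
From mathcomp Require Import all_classical all_reals all_analysis measurable_realfun.
From mathcomp Require Import lra ring zify.

Set Implicit Arguments.
Unset Strict Implicit.
Unset Printing Implicit Defensive.

Import Order.TTheory GRing.Theory Num.Theory.
Local Open Scope classical_set_scope.
Local Open Scope ring_scope.

(* Write tau for the two-point function at p_c. Finiteness of the triangle and
   positive definiteness of tau give w with
   sum_{x,a} tau(x) tau(a) tau(a - x - w) as small as we like.

   Ball growth. Let G r be the supremum of E|B(0,r)| over finite sets of edges.
   Exploring the ball of radius r around 0 and starting a fresh ball of radius
   r at x + w, for x in the first ball, costs only an open triangle, so the
   pairs of disjoint legs 0 -> x -> y of length r have expected number at least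
   c (G r)^2. For a given y nearly all such x lie near the geodesic from 0 to y,
   since other x close up a triangle; hence (G r)^2 <= C r G(2r). As G grows
   polynomially, this forces G r <= C r.

   Cluster volume. For p < p_c attach a ghost to each site with probability
   1 - exp(-t), and let M(t) be the probability that 0 is connected to it. If the
   cluster of x misses the ghost, then two arms at x + w1 and x + w2 reach it
   with probability of order M(t)^2; opening two short paths merges the three
   clusters at a branch point which the resulting configuration determines up
   to a bounded number of choices. So M(t) times the expected number of x that
   are connected to 0 but not to the ghost is bounded, which yields
   M(2t)^2 <= M(t)^2 + C t. Since M(t) -> 0 without percolation, M(t)^2 <= C t,
   that is, P(|C(0)| >= n) <= C n^(-1/2), uniformly in p < p_c; events that
   depend on finitely many edges are continuous in p, so this holds at p_c.

   One arm. To reach distance 3r the cluster is either large, or has a level in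
   [r, 2r) with few vertices, each of which must start a new arm of length r;
   this gives Gamma(3^k) <= A 3^(-k) by induction on k. *)

(** * Finite configurations and the BK inequality *)

(** What continues after a ball has been explored lives in the unexplored edges, a random subgraph.
    Hence growth and arm bounds are proved for all finite lists of edges and all starting points,
    with [tau], [G] and [mag] defined as suprema over such lists, and the infinite product measure
    enters only when the events of the statement are identified. Increasing events inherit their
    bounds in subgraphs from the full lattice; having an arm is not monotone in the subgraph, which
    is why it is reduced to cluster volume, which is.

    The displacement w is forced. At w = 0 the triangle sum is at least 1, so the interference
    between two explorations could cancel the main term; for suitable w it is as small as desired,
    and a fixed path of edges bridges the gap at the price of a constant factor.

    The volume bound replaces a differential inequality for M by one for the doubling of t, obtained
    by adding an independent second ghost field. It is run below p_c because it has to start from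
    M(t) -> 0, and there the definition of p_c supplies values without percolation. *)

Lemma eq_imp_le (R : numDomainType) (x y : R) : x = y -> x <= y.
Proof. by move=> ->. Qed.

Section Configurations.
Context {E : choiceType}.
Implicit Types (e : E) (s t : seq E) (u v w I J : E -> bool).

Definition open_edge e w : E -> bool := fun e' => (e' == e) || w e'.
Definition cup u v : E -> bool := fun e => u e || v e.
Definition keep w (q : E -> bool) : E -> bool := fun e => w e && q e.
Definition drop_edges w (q : E -> bool) : E -> bool := fun e => w e && ~~ q e.
Definition of_list s : E -> bool := fun e => e \in s.
Definition none : E -> bool := fun=> false.

Definition sub_cfg u v := forall e, u e -> v e.
Definition disjoint_cfg u v := forall e, u e -> v e -> False.
Definition supported s w := forall e, w e -> e \in s.
Definition increasing (A : (E -> bool) -> Prop) :=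
  forall u v, sub_cfg u v -> A u -> A v.
Definition decreasing (A : (E -> bool) -> Prop) :=
  forall u v, sub_cfg u v -> A v -> A u.

Lemma sub_cfg_trans u v w : sub_cfg u v -> sub_cfg v w -> sub_cfg u w.
Proof. by move=> uv vw e /uv /vw. Qed.

Lemma sub_cupl u v : sub_cfg u (cup u v).
Proof. by move=> e; rewrite /cup => ->. Qed.

Lemma sub_cupr u v : sub_cfg v (cup u v).
Proof. by move=> e; rewrite /cup => ->; rewrite orbT. Qed.

Lemma sub_open e w : sub_cfg w (open_edge e w).
Proof. by move=> e'; rewrite /open_edge => ->; rewrite orbT. Qed.

Lemma sub_keep w q : sub_cfg (keep w q) w.
Proof. by move=> e /andP[]. Qed.

Lemma sub_drop w q : sub_cfg (drop_edges w q) w.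
Proof. by move=> e /andP[]. Qed.

Lemma cup_none w : cup none w = w.
Proof. by apply/funext. Qed.

Lemma cupA u v w : cup u (cup v w) = cup (cup u v) w.
Proof. by apply/funext => e; rewrite /cup orbA. Qed.

Lemma cupC u v : cup u v = cup v u.
Proof. by apply/funext => e; rewrite /cup orbC. Qed.

Lemma open_cupl e u v : cup (open_edge e u) v = open_edge e (cup u v).
Proof. by apply/funext => e'; rewrite /cup /open_edge orbA. Qed.

Lemma open_openC e f w : open_edge e (open_edge f w) = open_edge f (open_edge e w).
Proof. by apply/funext => e'; rewrite /open_edge orbCA. Qed.

Lemma open_id e w : open_edge e (open_edge e w) = open_edge e w.
Proof. by apply/funext => e'; rewrite /open_edge orbA orbb. Qed.

Lemma keep_open e w q :
  keep (open_edge e w) q = if q e then open_edge e (keep w q) else keep w q.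
Proof.
apply/funext => e'; rewrite /keep /open_edge.
case qe : (q e); case: eqP => [->|_] //=; rewrite ?qe ?andbF //.
Qed.

(** Disjoint occurrence. A witness is a subconfiguration on which the event already holds, the right
    notion for the increasing events to which it is applied. *)
Definition box (A B : (E -> bool) -> Prop) w :=
  exists I J, [/\ sub_cfg I w, sub_cfg J w, disjoint_cfg I J, A I & B J].

Lemma box_incr A B : increasing (box A B).
Proof.
move=> u v uv [I [J [Iu Ju dIJ AI BJ]]]; exists I, J; split => //.
  exact: sub_cfg_trans uv.
exact: sub_cfg_trans uv.
Qed.

Definition boxes (As : seq ((E -> bool) -> Prop)) w := foldr box (fun=> True) As w.

Lemma boxes_incr As : increasing (boxes As).
Proof. by case: As => [//|A As]; apply: box_incr. Qed.

Lemma boxes1 A w : increasing A -> boxes [:: A] w -> A w.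
Proof. by move=> iA [I [J [Iw _ _ AI _]]]; apply: iA AI. Qed.

End Configurations.

Section Indicator.
Context {R : realFieldType}.

Definition ind (P : Prop) : R := (`[< P >] : nat)%:R.

Lemma ind_ge0 P : 0 <= ind P. Proof. exact: ler0n. Qed.
Lemma ind_le1 P : ind P <= 1. Proof. by rewrite /ind; case: asbool; rewrite ?ler01. Qed.
Lemma ind_true (P : Prop) : P -> ind P = 1.
Proof. by rewrite /ind => /asboolT ->. Qed.
Lemma ind_false (P : Prop) : ~ P -> ind P = 0.
Proof. by rewrite /ind => /asboolF ->. Qed.
Lemma ind_le (P Q : Prop) : (P -> Q) -> ind P <= ind Q.
Proof.
move=> PQ; case: (pselect P) => p; last by rewrite (ind_false p) ind_ge0.
by rewrite !ind_true //; apply: PQ.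
Qed.
Lemma ind_and (P Q : Prop) : ind (P /\ Q) = ind P * ind Q.
Proof.
by rewrite /ind asbool_and; case: (asbool P); case: (asbool Q); rewrite ?mulr0 ?mulr1.
Qed.
Lemma ind_bool (b : bool) : ind b = (b : nat)%:R.
Proof. by rewrite /ind asboolb. Qed.

End Indicator.

Section Expectation.
Context {R : realFieldType} {E : choiceType}.
Implicit Types (e : E) (s t : seq E) (u v w : E -> bool) (pr : E -> R).
Implicit Types (f g : (E -> bool) -> R).

(* An edge that occurs twice in s is open as soon as one of its coins is. *)
Fixpoint Ex pr s f : R :=
  if s is e :: s' then
    pr e * Ex pr s' (fun w => f (open_edge e w)) + (1 - pr e) * Ex pr s' f
  else f none.

Definition Pr pr s (A : (E -> bool) -> Prop) := Ex pr s (fun w => ind (A w)).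

Lemma eq_Ex pr s f g : f =1 g -> Ex pr s f = Ex pr s g.
Proof. by move=> /funext ->. Qed.

Lemma Ex_lin pr s a b f g :
  Ex pr s (fun w => a * f w + b * g w) = a * Ex pr s f + b * Ex pr s g.
Proof. by elim: s f g => [//|e s IH] f g /=; rewrite !IH; ring. Qed.

Lemma Ex_cons pr e s f :
  Ex pr (e :: s) f = Ex pr s (fun w => pr e * f (open_edge e w) + (1 - pr e) * f w).
Proof. by rewrite Ex_lin. Qed.

Lemma ExD pr s f g : Ex pr s (fun w => f w + g w) = Ex pr s f + Ex pr s g.
Proof.
rewrite -[Ex pr s f]mul1r -[Ex pr s g]mul1r -Ex_lin.
by apply: eq_Ex => w; rewrite !mul1r.
Qed.

Lemma ExZ pr s a f : Ex pr s (fun w => a * f w) = a * Ex pr s f.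
Proof.
rewrite -[RHS]addr0 -[X in _ + X](mul0r (Ex pr s f)) -Ex_lin.
by apply: eq_Ex => w; rewrite mul0r addr0.
Qed.

Lemma ExZr pr s a f : Ex pr s (fun w => f w * a) = Ex pr s f * a.
Proof. by rewrite mulrC -ExZ; apply: eq_Ex => w; rewrite mulrC. Qed.

Lemma ExB pr s f g : Ex pr s (fun w => f w - g w) = Ex pr s f - Ex pr s g.
Proof.
rewrite -[Ex pr s f]mul1r -mulN1r -Ex_lin.
by apply: eq_Ex => w; rewrite mul1r mulN1r.
Qed.

Lemma Ex_const pr s a : Ex pr s (fun=> a) = a.
Proof. by elim: s => [//|e s IH] /=; rewrite !IH; ring. Qed.

Lemma Ex_sum pr s (T : Type) (r : seq T) (F : T -> (E -> bool) -> R) :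
  Ex pr s (fun w => \sum_(i <- r) F i w) = \sum_(i <- r) Ex pr s (F i).
Proof.
elim: r => [|i r IH]; first by rewrite big_nil -[RHS](Ex_const pr s); apply: eq_Ex => w; rewrite big_nil.
by rewrite big_cons -IH -ExD; apply: eq_Ex => w; rewrite big_cons.
Qed.

Lemma Ex_cat pr s t f :
  Ex pr (s ++ t) f = Ex pr s (fun u => Ex pr t (fun v => f (cup u v))).
Proof.
elim: s f => [|e s IH] f /=; first by apply: eq_Ex => w; rewrite cup_none.
rewrite !IH; congr (_ * _ + _).
by apply: eq_Ex => u; apply: eq_Ex => v; rewrite open_cupl.
Qed.

Lemma Ex_comm pr pr' s t (F : (E -> bool) -> (E -> bool) -> R) :
  Ex pr s (fun u => Ex pr' t (F u)) = Ex pr' t (fun v => Ex pr s (F^~ v)).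
Proof. by elim: s F => [//|e s IH] F /=; rewrite !IH -Ex_lin. Qed.

Lemma Ex_perm pr s t f : perm_eq s t -> Ex pr s f = Ex pr t f.
Proof.
move=> st; apply: (catCA_perm_ind (P := fun t => Ex pr s f = Ex pr t f)) st _ => //.
move=> s1 s2 s3 ->; rewrite !Ex_cat.
under eq_Ex do rewrite Ex_cat.
under [RHS]eq_Ex do rewrite Ex_cat.
rewrite Ex_comm; apply: eq_Ex => u; apply: eq_Ex => v; apply: eq_Ex => w.
by rewrite !cupA (cupC u).
Qed.

Lemma Ex_filter pr s (q : E -> bool) f :
  Ex pr s (fun w => f (keep w q)) = Ex pr (seq.filter q s) f.
Proof.
elim: s f => [//|e s IH] f /=; rewrite IH.
case qe : (q e) => /=.
  congr (_ * _ + _); rewrite -IH; apply: eq_Ex => w.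
  by rewrite keep_open qe.
under [X in _ * X + _]eq_Ex do rewrite keep_open qe.
by rewrite IH; ring.
Qed.

(** Coins inside and outside [q] are independent, so the outside ones may be drawn again. This is
    the deterministic case of [Ex_stop], to which the random one is reduced. *)
Lemma Ex_split pr s (q : E -> bool) (F : (E -> bool) -> (E -> bool) -> R) :
  Ex pr s (fun w => F (keep w q) (drop_edges w q)) =
  Ex pr s (fun w => Ex pr s (fun w' => F (keep w q) (drop_edges w' q))).
Proof.
elim: s F => [//|e s IH] F /=.
have dropE w : drop_edges (open_edge e w) q =
    if q e then drop_edges w q else open_edge e (drop_edges w q).
  by rewrite /drop_edges; have := keep_open e w (predC q); rewrite /keep /= => ->; case: (q e).
case qe : (q e).
  have h1 := IH (fun u v => F (open_edge e u) v).
  transitivity (pr e * Ex pr s (fun w => F (open_edge e (keep w q)) (drop_edges w q)) +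
                (1 - pr e) * Ex pr s (fun w => F (keep w q) (drop_edges w q))).
    by congr (_ * _ + _); apply: eq_Ex => w; rewrite keep_open dropE qe.
  rewrite h1 IH; congr (_ * _ + _ * _); apply: eq_Ex => w.
    rewrite -Ex_lin; apply: eq_Ex => w'; rewrite keep_open dropE qe; ring.
  rewrite -Ex_lin; apply: eq_Ex => w'; rewrite dropE qe; ring.
have h1 := IH (fun u v => F u (open_edge e v)).
transitivity (pr e * Ex pr s (fun w => F (keep w q) (open_edge e (drop_edges w q))) +
              (1 - pr e) * Ex pr s (fun w => F (keep w q) (drop_edges w q))).
  by congr (_ * _ + _); apply: eq_Ex => w; rewrite keep_open dropE qe.
rewrite h1 IH -!Ex_lin; apply: eq_Ex => w.
rewrite -!Ex_lin; apply: eq_Ex => w'; rewrite keep_open !dropE qe; ring.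
Qed.

Lemma Ex_supp_ext pr s f g : (forall w, supported s w -> f w = g w) ->
  Ex pr s f = Ex pr s g.
Proof.
elim: s f g => [|e s IH] f g h /=; first by apply: h => e.
congr (_ * _ + _ * _); apply: IH => w sw; apply: h => e'; rewrite inE.
  by case/orP => [->//|/sw ->]; rewrite orbT.
by move/sw => ->; rewrite orbT.
Qed.

Lemma eq_Ex_pr pr pr' s f : (forall e, e \in s -> pr e = pr' e) ->
  Ex pr s f = Ex pr' s f.
Proof.
elim: s f => [//|e s IH] f h /=; rewrite h ?inE ?eqxx // !IH // => e' es;
  by apply: h; rewrite inE es orbT.
Qed.

Section Probability.
Context (pr : E -> R) (pr01 : forall e, 0 <= pr e <= 1).

Let pr0 e : 0 <= pr e. Proof. by case/andP: (pr01 e). Qed.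
Let pr1 e : 0 <= 1 - pr e. Proof. by case/andP: (pr01 e); rewrite subr_ge0. Qed.

Lemma Ex_ge0 s f : (forall w, supported s w -> 0 <= f w) -> 0 <= Ex pr s f.
Proof.
elim: s f => [|e s IH] f h /=; first by apply: h => e.
apply: addr_ge0; apply: mulr_ge0 => //; apply: IH => w sw; apply: h => e'; rewrite inE.
  by case/orP => [->//|/sw ->]; rewrite orbT.
by move/sw => ->; rewrite orbT.
Qed.

Lemma Ex_le_supp s f g : (forall w, supported s w -> f w <= g w) ->
  Ex pr s f <= Ex pr s g.
Proof.
by move=> h; rewrite -subr_ge0 -ExB; apply: Ex_ge0 => w /h; rewrite subr_ge0.
Qed.

Lemma Ex_le s f g : (forall w, f w <= g w) -> Ex pr s f <= Ex pr s g.
Proof. by move=> h; apply: Ex_le_supp. Qed.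

Lemma Pr_ge0 s A : 0 <= Pr pr s A.
Proof. by apply: Ex_ge0 => w _; apply: ind_ge0. Qed.

Lemma Pr_le1 s A : Pr pr s A <= 1.
Proof. by rewrite -[leRHS](Ex_const pr s); apply: Ex_le => w; apply: ind_le1. Qed.

Lemma Pr_le_supp s (A B : (E -> bool) -> Prop) :
  (forall w, supported s w -> A w -> B w) -> Pr pr s A <= Pr pr s B.
Proof. by move=> h; apply: Ex_le_supp => w sw; apply: ind_le; apply: h. Qed.

Lemma Pr_le s (A B : (E -> bool) -> Prop) :
  (forall w, A w -> B w) -> Pr pr s A <= Pr pr s B.
Proof. by move=> h; apply: Pr_le_supp => w _; apply: h. Qed.

Lemma Pr_subset s t A : increasing A -> uniq s -> uniq t -> {subset s <= t} ->
  Pr pr s A <= Pr pr t A.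
Proof.
move=> iA us ut st.
have -> : Pr pr s A = Ex pr t (fun w => ind (A (keep w (mem s)))).
  rewrite (Ex_filter pr t (mem s) (fun w => ind (A w))); apply: Ex_perm.
  apply: uniq_perm => //; first exact: filter_uniq.
  by move=> e; rewrite mem_filter /=; case es: (e \in s) => //=; rewrite st.
by apply: Ex_le => w; apply: ind_le; apply: iA; apply: sub_keep.
Qed.

(** Insertion tolerance: the coin of [e] alone opens it with probability [pr e], whatever the other
    coins show. *)
Lemma Ex_open s e f : e \in s -> (forall w, 0 <= f w) ->
  pr e * Ex pr s (fun w => f (open_edge e w)) <= Ex pr s f.
Proof.
elim: s f => [//|e' s IH] f es f0 /=.
have [ee|ne] := eqVneq e' e.
  rewrite ee; under eq_Ex do rewrite open_id.
  have h : 0 <= Ex pr s f by apply: Ex_ge0.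
  set a := Ex pr s _; have -> : pr e * (pr e * a + (1 - pr e) * a) = pr e * a by ring.
  by rewrite lerDl mulr_ge0.
have {}es : e \in s by move: es; rewrite inE eq_sym (negPf ne).
have := IH (fun w => f (open_edge e' w)) es (fun w => f0 _).
under eq_Ex do rewrite open_openC.
move: (IH f es f0) (pr0 e') (pr1 e'); set a := Ex _ _ _; set b := Ex _ _ _.
set c := Ex _ _ _; set d := Ex _ _ _ => h1 h2 h3 h4.
rewrite mulrDr lerD //.
  by rewrite mulrCA ler_wpM2l.
by rewrite mulrCA ler_wpM2l.
Qed.

Lemma Ex_open_list (p : R) s l f : 0 <= p -> (forall e, e \in l -> p <= pr e) ->
  {subset l <= s} -> (forall w, 0 <= f w) ->
  p ^+ size l * Ex pr s (fun w => f (cup (of_list l) w)) <= Ex pr s f.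
Proof.
move=> p0; elim: l f => [|e l IH] f hp ls f0; first by rewrite mul1r.
have -> : (fun w => f (cup (of_list (e :: l)) w)) =
    (fun w => f (open_edge e (cup (of_list l) w))).
  apply/funext => w; congr f; apply/funext => e'.
  by rewrite /cup /open_edge /of_list inE orbA.
rewrite /= exprS -mulrA; apply: le_trans (Ex_open (e := e) _ f0); last by apply: ls; rewrite inE eqxx.
have h1 : p ^+ size l * Ex pr s (fun w => f (open_edge e (cup (of_list l) w))) <=
    Ex pr s (fun w => f (open_edge e w)).
  apply: (IH (fun w => f (open_edge e w))) => // e' el.
    by apply: hp; rewrite inE el orbT.
  by apply: ls; rewrite inE el orbT.
apply: le_trans (_ : p * Ex pr s (fun w => f (open_edge e w)) <= _).
  exact: ler_wpM2l.
by apply: ler_wpM2r; [apply: Ex_ge0|apply: hp; rewrite inE eqxx].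
Qed.

(* S w is the set of edges explored in w: F w only depends on these, so the
   unexplored edges can be resampled. *)
Lemma Ex_stop s (S : (E -> bool) -> E -> bool)
    (F : (E -> bool) -> (E -> bool) -> R) :
  (forall w w', (forall e, S w e -> w e = w' e) ->
     (forall e, S w' e = S w e) /\ F w =1 F w') ->
  Ex pr s (fun w => F w (drop_edges w (S w))) =
  Ex pr s (fun w => Ex pr s (fun w' => F w (drop_edges w' (S w)))).
Proof.
move=> stop.
pose T w : {fset E} := [fset e in s | S w e]%fset.
have TE w e : (e \in T w) = (e \in s) && S w e by rewrite !inE.
pose D := fpowerset [fset e in s]%fset.
have TD w : \sum_(t <- D) (T w == t)%:R = 1 :> R.
  have Tw : T w \in D.
    by rewrite fpowersetE; apply/fsubsetP => e; rewrite !inE => /andP[].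
  rewrite (bigD1_seq (T w)) ?fset_uniq //= eqxx big1 ?addr0 // => t /negPf.
  by rewrite eq_sym => ->.
have exp G : Ex pr s G = \sum_(t <- D) Ex pr s (fun w => (T w == t)%:R * G w).
  by rewrite -Ex_sum; apply: eq_Ex => w; rewrite -mulr_suml TD mul1r.
rewrite exp [RHS]exp; apply: eq_bigr => t _.
pose q e := e \in t.
pose K u v := (T u == t)%:R * F u v.
(* Once the explored part of [s] is [t], the exploration reads only coins in [t]: [w] and [keep w q]
   explore the same edges. So the integrand is a function of the coins in [t] and of those off [t],
   and [Ex_split] applies. *)
have key w v : supported s w -> supported s v ->
    (T w == t)%:R * F w (drop_edges v (S w)) =
    K (keep w q) (drop_edges v q).
  move=> sw sv; rewrite /K.
  have h : T w = t \/ T (keep w q) = t ->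
      (forall e, S (keep w q) e = S w e) /\ F w =1 F (keep w q).
    move=> Tt; case: Tt => Tt.
      apply: stop => e Se; rewrite /keep; case we: (w e) => //=.
      by rewrite /q -Tt TE Se sw.
    have [|h1 h2] := @stop (keep w q) w.
    2: by split => [e|v']; rewrite ?h1 ?h2.
    move=> e Se; rewrite /keep; case we: (w e) => //=.
    by rewrite /q -Tt TE Se sw.
  have TT : (forall e, S (keep w q) e = S w e) -> T (keep w q) = T w.
    by move=> h1; apply/fsetP => e; rewrite !TE h1.
  case: (eqVneq (T w) t) => [e1|n1].
    have [h1 h2] := h (or_introl e1).
    rewrite (TT h1) e1 eqxx !mul1r h2; congr (F _ _).
    apply/funext => e; rewrite /drop_edges; case ve : (v e) => //=.
    by rewrite /q -e1 TE sv.
  case: (eqVneq (T (keep w q)) t) => [e2|n2]; last by rewrite !mul0r.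
  have [h1 _] := h (or_intror e2).
  by move: n1; rewrite -(TT h1) e2 eqxx.
transitivity (Ex pr s (fun w => K (keep w q) (drop_edges w q))).
  by apply: Ex_supp_ext => w sw; apply: key.
rewrite Ex_split; apply: Ex_supp_ext => w sw; rewrite -ExZ.
by apply: Ex_supp_ext => v sv; rewrite key.
Qed.

(** * The BK inequality with a decreasing side condition *)

Section BK.
Context (D A B : (E -> bool) -> Prop).
Context (decD : decreasing D) (incA : increasing A) (incB : increasing B).

(** Interpolation between one configuration and two independent ones: [w] is shared, [u] belongs to
    [A] and [u'] to [B]. The decreasing [D] reads only the shared and the first coins, so that it
    ends up next to [A]. *)
Let Q u u' w := D (cup u w) /\ exists I J,
  [/\ sub_cfg I w, sub_cfg J w, disjoint_cfg I J, A (cup u I) & B (cup u' J)].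

Let H t s := Ex pr t (fun u => Ex pr t (fun u' => Ex pr s (fun w => ind (Q u u' w)) : R)).

(* Opening the edge [e] in the shared configuration costs one coin; in the
   doubled configuration the certificate that uses [e] gets its own coin. *)
Let H_step t e s : H t (e :: s) <= H (e :: t) s.
Proof.
rewrite /H.
have -> : Ex pr (e :: t) (fun u => Ex pr (e :: t) (fun u' =>
    Ex pr s (fun w => ind (Q u u' w)))) =
  Ex pr t (fun u => Ex pr t (fun u' => Ex pr s (fun w =>
    pr e * (pr e * ind (Q (open_edge e u) (open_edge e u') w)
          + (1 - pr e) * ind (Q (open_edge e u) u' w))
    + (1 - pr e) * (pr e * ind (Q u (open_edge e u') w)
          + (1 - pr e) * ind (Q u u' w))))).
  rewrite Ex_cons; apply: eq_Ex => u; rewrite !Ex_cons -Ex_lin; apply: eq_Ex => u'.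
  by rewrite -!Ex_lin.
apply: Ex_le => u; apply: Ex_le => u'; rewrite Ex_cons; apply: Ex_le => w.
have mono a b : (exists I J, [/\ sub_cfg I w, sub_cfg J w, disjoint_cfg I J,
    A (cup u I) & B (cup u' J)]) ->
    exists I J, [/\ sub_cfg I w, sub_cfg J w, disjoint_cfg I J,
    A (cup (if a then open_edge e u else u) I) &
    B (cup (if b then open_edge e u' else u') J)].
  move=> [I [J [h1 h2 h3 h4 h5]]]; exists I, J; split => //.
    by case: a => //; apply: incA h4; rewrite open_cupl; apply: sub_open.
  by case: b => //; apply: incB h5; rewrite open_cupl; apply: sub_open.
have Q0 : Q u u' w -> Q u (open_edge e u') w.
  by move=> [d c]; split => //; apply: (mono false true).
(* If the certificate of [A] uses [e], the private coin goes to [u]; otherwise it is handed to [u'],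
   harmlessly even when [J] does not use it. *)
have Q1 : Q u u' (open_edge e w) ->
    Q (open_edge e u) u' w \/ Q u (open_edge e u') w.
  move=> [d [I [J [h1 h2 h3 h4 h5]]]].
  have rem K : sub_cfg K (open_edge e w) -> sub_cfg (drop_edges K (pred1 e)) w.
    by move=> hK e' /andP[/hK]; rewrite /open_edge /=; case: (e' == e).
  have remI K v : sub_cfg (cup v K) (cup (open_edge e v) (drop_edges K (pred1 e))).
    move=> e'; rewrite /cup /open_edge /drop_edges /=; case: (e' == e) => //=.
    by rewrite andbT.
  have remJ K v : ~~ K e -> sub_cfg (cup v K) (cup v (drop_edges K (pred1 e))).
    move=> nK e' /orP[ve|Ke]; rewrite /cup /drop_edges /= ?ve// Ke.
    by case: eqP => [eE|]; rewrite ?orbT //; move: nK; rewrite -eE Ke.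
  have dd : disjoint_cfg (drop_edges I (pred1 e)) (drop_edges J (pred1 e)).
    by move=> e' /andP[Ie _] /andP[Je _]; apply: (h3 e').
  have [Ie|nIe] := boolP (I e).
    left; split.
      by apply: decD d => e'; rewrite open_cupl /cup /open_edge orbCA.
    exists (drop_edges I (pred1 e)), (drop_edges J (pred1 e)); split => //; try exact: rem.
      by apply: incA h4; apply: remI.
    apply: incB h5; apply: remJ; apply/negP => Je; exact: h3 Je.
  right; split.
    by apply: decD d => e'; rewrite /cup /open_edge orbCA => ->; rewrite orbT.
  exists (drop_edges I (pred1 e)), (drop_edges J (pred1 e)); split => //; try exact: rem.
    by apply: incA h4; apply: remJ.
  by apply: incB h5; apply: remI.
have Q11 : Q u u' (open_edge e w) -> Q u u' w ->
    Q (open_edge e u) (open_edge e u') w /\ Q (open_edge e u) u' w.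
  move=> [d _] [_ c].
  have d' : D (cup (open_edge e u) w).
    by apply: decD d => e'; rewrite open_cupl /cup /open_edge orbCA.
  by split; split => //; [apply: (mono true true)|apply: (mono true false)].
have Q10 : Q (open_edge e u) u' w -> Q (open_edge e u) (open_edge e u') w.
  move=> [d [I [J [h1 h2 h3 h4 h5]]]]; split => //; exists I, J; split => //.
  by apply: incB h5; rewrite open_cupl; apply: sub_open.
have Q01 : Q u u' (open_edge e w) -> Q u (open_edge e u') w ->
    Q (open_edge e u) (open_edge e u') w.
  move=> [d _] [_ [I [J [h1 h2 h3 h4 h5]]]]; split.
    by apply: decD d => e'; rewrite open_cupl /cup /open_edge orbCA.
  exists I, J; split => //.
  by apply: incA h4; rewrite open_cupl; apply: sub_open.
have nn X : 0 <= ind (R := R) X := ind_ge0 X.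
have p0 := pr0 e; have p1 := pr1 e.
have sq0 : 0 <= pr e * (1 - pr e) by apply: mulr_ge0.
have sq1 : 0 <= pr e * pr e by apply: mulr_ge0.
have sq2 : 0 <= (1 - pr e) * (1 - pr e) by apply: mulr_ge0.
(* The unusual case is [q0] without [q1]: opening [e] can break the decreasing [D]. Then a coin for
   [u'] preserves [Q] by [Q0], and the two terms with [u] unchanged add up to [1 - pr e]. *)
case: (pselect (Q u u' (open_edge e w))) => q1; case: (pselect (Q u u' w)) => q0.
- have [a b] := Q11 q1 q0; rewrite !ind_true //; last exact: Q0.
  by apply: eq_imp_le; ring.
- rewrite (ind_true q1) (ind_false q0); case: (Q1 q1) => c.
    rewrite (ind_true c) (ind_true (Q10 c)).
    move: (nn (Q u (open_edge e u') w)); nra.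
  rewrite (ind_true c) (ind_true (Q01 q1 c)).
  move: (nn (Q (open_edge e u) u' w)); nra.
- rewrite (ind_false q1) (ind_true q0) (ind_true (Q0 q0)).
  move: (nn (Q (open_edge e u) (open_edge e u') w)) (nn (Q (open_edge e u) u' w)); nra.
- rewrite (ind_false q1) (ind_false q0) !mulr0 addr0.
  by rewrite addr_ge0 // mulr_ge0 // addr_ge0 // mulr_ge0.
Qed.

(** Moving the coins one by one from the shared list to the private ones only increases the
    probability. At the end no coin is shared, the certificates are empty, and [A] with [D] on one
    side and [B] on the other are read off independent copies. *)
Lemma BK s : Pr pr s (fun w => D w /\ box A B w) <=
  Pr pr s (fun w => D w /\ A w) * Pr pr s B.
Proof.
have Hrec t r : H t r <= H (catrev r t) [::].
  elim: r t => [//|e r IH] t; exact: le_trans (H_step _ _ _) (IH _).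
apply: le_trans (_ : H [::] s <= _).
  rewrite /H /=; apply: eq_imp_le; apply: eq_Ex => w.
  congr ind; apply/propext; rewrite /Q cup_none; split => -[d [I [J [? ? ? ? ?]]]];
  by split => //; exists I, J; split; rewrite ?cup_none in *.
apply: le_trans (Hrec _ _) _.
rewrite /H /= /Pr -ExZr (@Ex_perm pr _ s) ?catrevE ?cats0 ?perm_rev //.
apply: Ex_le => u; rewrite (@Ex_perm pr _ s) ?perm_rev //.
rewrite -ExZ; apply: Ex_le => u'; rewrite -ind_and; apply: ind_le.
rewrite /Q (cupC u none) cup_none => -[d [I [J [In Jn _ AI BJ]]]].
have hn K v : sub_cfg K none -> cup v K = v.
  by move=> hK; apply/funext => e; rewrite /cup; case Ke: (K e); rewrite ?orbF //; have := hK e Ke.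
by rewrite (hn _ _ In) in AI; rewrite (hn _ _ Jn) in BJ.
Qed.

End BK.

End Probability.

Lemma Ex_le_pr (pr pr' : E -> R) s f :
  (forall e, 0 <= pr e <= 1) -> (forall e, 0 <= pr' e <= 1) ->
  (forall e, pr e <= pr' e) ->
  (forall u v, sub_cfg u v -> f u <= f v) -> Ex pr s f <= Ex pr' s f.
Proof.
move=> h h' hh; elim: s f => [//|e s IH] f inc.
apply: le_trans (_ : Ex pr' s (fun w => pr e * f (open_edge e w) + (1 - pr e) * f w) <= _).
  rewrite Ex_cons; apply: IH => u v uv.
  apply: lerD; apply: ler_wpM2l; rewrite ?subr_ge0; try by case/andP: (h e).
    by apply: inc => e'; rewrite /open_edge => /orP[->|/uv ->]; rewrite ?orbT.
  exact: inc.
rewrite Ex_cons; apply: Ex_le => // w.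
have : f w <= f (open_edge e w) by apply: inc; apply: sub_open.
have := hh e; nra.
Qed.

(** An edge of the union is closed when both fields close it. This serves to add a second ghost
    field to a first one. *)
Lemma Ex_cup (pr pr1 pr2 : E -> R) s f :
  (forall e, 1 - pr e = (1 - pr1 e) * (1 - pr2 e)) ->
  Ex pr s f = Ex pr1 s (fun u => Ex pr2 s (fun v => f (cup u v))).
Proof.
move=> h; elim: s f => [|e s IH] f /=; first by rewrite cup_none.
rewrite !IH -!Ex_lin; apply: eq_Ex => u; rewrite -!Ex_lin; apply: eq_Ex => v.
rewrite !open_cupl (cupC u (open_edge e v)) open_cupl (cupC v) open_id.
have -> : pr e = 1 - (1 - pr1 e) * (1 - pr2 e) by rewrite -h; ring.
by ring.
Qed.

Lemma Ex_map (pr : E -> R) s f (phi psi : E -> E) : cancel phi psi -> cancel psi phi ->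
  (forall e, pr (phi e) = pr e) ->
  Ex pr (map phi s) f = Ex pr s (fun w => f (fun e => w (psi e))).
Proof.
move=> c1 c2 prp; elim: s f => [//|e s IH] f /=; rewrite !IH prp.
congr (_ * _ + _); apply: eq_Ex => w; congr f; apply/funext => e'.
by rewrite /open_edge (can2_eq c2 c1).
Qed.

(** Changing the law of one coin changes the average of a function with values in [0, 1] by at most
    [del]. On a fixed finite list this carries bounds from below the critical value to the critical
    value. *)
Lemma Ex_lipschitz (pr pr' : E -> R) s f (del : R) :
  (forall e, 0 <= pr e <= 1) -> (forall e, 0 <= pr' e <= 1) ->
  (forall e, `|pr e - pr' e| <= del) -> (forall w, 0 <= f w <= 1) ->
  Ex pr s f <= Ex pr' s f + (size s)%:R * del.
Proof.
move=> h h' hd; elim: s f => [|e s IH] f f01; first by rewrite /= mul0r addr0.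
rewrite !Ex_cons -natr1 mulrDl mul1r addrA addrAC.
apply: le_trans (_ : Ex pr' s (fun w => pr e * f (open_edge e w) + (1 - pr e) * f w)
    + (size s)%:R * del <= _).
  apply: IH => w; move: (f01 w) (f01 (open_edge e w)) (h e) => /andP[a b] /andP[c d] /andP[i j].
  by apply/andP; split; nra.
rewrite lerD2r -(Ex_const pr' s del) -ExD; apply: Ex_le => // w.
have := hd e; rewrite ler_norml => /andP[lo hi].
move: (f01 w) (f01 (open_edge e w)) => /andP[a b] /andP[c d].
have : `|f (open_edge e w) - f w| <= 1 by rewrite ler_norml; apply/andP; split; lra.
have : (pr e - pr' e) * (f (open_edge e w) - f w) <= del * 1; last by nra.
apply: le_trans (ler_norm _) _; rewrite normrM ler_pM ?normr_ge0 //.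
by rewrite ler_norml; apply/andP; split; lra.
Qed.

End Expectation.

(** * Walks and disjoint occurrence *)

Section Walks.
Context {V : choiceType}.
Notation E := {fset V}.
Implicit Types (w : E -> bool) (x y z a b c : V) (q : seq V) (n : option nat)
  (l : seq E) (B : V -> Prop) (e : E).

Fixpoint pedges x q : seq E :=
  if q is y :: q' then [fset x; y]%fset :: pedges y q' else [::].

Definition short n q := if n is Some k then (size q <= k)%N else true.

(** The length bound is optional, so that balls ([Some r]) and clusters ([None]) share one
    theory. *)
Definition walk n x y w : Prop :=
  exists q, [/\ all w (pedges x q), last x q = y & short n q].

(* A self-loop [fset y] plays the role of an edge from y to the ghost. *)
Definition ghost n x w : Prop := exists2 y, walk n x y w & w [fset y]%fset.

Definition touching B : E -> bool := fun e => `[< exists2 a, a \in e & B a >].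
(** The edges revealed by exploring the ball of radius [n]: all those with an endpoint in it, the
    closed ones on its boundary included. *)
Definition touch n x w := touching (fun a => walk n x a w).

Lemma sub_cfg_all w w' l : sub_cfg w w' -> all w l -> all w' l.
Proof. by move=> h; apply: sub_all. Qed.

Lemma walk_incr n x y : increasing (walk n x y).
Proof. by move=> u v uv [q [h1 h2 h3]]; exists q; split => //; apply: sub_cfg_all h1. Qed.

Lemma ghost_incr n x : increasing (ghost n x).
Proof. by move=> u v uv [y h1 h2]; exists y; [apply: walk_incr h1|apply: uv]. Qed.

Lemma pedges_cat x q1 q2 : pedges x (q1 ++ q2) = pedges x q1 ++ pedges (last x q1) q2.
Proof. by elim: q1 x => //= y q1 IH x; rewrite IH. Qed.

Lemma size_pedges x q : size (pedges x q) = size q.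
Proof. by elim: q x => //= y q IH x; rewrite IH. Qed.

Lemma path_pedges w x q : path (fun u v => w [fset u; v]%fset) x q = all w (pedges x q).
Proof. by elim: q x => //= y q IH x; rewrite IH. Qed.

Lemma short_leq n q q' : (size q' <= size q)%N -> short n q -> short n q'.
Proof. by case: n => //= k; apply: leq_trans. Qed.

Lemma walk_refl n x w : walk n x x w.
Proof. by exists [::]; split => //; case: n. Qed.

Lemma walk_weak n x y w : walk n x y w -> walk None x y w.
Proof. by move=> [q [h1 h2 h3]]; exists q. Qed.

Lemma walk_cat (m n : nat) x y z w : walk (Some m) x y w -> walk (Some n) y z w ->
  walk (Some (m + n)%N) x z w.
Proof.
move=> [q [h1 h2 h3]] [q' [h1' h2' h3']]; exists (q ++ q'); split => /=.
- by rewrite pedges_cat all_cat h1 h2.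
- by rewrite last_cat h2.
- by rewrite size_cat leq_add.
Qed.

Lemma walk_trans x y z w : walk None x y w -> walk None y z w -> walk None x z w.
Proof.
move=> [q [h1 h2 h3]] [q' [h1' h2' h3']]; exists (q ++ q'); split => //.
  by rewrite pedges_cat all_cat h1 h2.
by rewrite last_cat h2.
Qed.

Lemma pedges_rev x q : exists q', [/\ last (last x q) q' = x, size q' = size q &
  pedges (last x q) q' =i pedges x q].
Proof.
elim: q x => [|y q IH] x /=; first by exists [::].
have [q' [h1 h2 h3]] := IH y; exists (rcons q' x); split.
- by rewrite last_rcons.
- by rewrite size_rcons h2.
- move=> e; rewrite -cats1 pedges_cat mem_cat h3 h1 /= mem_seq1 in_cons.
  by rewrite orbC fsetUC.
Qed.

Lemma walk_sym n x y w : walk n x y w -> walk n y x w.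
Proof.
move=> [q [h1 h2 h3]]; have [q' [h4 h5 h6]] := pedges_rev x q.
exists q'; split; rewrite -?h2 //; last by apply: short_leq h3; rewrite h5.
by rewrite (eq_all_r (h6 : _ =i _)).
Qed.

Lemma uniq_walk w x q : all w (pedges x q) ->
  exists q', [/\ uniq (x :: q'), all w (pedges x q'), last x q' = last x q,
    (size q' <= size q)%N & {subset q' <= q}].
Proof.
rewrite -path_pedges => /shortenP[q' h1 h2 h3]; exists q'; split => //.
- by rewrite -path_pedges.
- by apply: uniq_leq_size => //; case/andP: h2.
Qed.

Lemma pedges_mem x q e : e \in pedges x q ->
  exists a b, [/\ e = [fset a; b]%fset, a \in belast x q & b \in q].
Proof.
elim: q x => //= y q IH x; rewrite inE => /orP[/eqP ->|/IH [a [b [-> h1 h2]]]].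
  by exists x, y; rewrite !inE !eqxx.
by exists a, b; rewrite !in_cons h1 h2 !orbT.
Qed.

Lemma pedges_sub x q e a : e \in pedges x q -> a \in e -> a \in x :: q.
Proof.
move=> /pedges_mem[b [c [-> h1 h2]]]; rewrite !inE => /orP[] /eqP ->.
  by have := mem_belast h1; rewrite inE.
by rewrite h2 orbT.
Qed.

Lemma pedges_card x q e : uniq (x :: q) -> e \in pedges x q ->
  exists a b, [/\ a != b, a \in e & b \in e].
Proof.
elim: q x => //= y q IH x /and3P[h1 h2 h3]; rewrite inE => /orP[/eqP ->|h4].
  exists x, y; rewrite !inE !eqxx orbT; split => //.
  by apply: contraNneq h1 => ->; rewrite inE eqxx.
by apply: IH h4; rewrite /= h2.
Qed.

Lemma pedges_disjoint x q1 q2 e : uniq (x :: q1 ++ q2) ->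
  e \in pedges x q1 -> e \in pedges (last x q1) q2 -> False.
Proof.
rewrite -cat_cons cat_uniq => /and3P[u1 /hasPn h u2] e1 e2.
have [a [b [ab ae be]]] := pedges_card u1 e1.
have k c : c \in e -> c = last x q1.
  move=> ce; have := pedges_sub e1 ce; have := pedges_sub e2 ce.
  by rewrite inE => /orP[/eqP //|/h /negP].
by move: ab; rewrite (k _ ae) (k _ be) eqxx.
Qed.

Lemma split_last (P : V -> bool) x q : P x ->
  exists q1 q2, [/\ q = q1 ++ q2, P (last x q1) & all (predC P) q2].
Proof.
elim: q x => [|y q IH] x Px; first by exists [::], [::].
case: (boolP (has P (y :: q))) => [hP|]; last first.
  by rewrite -all_predC => h; exists [::], (y :: q).
have [Py|nPy] := boolP (P y).
  by have [q1 [q2 [-> h1 h2]]] := IH y Py; exists (y :: q1), q2.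
have hq : has P q by move: hP; rewrite /= (negPf nPy).
clear -hq IH nPy.
have [q1 [q2 [-> h1 h2]]] : exists q1 q2, [/\ q = q1 ++ q2, P (last y q1) & all (predC P) q2].
  elim/last_ind: q hq {IH} => // q z IHz; rewrite has_rcons.
  have [Pz _|nPz /= hq] := boolP (P z).
    by exists (rcons q z), [::]; rewrite cats0 last_rcons.
  have [q1 [q2 [-> h1 h2]]] := IHz hq; exists q1, (rcons q2 z).
  by rewrite rcons_cat all_rcons /= nPz.
by exists (y :: q1), q2.
Qed.

Lemma split_first (P : V -> bool) x q : has P (x :: q) ->
  exists q1 q2, [/\ q = q1 ++ q2, P (last x q1) & all (predC P) (belast x q1)].
Proof.
elim: q x => [|y q IH] x; first by rewrite /= orbF => Px; exists [::], [::].
have [Px _|nPx] := boolP (P x); first by exists [::], (y :: q).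
rewrite [has _ _]/= (negPf nPx) => /IH[q1 [q2 [-> h1 h2]]].
by exists (y :: q1), q2; split => //=; rewrite nPx.
Qed.

Lemma split_mem c x q : c \in x :: q -> exists q1 q2, q = q1 ++ q2 /\ last x q1 = c.
Proof. by move/splitPl => [q1 q2 h]; exists q1, q2. Qed.

Lemma of_list_walk n x q y : last x q = y -> short n q -> walk n x y (of_list (pedges x q)).
Proof. by move=> h1 h2; exists q; split => //; apply/allP. Qed.

Lemma sub_of_list l w : sub_cfg (of_list l) w <-> all w l.
Proof. by split=> [h|/allP//]; apply/allP. Qed.

Fixpoint certified w (als : seq (((E -> bool) -> Prop) * seq E)) : Prop :=
  if als is (A, l) :: als' then
    [/\ A (of_list l), all w l, all (fun p => ~~ has (mem l) p.2) als' & certified w als']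
  else True.

Lemma certified_boxes w als : certified w als -> boxes (map fst als) w.
Proof.
move=> h; suff : boxes (map fst als) (of_list (flatten (map snd als))).
  apply: boxes_incr; apply/sub_of_list.
  elim: als h => [//|[A l] als IH] /= [_ h _ /IH]; by rewrite all_cat h.
elim: als h => [//|[A l] als IH] /= [h1 h2 h3 /IH h4].
exists (of_list l), (of_list (flatten (map snd als))); split => //.
- by move=> e; rewrite /of_list mem_cat => ->.
- by move=> e; rewrite /of_list mem_cat => ->; rewrite orbT.
- move=> e el /flatten_mapP[p pa ep].
  by have /hasPn/(_ e ep) := allP h3 p pa; rewrite /= (el : e \in l).
Qed.

Lemma walk_vertex n x q w a : all w (pedges x q) -> short n q -> a \in x :: q -> walk n x a w.
Proof.
move=> h1 h2 /split_mem[q1 [q2 [qE la]]]; exists q1; split => //.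
  by move: h1; rewrite qE pedges_cat all_cat => /andP[].
by apply: short_leq h2; rewrite qE size_cat leq_addr.
Qed.

(** By induction along a walk open in [w']: the part already shown open in [w] ends in the ball of
    [w], so the next edge touches that ball, where both configurations agree. This makes the
    explored set a stopping set. *)
Lemma touch_sym n x w w' : (forall e, touch n x w e -> w e = w' e) ->
  forall e, touch n x w' e -> w' e = w e.
Proof.
move=> h e /asboolP[a ae [q [h1 h2 h3]]]; rewrite h //; apply/asboolP; exists a => //.
exists q; split => // {h2}.
elim/last_ind: q h1 h3 => // q z IH; rewrite -cats1 pedges_cat !all_cat => /andP[h1 h2] h3.
have h4 : short n q by apply: short_leq h3; rewrite size_cat leq_addr.
rewrite IH //=; move: h2; rewrite /= !andbT => h2; rewrite h //.
by apply/asboolP; exists (last x q); [rewrite !inE eqxx|exists q; rewrite IH].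
Qed.

(** The side condition allows [m] to be one less than [n]: each edge of a walk starts at a vertex
    reached before, so the edges touching the ball of radius m decide the walks of length m + 1. *)
Lemma touch_walk n m x y w w' : (forall q z, short n (rcons q z) -> short m q) ->
  (forall e, touch m x w e -> w e = w' e) -> walk n x y w <-> walk n x y w'.
Proof.
move=> nm; suff H (v v' : E -> bool) : (forall e, touch m x v e -> v e = v' e) ->
    walk n x y v -> walk n x y v'.
  by move=> h; split; apply: H => //; apply: touch_sym.
move=> h [q [h1 h2 h3]]; exists q; split => //; apply/allP => e eq_.
rewrite -h ?(allP h1) //; case/lastP: q h1 h2 h3 eq_ => // q b h1 _ h3 eq_.
have [a [c [eE aq _]]] := pedges_mem eq_.
apply/asboolP; exists a; first by rewrite eE !inE eqxx.
rewrite belast_rcons in aq; apply: (@walk_vertex m x q) => //; last exact: nm h3.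
by move: h1; rewrite -cats1 pedges_cat all_cat => /andP[].
Qed.

Lemma short_rcons n q z : short n (rcons q z) -> short n q.
Proof. by apply: short_leq; rewrite size_rcons. Qed.

Lemma touch_eq n x w w' : (forall e, touch n x w e -> w e = w' e) ->
  touch n x w =1 touch n x w'.
Proof.
move=> h e; apply/asbool_equiv_eq.
by split => -[a ae]; move/(touch_walk _ (@short_rcons n) h); exists a.
Qed.

Lemma touch_ghost n x w w' : (forall e, touch n x w e -> w e = w' e) ->
  ghost n x w <-> ghost n x w'.
Proof.
move=> h; have ty y : walk n x y w -> touch n x w [fset y]%fset.
  by move=> wy; apply/asboolP; exists y; rewrite ?inE.
split=> -[y h1 h2].
  by exists y; [apply/(touch_walk _ (@short_rcons n) h)|rewrite -h // ty].
by have h1' := (touch_walk y (@short_rcons n) h).2 h1; exists y => //; rewrite h // ty.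
Qed.

Lemma off_vertices B w q z : all (drop_edges w (touching B)) (pedges z q) -> ~ B z ->
  forall a, a \in z :: q -> ~ B a.
Proof.
elim: q z => [|y q IH] z /=; first by move=> _ h a; rewrite inE => /eqP ->.
move=> /andP[/andP[_ /asboolPn h1] h2] h3 a.
rewrite in_cons => /orP[/eqP -> //|]; apply: IH => // By.
by apply: h1; exists y => //; rewrite !inE eqxx orbT.
Qed.

Lemma off_pedges B w q z : all w (pedges z q) -> (forall a, a \in z :: q -> ~ B a) ->
  all (drop_edges w (touching B)) (pedges z q).
Proof.
move=> h1 h2; apply/allP => e eq_; rewrite /drop_edges (allP h1 e eq_) /=.
by apply/negP => /asboolP[a ae]; apply: h2; apply: pedges_sub eq_ ae.
Qed.

(** A simple walk either avoids [B], and then uses no edge touching it, or is cut at a vertex of [B]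
    into edge-disjoint pieces. The second alternative is the loss in lower bounds, and BK controls
    it. *)
Lemma walk_cut B n z y w : walk n z y w ->
  (~ B z /\ walk n z y (drop_edges w (touching B))) \/
  (exists2 a, B a & boxes [:: walk None z a; walk n a y] w).
Proof.
move=> [q0 [/uniq_walk[q [h1 h2 h3 h4 _]] h5 h6]].
case: (pselect (exists2 a, a \in z :: q & B a)) => [[a az Ba]|nB].
  right; exists a => //.
  have [q1 [q2 [qE la]]] := split_mem az; subst q.
  apply: (@certified_boxes w [:: (_, pedges z q1); (_, pedges a q2)]) => /=.
  move: h2; rewrite pedges_cat all_cat la => /andP[h2 h2']; split => //.
  - by apply: of_list_walk.
  - rewrite andbT; apply/hasPn => e e2; apply/negP => e1.
    by apply: (pedges_disjoint h1 e1); rewrite la.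
  - split => //; apply: of_list_walk; last first.
      by apply: short_leq h6; apply: leq_trans h4; rewrite size_cat leq_addl.
    by rewrite -h5 -h3 last_cat la.
left; split; first by move=> Bz; apply: nB; exists z; rewrite ?inE ?eqxx.
exists q; split; rewrite ?h3 //; last exact: short_leq h6.
by apply: off_pedges => // a ae Ba; apply: nB; exists a.
Qed.

Lemma ghost_cert n x q : short n q -> ghost n x (of_list (rcons (pedges x q) [fset last x q]%fset)).
Proof.
move=> h; exists (last x q); last by rewrite /of_list mem_rcons inE eqxx.
exists q; split => //; apply/allP => e eq_; rewrite /of_list mem_rcons inE.
by rewrite eq_ orbT.
Qed.

Lemma fset1_pedges x q c : uniq (x :: q) -> [fset c]%fset \in pedges x q -> False.
Proof.
move=> h1 h2; have [a [b [ab]]] := pedges_card h1 h2; rewrite !inE => /eqP ac /eqP bc.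
by rewrite ac bc eqxx in ab.
Qed.

Lemma ghost_cut B n z w : ghost n z w ->
  (~ B z /\ ghost n z (drop_edges w (touching B))) \/
  (exists2 a, B a & boxes [:: walk None z a; ghost n a] w).
Proof.
move=> [y [q0 [/uniq_walk[q [h1 h2 h3 h4 _]] h5 h6]] wy].
have h36 : short n q by apply: short_leq h6.
case: (pselect (exists2 a, a \in z :: q & B a)) => [[a az Ba]|nB].
  right; exists a => //.
  have [q1 [q2 [qE la]]] := split_mem az; subst q.
  apply: (@certified_boxes w [:: (_, pedges z q1);
    (_, rcons (pedges a q2) [fset last a q2]%fset)]) => /=.
  have ly : last a q2 = y by rewrite -h5 -h3 last_cat la.
  have uq1 : uniq (z :: q1) by move: h1; rewrite -cat_cons cat_uniq => /and3P[].
  move: h2; rewrite pedges_cat all_cat la => /andP[h2 h2']; split => //.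
  - by apply: of_list_walk.
  - rewrite andbT; apply/hasPn => e; rewrite mem_rcons inE => /orP[/eqP->|e2]; apply/negP.
      exact: fset1_pedges.
    by move=> e1; apply: (pedges_disjoint h1 e1); rewrite la.
  - split => //; last by rewrite all_rcons h2' ly wy.
    by apply: ghost_cert; apply: short_leq h36; rewrite size_cat leq_addl.
left; split; first by move=> Bz; apply: nB; exists z; rewrite ?inE ?eqxx.
exists y.
  exists q; split; rewrite ?h3 //.
  by apply: off_pedges => // a ae Ba; apply: nB; exists a.
rewrite /drop_edges wy /=; apply/negP => /asboolP[a]; rewrite inE => /eqP -> By.
by apply: nB; exists y => //; rewrite -h5 -h3 mem_last.
Qed.

Lemma pedges_off (P : V -> bool) b q e : all (predC P) q -> e \in pedges b q ->
  exists2 c, c \in e & ~~ P c.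
Proof.
move=> /allP h /pedges_mem[a [c [-> h1 h2]]]; exists c; first by rewrite !inE eqxx orbT.
exact: h.
Qed.

Lemma pedges_off_belast (P : V -> bool) b q e : all (predC P) (belast b q) ->
  e \in pedges b q -> exists2 c, c \in e & ~~ P c.
Proof.
move=> /allP h /pedges_mem[a [c [-> h1 h2]]]; exists a; first by rewrite !inE eqxx.
exact: h.
Qed.

(** The branch point [b] is the last vertex of the walk to [a] that lies on a simple walk from [x]
    to [y]; past it, every edge has an endpoint off that simple walk. *)
Lemma tree_boxes n x y a w : walk n x y w -> walk None x a w ->
  exists b, boxes [:: walk n x b; walk None b y; walk None b a] w.
Proof.
move=> [q0 [/uniq_walk[q [h1 h2 h3 h4 _]] h5 h6]] [q' [h1' l' _]].
have xq : x \in x :: q by rewrite inE eqxx.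
have [p1 [p2 [qE hb hp2]]] := split_last q' (P := mem (x :: q)) xq.
set b := last x p1 in hb; exists b.
have [q1 [q2 [qE2 lb]]] := split_mem hb; subst q q'.
move: h2; rewrite pedges_cat all_cat lb => /andP[h2 h2'].
move: h1'; rewrite pedges_cat all_cat => /andP[_ h1'].
have off e : e \in pedges b p2 -> e \in pedges x (q1 ++ q2) -> False.
  move=> /(pedges_off hp2)[c ce /negP cn] e1; apply: cn.
  exact: (pedges_sub e1 ce).
apply: (@certified_boxes w [:: (_, pedges x q1); (_, pedges b q2); (_, pedges b p2)]) => /=.
split => //.
- apply: of_list_walk => //; apply: short_leq h6; apply: leq_trans h4.
  by rewrite size_cat leq_addr.
- rewrite andbT; apply/andP; split; apply/hasPn => e e2; apply/negP => e1.
    by apply: (pedges_disjoint h1 e1); rewrite lb.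
  by apply: (off e e2); rewrite pedges_cat mem_cat; move: e1 => /= ->.
- split => //.
  + by apply: of_list_walk => //; rewrite -h5 -h3 last_cat lb.
  + rewrite andbT; apply/hasPn => e e2; apply/negP => e1.
    by apply: (off e e2); rewrite pedges_cat mem_cat lb; move: e1 => /= ->; rewrite orbT.
  + split => //; apply: of_list_walk => //; by rewrite -l' last_cat.
Qed.

(** As in [tree_boxes], with the ghost loop added to the second leg; the walk to [a] is made simple
    so that it cannot use this loop. *)
Lemma tree_ghost_boxes n x a w : ghost n x w -> walk None x a w ->
  exists b, boxes [:: walk n x b; ghost n b; walk None b a] w.
Proof.
move=> [y [q0 [/uniq_walk[q [h1 h2 h3 h4 _]] h5 h6]] wy] [q0' [/uniq_walk[q' [u' h1' l' _ _]] h2' _]].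
have xq : x \in x :: q by rewrite inE eqxx.
have [p1 [p2 [qE hb hp2]]] := split_last q' (P := mem (x :: q)) xq.
set b := last x p1 in hb; exists b.
have [q1 [q2 [qE2 lb]]] := split_mem hb; subst q q'.
have h36 : short n (q1 ++ q2) by apply: short_leq h6.
move: h2; rewrite pedges_cat all_cat lb => /andP[h2 h2'0].
move: h1'; rewrite pedges_cat all_cat => /andP[_ h1'].
have off e : e \in pedges b p2 -> e \in pedges x (q1 ++ q2) -> False.
  move=> /(pedges_off hp2)[c ce /negP cn] e1; apply: cn.
  exact: (pedges_sub e1 ce).
have ly : last b q2 = y by rewrite -h5 -h3 last_cat lb.
have uq1 : uniq (x :: q1) by move: h1; rewrite -cat_cons cat_uniq => /and3P[].
have nl c : [fset c]%fset \in pedges b p2 -> False.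
  move=> hc; apply: (@fset1_pedges x (p1 ++ p2) c) => //.
  by rewrite pedges_cat mem_cat hc orbT.
apply: (@certified_boxes w [:: (_, pedges x q1);
  (_, rcons (pedges b q2) [fset last b q2]%fset); (_, pedges b p2)]) => /=.
split => //.
- apply: of_list_walk => //; apply: short_leq h36; by rewrite size_cat leq_addr.
- rewrite andbT; apply/andP; split; apply/hasPn => e; last first.
    move=> e2; apply/negP => e1.
    by apply: (off e e2); rewrite pedges_cat mem_cat; move: e1 => /= ->.
  rewrite mem_rcons inE => /orP[/eqP->|e2]; apply/negP; first exact: fset1_pedges.
  by move=> e1; apply: (pedges_disjoint h1 e1); rewrite lb.
- split => //.
  + by apply: ghost_cert; apply: short_leq h36; rewrite size_cat leq_addl.
  + by rewrite all_rcons h2'0 ly wy.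
  + rewrite andbT; apply/hasPn => e e2; apply/negP; rewrite /= mem_rcons inE.
    move=> /orP[/eqP ee|e1]; first by apply: (nl (last b q2)); rewrite -ee.
    by apply: (off e e2); rewrite pedges_cat mem_cat lb e1 orbT.
  + split => //; apply: of_list_walk => //; by rewrite -h2' -l' last_cat.
Qed.

Definition vertices x (s : seq E) : seq V :=
  undup (x :: flatten [seq enum_fset e | e <- s]).

Lemma walk_vertices n x y s w : supported s w -> walk n x y w -> y \in vertices x s.
Proof.
move=> sw [q [h1 <- _]]; rewrite mem_undup.
case/lastP: q h1 => [|q z]; first by rewrite inE eqxx.
rewrite -cats1 pedges_cat all_cat /= andbT last_cat => /andP[_ /sw h] /=.
rewrite inE; apply/orP; right; apply/flattenP.
by exists (enum_fset [fset last x q; z]%fset); [apply: map_f|rewrite in_fset2 eqxx orbT].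
Qed.

Definition geodesic x q y w := [/\ uniq (x :: q), all w (pedges x q), last x q = y &
  forall q', all w (pedges x q') -> last x q' = y -> (size q <= size q')%N].

Lemma geodesic_exists x y w : walk None x y w -> exists q, geodesic x q y w.
Proof.
move=> [q0 [h1 h2 _]].
pose P k := `[< exists q, [/\ all w (pedges x q), last x q = y & size q = k] >].
have [|k /asboolP[q [h3 h4 h5]] kmin] := @ex_minnP P.
  by exists (size q0); apply/asboolP; exists q0.
have [q' [u1 u2 u3 u4 _]] := uniq_walk h3; exists q'; split; rewrite ?u3 //.
move=> q1 k1 k2; apply: leq_trans u4 _; rewrite h5.
by apply: kmin; apply/asboolP; exists q1.
Qed.

Lemma disjointP l l' : (forall e, e \in l -> e \in l' -> False) -> ~~ has (mem l) l'.
Proof. by move=> h; apply/hasPn => e e'; apply/negP => /h /(_ e'). Qed.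

Lemma triangle_boxes o y x w q1 q2 q3 l1 l2 (r r' : nat)
    (u := last o q1) (v := last u q2) (q := q1 ++ q2 ++ q3) :
  uniq (o :: q) -> all w (pedges o q) -> last o q = y ->
  (size q1 <= r)%N -> (size q3 <= r')%N -> all w l1 -> all w l2 ->
  walk None u x (of_list l1) -> walk None x v (of_list l2) ->
  (forall e, e \in l1 -> e \in l2 -> False) ->
  (forall e, e \in pedges o q -> e \in l1 -> False) ->
  (forall e, e \in pedges o q -> e \in l2 -> False) ->
  boxes [:: walk (Some r) o u; walk None u x; walk None x v; walk None u v;
            walk (Some r') v y] w.
Proof.
move=> uq hq lq s1 s3 w1 w2 h1 h2 d12 d1 d2.
have qE : pedges o q = pedges o q1 ++ pedges u q2 ++ pedges v q3 by rewrite !pedges_cat.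
move: hq; rewrite qE !all_cat => /and3P[k1 k2 k3].
have in1 e : e \in pedges o q1 -> e \in pedges o q by rewrite qE mem_cat => ->.
have in2 e : e \in pedges u q2 -> e \in pedges o q by rewrite qE !mem_cat => ->; rewrite orbT.
have in3 e : e \in pedges v q3 -> e \in pedges o q by rewrite qE !mem_cat => ->; rewrite !orbT.
have d e : e \in pedges o q1 -> e \in pedges u (q2 ++ q3) -> False by apply: pedges_disjoint.
have d' e : e \in pedges u q2 -> e \in pedges v q3 -> False.
  apply: pedges_disjoint; move: uq.
  by rewrite /q -cat_cons lastI cat_rcons cat_uniq => /and3P[].
apply: (@certified_boxes w [:: (_, pedges o q1); (_, l1); (_, l2); (_, pedges u q2);
  (_, pedges v q3)]) => /=.
split => //.
- exact: of_list_walk.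
- rewrite andbT; apply/and4P; split; apply: disjointP => e e1.
  + by apply: d1; apply: in1.
  + by apply: d2; apply: in1.
  + by move=> e2; apply: (d e e1); rewrite pedges_cat mem_cat e2.
  + by move=> e2; apply: (d e e1); rewrite pedges_cat mem_cat e2 orbT.
split => //.
  by rewrite andbT; apply/and3P; split; apply: disjointP => e e1;
    [apply: d12|move=> /in2 /d1; apply|move=> /in3 /d1; apply].
split => //.
  by rewrite andbT; apply/andP; split; apply: disjointP => e e1;
    [move=> /in2 /d2; apply|move=> /in3 /d2; apply].
split => //; first exact: of_list_walk.
  by rewrite andbT; apply: disjointP.
by split => //; apply: of_list_walk => //; rewrite -lq /q !last_cat.
Qed.

(* x lies off the geodesic from o to y but on an open path from o to y: the
   excursion through x closes up a triangle with the geodesic. *)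
Lemma detour_boxes o x y w q (r r' : nat) : geodesic o q y w ->
  boxes [:: walk (Some r) o x; walk (Some r') x y] w -> x \notin o :: q ->
  exists u v, [/\ u \in o :: q, v \in o :: q &
    boxes [:: walk (Some r) o u; walk None u x; walk None x v; walk None u v;
              walk (Some r') v y] w].
Proof.
move=> [uq hq lq qmin] [I [J [Iw Jw dIJ [al [Ial lal sal]] [J1 [_ [J1J _ _ [be [Jbe lbe sbe]] _]]]]]] xq.
have {J1J}Jbe := sub_cfg_all J1J Jbe.
have oq : o \in o :: q by rewrite inE eqxx.
have yq : y \in o :: q by rewrite -lq mem_last.
have [al1 [al2 [alE uP al2P]]] := split_last al (P := mem (o :: q)) oq.
have [|be1 [be2 [beE vP be1P]]] := @split_first (mem (o :: q)) x be.
  by apply/hasP; exists y => //; rewrite -lbe mem_last.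
set u := last o al1 in uP; set v := last x be1 in vP.
have {}uP : u \in o :: q by exact: uP.
have {}vP : v \in o :: q by exact: vP.
have la2 : last u al2 = x by rewrite -lal alE last_cat.
have [Ial1 Ial2] : all I (pedges o al1) /\ all I (pedges u al2).
  by apply/andP; rewrite -all_cat -pedges_cat -alE.
have [Jbe1 Jbe2] : all J (pedges x be1) /\ all J (pedges v be2).
  by apply/andP; rewrite -all_cat -pedges_cat -beE.
have wal1 := sub_cfg_all Iw Ial1; have wal2 := sub_cfg_all Iw Ial2.
have wbe1 := sub_cfg_all Jw Jbe1; have wbe2 := sub_cfg_all Jw Jbe2.
have lbe2 : last v be2 = y by rewrite -lbe beE last_cat.
have sal1 : (size al1 <= r)%N by apply: leq_trans sal; rewrite alE size_cat leq_addr.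
have sbe2 : (size be2 <= r')%N by apply: leq_trans sbe; rewrite beE size_cat leq_addl.
have da e : e \in pedges o q -> e \in pedges u al2 -> False.
  move=> e1 /(pedges_off al2P)[c ce /negP cn]; apply: cn; exact: (pedges_sub e1 ce).
have db e : e \in pedges o q -> e \in pedges x be1 -> False.
  move=> e1 /(pedges_off_belast be1P)[c ce /negP cn]; apply: cn; exact: (pedges_sub e1 ce).
have dab e : e \in pedges u al2 -> e \in pedges x be1 -> False.
  by move=> /(allP Ial2) + /(allP Jbe1); apply: dIJ.
have [g1 [g2 [qE lu]]] := split_mem uP.
have sg1 : (size g1 <= r)%N.
  apply: leq_trans sal1; rewrite -(leq_add2r (size g2)) -!size_cat -qE; apply: qmin.
    by rewrite pedges_cat all_cat wal1 /= -/u -lu; move: hq; rewrite qE pedges_cat all_cat => /andP[].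
  by rewrite last_cat -/u -lu -last_cat -qE.
have /andP[hg1 hg2] : all w (pedges o g1) && all w (pedges u g2).
  by rewrite -lu -all_cat -pedges_cat -qE.
(* The excursion may return to the geodesic before or after [u]. In either order, exchanging an end
   of the geodesic for an end of the walk through [x] shows by minimality that the end pieces have
   lengths at most [r] and [r']. *)
have : v \in belast o g1 ++ u :: g2 by rewrite -cat_rcons -lu -lastI cat_cons -qE.
rewrite mem_cat => /orP[vg|vg].
  have {vg}/split_mem[h1 [h2 [g1E lv]]] : v \in o :: g1 by apply: mem_belast.
  exists v, u; split => //.
  have lu2 : last v h2 = u by rewrite -lu g1E last_cat lv.
  have := @triangle_boxes o y x w h1 h2 g2 (pedges x be1) (pedges u al2) r r'.
  cbv zeta; rewrite lv lu2 catA -g1E -qE; apply => //.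
  - by apply: leq_trans sg1; rewrite g1E size_cat leq_addr.
  - apply: leq_trans sbe2; apply: leq_trans (_ : size (h2 ++ g2) <= _)%N.
      by rewrite size_cat leq_addl.
    rewrite -(leq_add2l (size h1)) -!size_cat catA -g1E -qE; apply: qmin.
      by rewrite pedges_cat all_cat lv wbe2; move: hg1; rewrite g1E pedges_cat all_cat => /andP[->].
    by rewrite last_cat lv.
  - by apply: walk_sym; apply: of_list_walk.
  - by apply: walk_sym; apply: of_list_walk.
  - by move=> e e1 e2; apply: dab e2 e1.
have [h1 [h2 [g2E lv]]] := split_mem vg.
exists u, v; split => //.
have := @triangle_boxes o y x w g1 h1 h2 (pedges u al2) (pedges x be1) r r'.
cbv zeta; rewrite lu lv -g2E -qE; apply => //; try exact: of_list_walk.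
apply: leq_trans sbe2; rewrite -(leq_add2l (size (g1 ++ h1))) -!size_cat -catA -g2E -qE.
apply: qmin; last by rewrite !last_cat lu lv.
rewrite !pedges_cat !all_cat hg1 lu last_cat lu lv wbe2 andbT.
by move: hg2; rewrite g2E pedges_cat all_cat => /andP[].
Qed.

(* The last vertex c of the jump that lies in the ball is the junction: the
   walk from o to c stays in the ball, the rest of the jump avoids it. *)
Lemma open_jump n (r' : nat) o x z y k w : walk n o x w -> ~ walk n o z w ->
  last x k = z -> walk (Some r') z y (drop_edges w (touch n o w)) ->
  exists2 c, c \in x :: k & boxes [:: walk n o c; walk (Some (size k + r')%N) c y]
     (cup (of_list (pedges x k)) w).
Proof.
move=> ox noz lk [q [h1 h2 h3]].
pose P v := `[< walk n o v w >].
have Px : P x by apply/asboolP.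
have [k1 [k2 [kE /asboolP[al [h4 h5 h6]] k2P]]] := split_last k Px.
set c := last x k1 in h5; exists c.
  by rewrite kE -cat_cons mem_cat mem_last.
have lc : last c k2 = z by rewrite -lk kE last_cat.
apply: (@certified_boxes _ [:: (walk n o c, pedges o al);
  (walk (Some (size k + r')%N) c y, pedges c (k2 ++ q))]) => /=.
split => //.
- exact: of_list_walk.
- by apply: sub_cfg_all h4; apply: sub_cupr.
- rewrite andbT; apply: disjointP => e e1.
  have inB a : a \in e -> walk n o a w.
    by move=> /(pedges_sub e1); apply: walk_vertex.
  rewrite pedges_cat mem_cat lc => /orP[/(pedges_off k2P)[a ae /asboolP]|]; first by apply; apply: inB.
  move=> /pedges_mem[a [b [eE az bq]]].
  apply: (off_vertices h1 noz (a := b)); first by rewrite inE bq orbT.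
  by apply: inB; rewrite eE !inE eqxx orbT.
- split => //; last first.
    rewrite pedges_cat all_cat lc; apply/andP; split.
      apply/allP => e ek; rewrite /cup /of_list kE pedges_cat mem_cat.
      by move: ek; rewrite -/c => ->; rewrite orbT.
    by apply: sub_cfg_all h1 => e /andP[we _]; apply: sub_cupr.
  apply: of_list_walk; first by rewrite last_cat lc.
  by rewrite /= size_cat leq_add // kE size_cat leq_addl.
Qed.

End Walks.

(** * Translations and trees *)

Section Sums.
Context {R : realFieldType}.

Lemma ind_le_sum (T : eqType) (L : seq T) (P : Prop) (Q : T -> Prop) :
  (P -> exists2 b, b \in L & Q b) -> ind P <= \sum_(b <- L) ind (Q b) :> R.
Proof.
move=> h; case: (pselect P) => p; last by rewrite ind_false // sumr_ge0 // => *; apply: ind_ge0.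
have [b bL Qb] := h p; rewrite (ind_true p) (big_rem b) //= (ind_true Qb) lerDl.
by apply: sumr_ge0 => *; apply: ind_ge0.
Qed.

Lemma sum_map_le (T : eqType) (X Y : seq T) (F : T -> R) : uniq X -> {subset X <= Y} ->
  (forall x, 0 <= F x) -> \sum_(x <- X) F x <= \sum_(x <- Y) F x.
Proof.
move=> uX XY F0; elim: X Y uX XY => [|x X IH] Y; first by rewrite big_nil sumr_ge0.
move=> /= /andP[xX uX] XY; have xY : x \in Y by apply: XY; rewrite inE eqxx.
rewrite big_cons (big_rem x xY) /= lerD2l; apply: IH => // y yX.
have yY : y \in Y by apply: XY; rewrite inE yX orbT.
have : y \in x :: rem x Y by rewrite -(perm_mem (perm_to_rem xY)).
rewrite inE => /orP[/eqP yx|//]; by rewrite -yx yX in xX.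
Qed.

Lemma sum_mem_le (V : zmodType) (X L : seq V) c : uniq X -> \sum_(x <- X) ((x - c \in L) : nat)%:R <= (size L)%:R :> R.
Proof.
move=> uX; rewrite -natr_sum ler_nat.
have -> : (\sum_(x <- X) ((x - c)%R \in L) = count (fun x => (x - c)%R \in L) X)%N.
  by rewrite -sum1_count [RHS]big_mkcond; apply: eq_bigr => x _; case: (_ \in L).
rewrite -size_filter.
rewrite -(size_map (fun v => v - c)); apply: uniq_leq_size.
  by rewrite map_inj_uniq ?filter_uniq // => x y /addIr.
by move=> v /mapP[x]; rewrite mem_filter => /andP[xL _] ->.
Qed.

End Sums.

Lemma lub_exists (R : realType) (T : Type) (P : T -> Prop) (f : T -> R) (b : R) :
  (exists t, P t) -> (forall t, P t -> f t <= b) ->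
  exists m, (forall t, P t -> f t <= m) /\ forall e, 0 < e -> exists2 t, P t & m - e < f t.
Proof.
move=> [t0 Pt0] hb; pose A := (fun y => exists2 t, P t & f t = y) : set R.
have hA : has_sup A.
  split; first by exists (f t0); exists t0.
  by exists b => y [t Pt <-]; apply: hb.
exists (sup A); split.
  by move=> t Pt; apply: sup_upper_bound => //; exists t.
by move=> e e0; have [y [t Pt <-] h] := sup_adherent e0 hA; exists t.
Qed.

Section Shift.
Context {V : zmodType}.
Notation E := {fset V}.
Implicit Types (x y z : V) (e : E).

Definition shift z e : E := [fset (x + z)%R | x in e]%fset.

Lemma mem_shift z e x : (x \in shift z e) = (x - z \in e).
Proof.
apply/imfsetP/idP => [[y ye ->]|h]; first by rewrite addrK.
by exists (x - z) => //; rewrite subrK.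
Qed.

Lemma shift2 z x y : shift z [fset x; y]%fset = [fset (x + z)%R; (y + z)%R]%fset.
Proof. by apply/fsetP => a; rewrite mem_shift !inE !subr_eq. Qed.

Lemma shift1 z x : shift z [fset x]%fset = [fset (x + z)%R]%fset.
Proof. by apply/fsetP => a; rewrite mem_shift !inE !subr_eq. Qed.

Lemma shiftNK z : cancel (shift z) (shift (- z)).
Proof. by move=> e; apply/fsetP => a; rewrite !mem_shift opprK addrK. Qed.

Lemma shiftKN z : cancel (shift (- z)) (shift z).
Proof. by move=> e; apply/fsetP => a; rewrite !mem_shift opprK subrK. Qed.

Lemma card_shift z e : #|` shift z e| = #|` e|.
Proof. by apply: card_imfset; apply: addIr. Qed.

Lemma pedges_shift z x (q : seq V) : pedges (x + z) (map (+%R^~ z) q) = map (shift z) (pedges x q).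
Proof. by elim: q x => //= y q IH x; rewrite IH shift2. Qed.

Lemma walk_shift z n x y w : walk n x y w -> walk n (x + z) (y + z) (fun e => w (shift (- z) e)).
Proof.
move=> [q [h1 h2 h3]]; exists (map (+%R^~ z) q); split.
- elim: q x h1 {h2 h3} => //= a q IH x /andP[h1 h2]; rewrite IH // andbT.
  by rewrite shift2 !addrK.
- by rewrite -h2 -[RHS](last_map (fun v => v + z)%R).
- by apply: short_leq h3; rewrite size_map.
Qed.

Lemma walk_shiftE z n x y w :
  walk n (x + z) (y + z) (fun e => w (shift (- z) e)) <-> walk n x y w.
Proof.
split=> [/(walk_shift (- z))|]; last exact: walk_shift.
rewrite !addrK opprK; congr walk; apply/funext => e; by rewrite shiftNK.
Qed.

Lemma ghost_shiftE z n x w :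
  ghost n (x + z) (fun e => w (shift (- z) e)) <-> ghost n x w.
Proof.
split=> -[y h1 h2].
  exists (y - z); first by apply/(walk_shiftE z); rewrite subrK.
  by rewrite shift1 in h2.
exists (y + z); first exact/walk_shiftE.
by rewrite shift1 addrK.
Qed.

End Shift.

Section Lattice.
Context {R : realType} {V : zmodType} (EL : pred {fset V}).
Notation E := {fset V}.
Hypothesis ELshift : forall z e, EL (shift z e) = EL e.

Definition site (e : E) := #|` e| == 1%N.
(** Singletons are the ghost loops. Admissible lists mix them with lattice edges, so that the same
    estimates serve with and without ghosts. *)
Definition bond_or_site (e : E) := EL e || site e.
Definition adm (s : seq E) := uniq s && all bond_or_site s.

Lemma adm_uniq s : adm s -> uniq s. Proof. by case/andP. Qed.

Lemma adm_undup s : all bond_or_site s -> adm (undup s).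
Proof.
move=> h; rewrite /adm undup_uniq; apply/allP => e; rewrite mem_undup.
exact: (allP h).
Qed.

Lemma adm_filter (q : E -> bool) s : adm s -> adm (seq.filter q s).
Proof.
case/andP=> us /allP h; rewrite /adm filter_uniq //=; apply/allP => e.
by rewrite mem_filter => /andP[_ /h].
Qed.

Lemma adm_shift z s : adm s -> adm (map (shift z) s).
Proof.
case/andP=> us /allP h; rewrite /adm map_inj_uniq ?us; last exact: can_inj (shiftNK z).
by apply/allP => e /mapP[e' /h e's ->]; rewrite /bond_or_site ELshift /site card_shift.
Qed.

Section Law.
Context (pr : E -> R) (pr01 : forall e, 0 <= pr e <= 1).
Hypothesis prshift : forall z e, pr (shift z e) = pr e.

Lemma Pr_shift_walk z s n x y :
  Pr pr (map (shift z) s) (walk n (x + z) (y + z)) = Pr pr s (walk n x y).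
Proof.
rewrite /Pr (Ex_map s _ (shiftNK z) (shiftKN z)) //; apply: eq_Ex => w.
by congr ind; apply/propext; apply: walk_shiftE.
Qed.

Lemma Pr_shift_ghost z s n x :
  Pr pr (map (shift z) s) (ghost n (x + z)) = Pr pr s (ghost n x).
Proof.
rewrite /Pr (Ex_map s _ (shiftNK z) (shiftKN z)) //; apply: eq_Ex => w.
by congr ind; apply/propext; apply: ghost_shiftE.
Qed.

Lemma BK_boxes s D A As : decreasing D -> increasing A ->
  Pr pr s (fun w => D w /\ boxes (A :: As) w) <=
  Pr pr s (fun w => D w /\ A w) * Pr pr s (boxes As).
Proof. by move=> dD iA; exact: (BK pr01 dD iA (@boxes_incr _ As) s). Qed.

Lemma boxes_cons s A As : increasing A ->
  Pr pr s (boxes (A :: As)) <= Pr pr s A * Pr pr s (boxes As).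
Proof.
move=> iA; have decT : decreasing (fun _ : E -> bool => True) by [].
apply: le_trans (_ : Pr pr s (fun w => True /\ boxes (A :: As) w) <= _).
  by apply: Pr_le.
apply: le_trans (BK_boxes s As decT iA) _.
by apply: ler_wpM2r; [apply: Pr_ge0|apply: Pr_le => // w []].
Qed.

Context (tau : V -> R).
Hypothesis tau_ge0 : forall v, 0 <= tau v.
Hypothesis tau_ub : forall s n x y, adm s -> Pr pr s (walk n x y) <= tau (y - x).

Lemma boxes_walk s n x y As : adm s ->
  Pr pr s (boxes (walk n x y :: As)) <= tau (y - x) * Pr pr s (boxes As).
Proof.
move=> ads; apply: le_trans (boxes_cons _ _ (@walk_incr _ _ _ _)) _.
by apply: ler_wpM2r; [apply: Pr_ge0|apply: tau_ub].
Qed.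

Lemma boxes_walk1 s n x y : adm s -> Pr pr s (boxes [:: walk n x y]) <= tau (y - x).
Proof.
move=> ads; apply: le_trans (tau_ub n x y ads); apply: Pr_le => // w.
exact: boxes1 (@walk_incr _ _ _ _).
Qed.

(** The open triangle sum with displacement [w], bounded through its finite partial sums. *)
Definition open_triangle_le (w : V) (eps : R) := forall X A : seq V, uniq X -> uniq A ->
  \sum_(x <- X) \sum_(a <- A) tau x * tau a * tau (a - x - w) <= eps.

Lemma shift_sum2 (X A : seq V) (F : V -> V -> R) b :
  \sum_(x <- X) \sum_(a <- A) F (x - b) (a - b) =
  \sum_(x <- map (fun v => v - b) X) \sum_(a <- map (fun v => v - b) A) F x a.
Proof. by rewrite big_map; apply: eq_bigr => x _; rewrite big_map. Qed.

Lemma uniq_shift (X : seq V) b : uniq X -> uniq (map (fun v => v - b) X).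
Proof. by move=> uX; rewrite map_inj_uniq // => x y /addIr. Qed.

(** [x] and [a] branch off at some [b]. BK leaves [D] on the leg from [c] to [b], and the two other
    legs together with the weight form, seen from [b], an open triangle with displacement [w], whose
    bound is the same for all [b]. *)
Lemma tree_sum s n c D w eps (X A L : seq V) : adm s -> decreasing D ->
  uniq X -> uniq A ->
  (forall cfg b, supported s cfg -> walk n c b cfg -> b \in L) ->
  open_triangle_le w eps ->
  \sum_(x <- X) \sum_(a <- A) tau (a - x - w) *
      Pr pr s (fun cfg => D cfg /\ walk n c x cfg /\ walk None c a cfg)
  <= eps * \sum_(b <- L) Pr pr s (fun cfg => D cfg /\ walk n c b cfg).
Proof.
move=> ads dD uX uA hL ot.
apply: le_trans (_ : \sum_(b <- L) Pr pr s (fun cfg => D cfg /\ walk n c b cfg) *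
   \sum_(x <- X) \sum_(a <- A) tau (x - b) * tau (a - b) * tau ((a - b) - (x - b) - w) <= _).
  have -> : \sum_(b <- L) Pr pr s (fun cfg => D cfg /\ walk n c b cfg) *
     \sum_(x <- X) \sum_(a <- A) tau (x - b) * tau (a - b) * tau ((a - b) - (x - b) - w) =
     \sum_(x <- X) \sum_(a <- A) tau (a - x - w) *
       \sum_(b <- L) Pr pr s (fun cfg => D cfg /\ walk n c b cfg) * (tau (x - b) * tau (a - b)).
    under eq_bigr do rewrite mulr_sumr.
    rewrite exchange_big /=; apply: eq_bigr => x _.
    under eq_bigr do rewrite mulr_sumr.
    rewrite exchange_big /=; apply: eq_bigr => a _.
    rewrite mulr_sumr; apply: eq_bigr => b _.
    have -> : a - b - (x - b) - w = a - x - w by rewrite opprB addrA subrK.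
    ring.
  apply: ler_sum => x _; apply: ler_sum => a _; apply: ler_wpM2l => //.
  apply: le_trans (_ : \sum_(b <- L) Pr pr s (fun cfg => D cfg /\
     boxes [:: walk n c b; walk None b x; walk None b a] cfg) <= _).
    rewrite /Pr -Ex_sum; apply: Ex_le_supp => // cfg sc.
    apply: ind_le_sum => -[Dc [h1 h2]]; have [b hb] := tree_boxes h1 h2.
    exists b => //; apply: (hL cfg) => //.
    by case: hb => I [J [hI _ _ /(walk_incr hI)]].
  apply: ler_sum => b _.
  apply: le_trans (BK_boxes s _ dD (@walk_incr _ n c b)) _.
  apply: ler_wpM2l; first exact: Pr_ge0.
  by apply: le_trans (boxes_walk _ _ _ _ ads) _; rewrite ler_wpM2l // boxes_walk1.
rewrite mulr_sumr; apply: ler_sum => b _; rewrite mulrC ler_wpM2r ?Pr_ge0 //.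
rewrite (shift_sum2 X A (fun x a => tau x * tau a * tau (a - x - w))).
by apply: ot; apply: uniq_shift.
Qed.

End Law.
End Lattice.

(** * Growth of balls *)

Section BallGrowth.
Context {R : realType} {V : zmodType} (EL : pred {fset V}).
Notation E := {fset V}.
Hypothesis ELshift : forall z e, EL (shift z e) = EL e.
Context (pr : E -> R) (pr01 : forall e, 0 <= pr e <= 1).
Hypothesis prshift : forall z e, pr (shift z e) = pr e.
Context (tau : V -> R).
Hypothesis tau_ge0 : forall v, 0 <= tau v.
Hypothesis tau_ub : forall s n x y, adm EL s -> Pr pr s (walk n x y) <= tau (y - x).
Context (ball : nat -> seq V).
Hypothesis ballP : forall (r : nat) s w x y, adm EL s -> supported s w ->
  walk (Some r) x y w -> y - x \in ball r.

Definition ball_sum r s (X : seq V) c := \sum_(x <- X) Pr pr s (walk (Some r) c x).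

Definition growth_spec r g := [/\ 1 <= g,
  forall s X c, adm EL s -> uniq X -> ball_sum r s X c <= g &
  forall eps, 0 < eps -> exists s X, [/\ adm EL s, uniq X & g - eps < ball_sum r s X 0]].

Lemma ball_sum_bound r s X c : adm EL s -> uniq X -> ball_sum r s X c <= (size (ball r))%:R.
Proof.
move=> ads uX; rewrite /ball_sum /Pr -Ex_sum -[leRHS](Ex_const pr s); apply: Ex_le_supp => // w sw.
apply: le_trans (sum_mem_le (ball r) c uX); apply: ler_sum => x _.
by rewrite -ind_bool; apply: ind_le => h; apply: ballP sw h.
Qed.

Lemma ball_sum_shift r s X c : ball_sum r (map (shift c) s) (map (+%R^~ c) X) c = ball_sum r s X 0.
Proof.
rewrite /ball_sum big_map; apply: eq_bigr => x _.
by rewrite -(Pr_shift_walk prshift c s (Some r) 0 x) add0r.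
Qed.

Lemma growth_exists r : exists g, growth_spec r g.
Proof.
pose P (t : seq E * seq V) := adm EL t.1 /\ uniq t.2.
have [|[s X] [/= ads uX]|g [g1 g2]] := @lub_exists R _ P (fun t => ball_sum r t.1 t.2 0) (size (ball r))%:R.
- by exists ([::], [::]).
- exact: ball_sum_bound.
exists g; split.
- have := g1 ([::], [:: 0]); rewrite /P /= => /(_ (conj erefl erefl)).
  apply: le_trans; rewrite /ball_sum big_seq1 /Pr /= ind_true //; exact: walk_refl.
- move=> s X c ads uX.
  have := ball_sum_shift r (map (shift (- c)) s) (map (+%R^~ (- c)) X) c.
  have -> : map (shift c) (map (shift (- c)) s) = s.
    by rewrite -map_comp -[RHS]map_id; apply: eq_map => e; apply: shiftKN.
  have -> : map (+%R^~ c) (map (+%R^~ (- c)) X) = X.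
    by rewrite -map_comp -[RHS]map_id; apply: eq_map => x /=; rewrite subrK.
  move=> ->; apply: (g1 (_, _)); split; rewrite /= ?map_inj_uniq //; last by move=> x y /addIr.
  exact: adm_shift.
- by move=> eps /g2[[s X] [ads uX] h]; exists s, X.
Qed.

(** A supremum over finite lists: it bounds the growth in whatever an exploration leaves over, and
    it is nearly attained on one list, whose translates can be reused. *)
Definition G r := projT1 (cid (growth_exists r)).
Lemma G_spec r : growth_spec r (G r).
Proof. exact: projT2 (cid (growth_exists r)). Qed.

Lemma G_ge1 r : 1 <= G r. Proof. by case: (G_spec r). Qed.
Lemma G_ge0 r : 0 <= G r. Proof. exact: le_trans (G_ge1 r). Qed.
Lemma G_ub r s X c : adm EL s -> uniq X -> ball_sum r s X c <= G r.
Proof. by case: (G_spec r) => _ + _; apply. Qed.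

Lemma G_le_ball r : G r <= (size (ball r))%:R.
Proof.
apply/ler_addgt0Pr => e e0; have [_ _ /(_ e e0)[s [X [ads uX h]]]] := G_spec r.
have := ball_sum_bound r 0 ads uX; lra.
Qed.

(** A walk of length [r + m] is cut after [r] steps; the displacement of the rest lies in [ball m],
    and each displacement contributes at most one ball of radius [r]. *)
Lemma G_add r m : G (r + m) <= (size (ball m))%:R * G r.
Proof.
apply/ler_addgt0Pr => e e0; have [_ _ /(_ e e0)[s [X [ads uX h]]]] := G_spec (r + m).
suff : ball_sum (r + m) s X 0 <= (size (ball m))%:R * G r by lra.
apply: le_trans (_ : \sum_(v <- ball m) \sum_(x <- X) Pr pr s (walk (Some r) 0 (x - v)) <= _).
  rewrite exchange_big; apply: ler_sum => x _; rewrite /Pr -Ex_sum.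
  apply: Ex_le_supp => // w sw; apply: ind_le_sum => -[q [h1 h2 h3]].
  move: h1 h2; rewrite -(cat_take_drop r q) pedges_cat all_cat last_cat => /andP[k1 k2] k3.
  set x' := last 0 (take r q) in k2 k3.
  have w2 : walk (Some m) x' x w.
    by exists (drop r q); split => //; rewrite /= size_drop leq_subLR.
  exists (x - x'); first exact: ballP sw w2.
  rewrite opprB addrC subrK; exists (take r q); split => //.
  by rewrite /= size_take_min geq_minl.
apply: le_trans (_ : \sum_(v <- ball m) G r <= _).
  apply: ler_sum => v _; have := G_ub r 0 ads (uniq_shift v uX).
  by rewrite /ball_sum big_map.
by rewrite big_const_seq count_predT iter_addr_0 mulr_natl.
Qed.

Definition jump_event r w0 x y (w : E -> bool) := [/\ walk (Some r) 0 x w,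
  ~ walk (Some r) 0 (x + w0) w &
  walk (Some r) (x + w0) y (drop_edges w (touch (Some r) 0 w))].

(** Once the ball around 0 is explored, the other edges are resampled and a fresh ball starts at
    [x + w0]. It is lost only by running into an explored vertex [a], possibly [x + w0] itself,
    which costs a connection from [x + w0] to [a]. *)
Lemma Pr_jump r w0 x y s (U := vertices 0 s) : adm EL s ->
  Ex pr s (fun w => ind (walk (Some r) 0 x w) *
    (Pr pr s (walk (Some r) (x + w0) y) -
     \sum_(a <- U) ind (walk None 0 a w) *
       (tau (a - x - w0) * Pr pr s (walk (Some r) a y))))
  <= Pr pr s (jump_event r w0 x y).
Proof.
move=> ads; pose F w v : R := ind (walk (Some r) 0 x w /\ ~ walk (Some r) 0 (x + w0) w) *
  ind (walk (Some r) (x + w0) y v).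
have -> : Pr pr s (jump_event r w0 x y) =
    Ex pr s (fun w => F w (drop_edges w (touch (Some r) 0 w))).
  apply: eq_Ex => w; rewrite /F -ind_and; congr ind; apply/propext.
  by split=> [[? ? ?]|[[? ?] ?]].
rewrite (@Ex_stop _ _ pr s (touch (Some r) 0) F); last first.
  move=> w w' h; split; first by move=> e; rewrite (touch_eq h).
  by move=> v; rewrite /F; congr (ind _ * _); apply/propext; rewrite !(touch_walk _ (@short_rcons _ _) h).
apply: Ex_le_supp => // w sw; rewrite /F ExZ.
case: (pselect (walk (Some r) 0 x w)) => hx; last first.
  by rewrite !ind_false ?mul0r //; case.
rewrite (ind_true hx) mul1r lerBlDr.
pose B a := walk (Some r) 0 a w.
apply: le_trans (_ : Ex pr s (fun w' => ind (~ B (x + w0)) *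
    ind (walk (Some r) (x + w0) y (drop_edges w' (touching B))) +
    \sum_(a <- U) ind (B a) * ind (boxes [:: walk None (x + w0) a; walk (Some r) a y] w')) <= _).
  apply: Ex_le => // w'.
  case: (pselect (walk (Some r) (x + w0) y w')) => [h|h]; last first.
    rewrite ind_false // addr_ge0 ?mulr_ge0 ?ind_ge0 // sumr_ge0 // => *.
    by rewrite mulr_ge0 ?ind_ge0.
  rewrite (ind_true h); have [[h1 h2]|[a Ba h1]] := walk_cut B h.
    rewrite !ind_true // mul1r lerDl sumr_ge0 // => *.
    by rewrite mulr_ge0 ?ind_ge0.
  rewrite -[1]add0r lerD ?mulr_ge0 ?ind_ge0 //.
  rewrite -(ind_true (R := R) h); under eq_bigr do rewrite -ind_and.
  apply: ind_le_sum => _; exists a => //; exact: walk_vertices sw Ba.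
rewrite ExD Ex_sum ExZ lerD //.
  by apply: ler_wpM2r; [apply: Pr_ge0|apply: ind_le].
apply: ler_sum => a _; rewrite ExZ; apply: ler_pM; rewrite ?ind_ge0 ?Pr_ge0 //.
  by apply: ind_le; apply: walk_weak.
apply: le_trans (boxes_walk pr01 tau_ub _ _ _ _ ads) _; rewrite opprD addrA ler_wpM2l //.
by apply: Pr_le => // w'; apply: boxes1 (@walk_incr _ _ _ _).
Qed.

Definition jump_loss r w0 s U x := \sum_(a <- U) tau (a - x - w0) *
  Pr pr s (fun w => True /\ walk (Some r) 0 x w /\ walk None 0 a w).

Lemma jumps_lower r w0 : open_triangle_le tau w0 4^-1 ->
  exists s0 X Y, [/\ adm EL s0, uniq X & uniq Y] /\ forall s, adm EL s -> {subset s0 <= s} ->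
  2^-1 * G r ^+ 2 <= \sum_(x <- X) \sum_(y <- Y) Pr pr s (jump_event r w0 x y).
Proof.
move=> ot; have [G1 _ Gapx] := G_spec r; have G0 := G_ge0 r.
(* Both balls are within a tenth of the supremum and the open triangle takes a quarter: (9/10)^2 -
   1/4 still exceeds 1/2. *)
have [|s1 [X [ads1 uX hX]]] := Gapx (10^-1 * G r); first by rewrite mulr_gt0 //; lra.
(* A copy of the nearly optimal list is placed at every start [x + w0], so that the second ball is
   nearly maximal whichever [x] is used. *)
pose s0 := undup (s1 ++ flatten [seq map (shift (x + w0)) s1 | x <- X]).
pose Y := undup (flatten [seq map (fun y => y + (x + w0)) X | x <- X]).
have all1 : all (bond_or_site EL) s1 by case/andP: ads1.
have ads0 : adm EL s0.
  apply: adm_undup; rewrite all_cat all1; apply/allP => e /flattenP[l /mapP[x _ ->]].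
  by have /andP[_ /allP] := adm_shift ELshift (x + w0) ads1; apply.
exists s0, X, Y; split; first by split => //; apply: undup_uniq.
move=> s ads s0s; set U := vertices 0 s.
have us := adm_uniq ads.
have low1 : 9/10 * G r <= \sum_(x <- X) Pr pr s (walk (Some r) 0 x).
  apply: le_trans (_ : ball_sum r s1 X 0 <= _); first by lra.
  apply: ler_sum => x _; apply: Pr_subset => //; first exact: walk_incr.
    exact: adm_uniq ads1.
  by move=> e e1; apply: s0s; rewrite mem_undup mem_cat e1.
have low2 x : x \in X -> 9/10 * G r <= \sum_(y <- Y) Pr pr s (walk (Some r) (x + w0) y).
  move=> xX; apply: le_trans (_ : ball_sum r s1 X 0 <= _); first by lra.
  rewrite -(ball_sum_shift r s1 X (x + w0)).
  apply: le_trans (_ : ball_sum r s (map (+%R^~ (x + w0)) X) (x + w0) <= _).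
    apply: ler_sum => y _; apply: Pr_subset => //; first exact: walk_incr.
      exact: (adm_uniq (adm_shift ELshift _ ads1)).
    move=> e e1; apply: s0s; rewrite mem_undup mem_cat; apply/orP; right.
    by apply/flattenP; exists (map (shift (x + w0)) s1) => //; apply/mapP; exists x.
  apply: sum_map_le => [||y]; last exact: Pr_ge0.
    by rewrite map_inj_uniq // => y y' /addIr.
  move=> y hy; rewrite mem_undup; apply/flattenP.
  by exists (map (+%R^~ (x + w0)) X) => //; apply/mapP; exists x.
have ubY a : \sum_(y <- Y) Pr pr s (walk (Some r) a y) <= G r.
  by apply: (G_ub r a ads); apply: undup_uniq.
have step x : x \in X ->
    9/10 * G r * Pr pr s (walk (Some r) 0 x) - G r * jump_loss r w0 s U x
    <= \sum_(y <- Y) Pr pr s (jump_event r w0 x y).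
  move=> xX; apply: le_trans (ler_sum _ (fun y _ => Pr_jump r w0 x y ads)).
  rewrite -Ex_sum.
  have -> : 9/10 * G r * Pr pr s (walk (Some r) 0 x) - G r * jump_loss r w0 s U x =
      Ex pr s (fun w => ind (walk (Some r) 0 x w) * (9/10 * G r) -
        G r * \sum_(a <- U) tau (a - x - w0) * (ind (walk (Some r) 0 x w) * ind (walk None 0 a w))).
    rewrite ExB ExZr ExZ Ex_sum mulrC; congr (_ - _ * _); apply: eq_bigr => a _.
    rewrite ExZ; congr (_ * _); apply: eq_Ex => w; rewrite -ind_and; congr ind.
    by apply/propext; tauto.
  apply: Ex_le => // w; rewrite -mulr_sumr sumrB mulrBr lerB //.
    by apply: ler_wpM2l; [apply: ind_ge0|apply: low2].
  rewrite exchange_big /= !mulr_sumr; apply: ler_sum => a _.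
  have -> : \sum_(y <- Y) ind (walk None 0 a w) * (tau (a - x - w0) * Pr pr s (walk (Some r) a y))
     = ind (walk None 0 a w) * tau (a - x - w0) * \sum_(y <- Y) Pr pr s (walk (Some r) a y).
    by rewrite mulr_sumr; apply: eq_bigr => y _; rewrite mulrA.
  have := ubY a; have := ind_ge0 (R := R) (walk None 0 a w).
  have := ind_ge0 (R := R) (walk (Some r) 0 x w); have := tau_ge0 (a - x - w0).
  set i := ind _; set j := ind _; set t := tau _; set S := \sum_(y <- Y) _ => t0 i0 j0 hS.
  have -> : G r * (t * (i * j)) = i * (j * t * G r) by ring.
  apply: ler_wpM2l => //; apply: ler_wpM2l => //; exact: mulr_ge0.
apply: le_trans (_ : \sum_(x <- X) (9/10 * G r * Pr pr s (walk (Some r) 0 x) -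
  G r * jump_loss r w0 s U x) <= _); last first.
  by rewrite big_seq [leRHS]big_seq; apply: ler_sum.
rewrite sumrB -!mulr_sumr.
have tr : \sum_(x <- X) jump_loss r w0 s U x <= 4^-1 * G r.
  have decT : decreasing (fun _ : E -> bool => True) by [].
  apply: le_trans (@tree_sum _ _ _ _ pr01 _ tau_ge0 tau_ub s (Some r) 0 (fun=> True) w0 4^-1
    X U U ads decT uX (undup_uniq _) _ ot) _.
    by move=> cfg b sc; apply: walk_vertices.
  apply: ler_wpM2l; first lra.
  apply: le_trans (G_ub r 0 ads (undup_uniq _)); apply: ler_sum => b _.
  by apply: Pr_le => // w [].
have h1 : 9/10 * G r * (9/10 * G r) <= 9/10 * G r * \sum_(x <- X) Pr pr s (walk (Some r) 0 x).
  by apply: ler_wpM2l => //; lra.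
have h2 := ler_wpM2l G0 tr.
have h3 : 0 <= G r * G r by apply: mulr_ge0.
rewrite expr2; lra.
Qed.

Definition two_legs r r' x y : (E -> bool) -> Prop :=
  boxes [:: walk (Some r) 0 x; walk (Some r') x y].

(** Opening the path from [x] to [x + w0] costs a factor [p] per edge and turns a jump into two
    disjoint legs. They meet at the last vertex of the path in the ball, hence the sum over [k]. *)
Lemma jump_upper r w0 x y kap p s : 0 <= p -> (forall e, EL e -> p <= pr e) ->
  adm EL s -> all EL (pedges 0 kap) -> last 0 kap = w0 ->
  {subset map (shift x) (pedges 0 kap) <= s} ->
  p ^+ size kap * Pr pr s (jump_event r w0 x y) <=
  \sum_(k <- 0 :: kap) Pr pr s (two_legs r (size kap + r) (x + k) y).
Proof.
move=> p0 hp ads kE kw ks; pose k' := map (+%R^~ x) kap.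
have pk : pedges x k' = map (shift x) (pedges 0 kap).
  by rewrite -[x in pedges x](add0r x) pedges_shift.
have lk : last x k' = x + w0.
  by rewrite -kw [x + _]addrC -[RHS](last_map (+%R^~ x)) add0r.
pose f w : R := \sum_(k <- 0 :: kap) ind (two_legs r (size kap + r) (x + k) y w).
have f0 w : 0 <= f w by apply: sumr_ge0 => *; apply: ind_ge0.
apply: le_trans (_ : p ^+ size kap * Ex pr s (fun w => f (cup (of_list (pedges x k')) w)) <= _).
  rewrite ler_wpM2l ?exprn_ge0 //; apply: Ex_le => // w.
  apply: ind_le_sum => -[h1 h2 h3].
  have [c ck hc] := open_jump h1 h2 lk h3.
  exists (c - x); last by rewrite addrC subrK; move: hc; rewrite size_map.
  move: ck; rewrite !in_cons subr_eq0 => /orP[->//|/mapP[k kk ->]].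
  by rewrite addrK kk orbT.
rewrite -[X in \sum_(k <- X) _]/(0 :: kap) /Pr -Ex_sum.
have := @Ex_open_list _ _ _ pr01 p s (pedges x k') f p0.
rewrite size_pedges size_map; apply => //.
  move=> e; rewrite pk => /mapP[e' /(allP kE) e'E ->]; rewrite prshift; exact: hp.
by rewrite pk.
Qed.

Definition tail_le (F : seq V) (eps : R) := forall X Y, uniq X -> uniq Y ->
  \sum_(x <- X) \sum_(y <- Y) ((x \notin F) : nat)%:R * (tau x * tau (y - x) * tau y) <= eps.

Lemma two_legs_count r r' s w y X F (U := vertices 0 s) : adm EL s -> supported s w ->
  uniq X -> 0 \in F ->
  \sum_(x <- X) ind (two_legs r r' x y w) <=
  (size F * (r + r').+1)%:R * ind (walk (Some (r + r')) 0 y w) +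
  \sum_(x <- X) \sum_(u <- U) \sum_(v <- U) ((x - u \notin F) : nat)%:R *
    ind (boxes [:: walk (Some r) 0 u; walk None u x; walk None x v; walk None u v;
              walk (Some r') v y] w) :> R.
Proof.
move=> ads sw uX F0; set S := \sum_(x <- X) \sum_(u <- U) _.
have S0 : 0 <= S.
  by do 3 (apply: sumr_ge0 => ? _); rewrite mulr_ge0 ?ind_ge0.
case: (pselect (walk (Some (r + r')) 0 y w)) => [h|nh]; last first.
  rewrite big1; first by rewrite addr_ge0 // mulr_ge0 ?ind_ge0.
  move=> x _; apply: ind_false => -[I [J [Iw Jw _ h1 [I' [J' [I'J _ _ h2 _]]]]]].
  apply: nh; apply: walk_cat; first exact: (walk_incr Iw h1).
  by apply: walk_incr h2; apply: sub_cfg_trans Jw.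
have [q geo] := geodesic_exists (walk_weak h).
have sq : (size q <= r + r')%N.
  by case: h => q' [h1 h2 h3]; case: geo => _ _ _ qm; apply: leq_trans h3; apply: qm.
have qwalk c : c \in 0 :: q -> c \in U.
  move=> cq; apply: (walk_vertices (n := None) sw).
  by case: geo => _ h1 _ _; apply: walk_vertex h1 _ cq.
rewrite (ind_true h) mulr1.
apply: le_trans (_ : \sum_(x <- X) \sum_(c <- 0 :: q) ((x - c \in F) : nat)%:R + S <= _); last first.
  rewrite lerD2r exchange_big /=.
  apply: le_trans (_ : \sum_(c <- 0 :: q) (size F)%:R <= _).
    by apply: ler_sum => c _; apply: sum_mem_le.
  rewrite big_const_seq count_predT iter_addr_0 -mulrnA ler_nat.
  exact: leq_mul.
rewrite -big_split /=; apply: ler_sum => x _.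
set A := \sum_(c <- _) _; set B := \sum_(u <- U) _.
have A0 : 0 <= A by apply: sumr_ge0 => *; apply: ler0n.
have B0 : 0 <= B by do 2 (apply: sumr_ge0 => ? _); rewrite mulr_ge0 ?ind_ge0.
case: (pselect (two_legs r r' x y w)) => [D|nD]; last by rewrite ind_false // addr_ge0.
rewrite (ind_true D); case: (boolP (has (fun c => x - c \in F) (0 :: q))) => [/hasP[c cq cF]|nF].
  rewrite -[1]addr0 lerD // /A (big_rem c cq) /= cF lerDl.
  by apply: sumr_ge0 => *; apply: ler0n.
have xq : x \notin 0 :: q.
  by apply: contra nF => xq; apply/hasP; exists x => //; rewrite subrr.
have [u [v [uq vq hb]]] := detour_boxes geo D xq.
rewrite -[1]add0r lerD // /B (big_rem u (qwalk u uq)) /= (big_rem v (qwalk v vq)) /=.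
rewrite (ind_true hb).
have -> : x - u \notin F by apply: contra nF => xu; apply/hasP; exists u.
rewrite mulr1 -addrA lerDl; apply: addr_ge0; apply: sumr_ge0 => *;
  rewrite ?mulr_ge0 ?ind_ge0 //.
by apply: sumr_ge0 => *; rewrite mulr_ge0 ?ind_ge0.
Qed.

(** In the detour term, summing over [y] first gives [G r'] for the last leg; the triangle,
    translated by [u], then gives [eps], and the first leg gives [G r]. *)
Lemma two_legs_upper r r' s X Y F eps : adm EL s -> uniq X -> uniq Y -> 0 \in F ->
  tail_le F eps ->
  \sum_(x <- X) \sum_(y <- Y) Pr pr s (two_legs r r' x y) <=
  (size F * (r + r').+1)%:R * G (r + r') + eps * (G r * G r').
Proof.
move=> ads uX uY F0 tl; set U := vertices 0 s.
have uU : uniq U by apply: undup_uniq.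
have eps0 : 0 <= eps.
  by have := tl [::] [::] erefl erefl; rewrite big_nil.
rewrite exchange_big /=.
apply: le_trans (_ : \sum_(y <- Y) ((size F * (r + r').+1)%:R *
    Pr pr s (walk (Some (r + r')) 0 y) +
    \sum_(x <- X) \sum_(u <- U) \sum_(v <- U) ((x - u \notin F) : nat)%:R *
    (Pr pr s (walk (Some r) 0 u) * (tau (x - u) * tau (v - x) * tau (v - u)) *
     Pr pr s (walk (Some r') v y))) <= _).
  apply: ler_sum => y _; rewrite /Pr -Ex_sum.
  apply: le_trans (Ex_le_supp pr01 (fun w sw => two_legs_count r r' y ads sw uX F0)) _.
  rewrite ExD ExZ lerD2l Ex_sum; apply: ler_sum => x _; rewrite Ex_sum.
  apply: ler_sum => u _; rewrite Ex_sum; apply: ler_sum => v _; rewrite ExZ.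
  apply: ler_wpM2l => //.
  apply: le_trans (boxes_cons pr01 _ _ (@walk_incr _ _ _ _)) _.
  rewrite -!mulrA; apply: ler_wpM2l; first exact: Pr_ge0.
  do 3 (apply: le_trans (boxes_walk pr01 tau_ub _ _ _ _ ads) _; apply: ler_wpM2l => //).
  by apply: Pr_le => // w; apply: boxes1 (@walk_incr _ _ _ _).
rewrite big_split /=; apply: lerD.
  by rewrite -mulr_sumr; apply: ler_wpM2l => //; apply: G_ub.
rewrite exchange_big /=.
apply: le_trans (_ : \sum_(x <- X) \sum_(u <- U) \sum_(v <- U) ((x - u \notin F) : nat)%:R *
    (Pr pr s (walk (Some r) 0 u) * (tau (x - u) * tau (v - x) * tau (v - u)) * G r') <= _).
  apply: ler_sum => x _; rewrite exchange_big /=; apply: ler_sum => u _.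
  rewrite exchange_big /=; apply: ler_sum => v _; rewrite -mulr_sumr.
  apply: ler_wpM2l => //; rewrite -mulr_sumr; apply: ler_wpM2l.
    by rewrite mulr_ge0 ?Pr_ge0 // !mulr_ge0.
  exact: G_ub.
rewrite exchange_big /=.
apply: le_trans (_ : \sum_(u <- U) Pr pr s (walk (Some r) 0 u) * (eps * G r') <= _); last first.
  have -> : eps * (G r * G r') = G r * (eps * G r') by ring.
  rewrite -mulr_suml; apply: ler_wpM2r; first by rewrite mulr_ge0 ?G_ge0.
  exact: G_ub.
apply: ler_sum => u _.
have -> : \sum_(x <- X) \sum_(v <- U) ((x - u \notin F) : nat)%:R *
    (Pr pr s (walk (Some r) 0 u) * (tau (x - u) * tau (v - x) * tau (v - u)) * G r') =
    Pr pr s (walk (Some r) 0 u) * ((\sum_(x <- X) \sum_(v <- U)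
     ((x - u \notin F) : nat)%:R * (tau (x - u) * tau ((v - u) - (x - u)) * tau (v - u))) * G r').
  rewrite mulr_suml mulr_sumr; apply: eq_bigr => x _.
  rewrite mulr_suml mulr_sumr; apply: eq_bigr => v _.
  have -> : v - u - (x - u) = v - x by rewrite opprB addrA subrK.
  ring.
apply: ler_wpM2l; first exact: Pr_ge0.
apply: ler_wpM2r; first exact: G_ge0.
rewrite (shift_sum2 X U (fun x v => ((x \notin F) : nat)%:R * (tau x * tau (v - x) * tau v)) u).
by apply: tl; apply: uniq_shift.
Qed.

Context (p : R).
Hypotheses (p_gt0 : 0 < p) (hp : forall e, EL e -> p <= pr e).
Hypothesis connected : forall w : V, exists kap, all EL (pedges 0 kap) /\ last 0 kap = w.
Hypothesis tail : forall eps, 0 < eps -> exists F, 0 \in F /\ tail_le F eps.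
Hypothesis open_triangle : exists w0, open_triangle_le tau w0 4^-1.

Let length_bound (r m : nat) : (1 <= r)%N -> ((r + (m + r)).+1 <= (3 + m) * r)%N.
Proof. nia. Qed.

Lemma G_sq : exists2 C, 1 <= C & forall r : nat, (1 <= r)%N -> G r ^+ 2 <= C * r%:R * G (2 * r).
Proof.
have [w0 ot] := open_triangle; have [kap [kE kw]] := connected w0.
set m := size kap; set b : R := (size (ball m))%:R.
have b0 : 0 <= b by apply: ler0n.
set q := p ^+ m; have q0 : 0 < q by apply: exprn_gt0.
(* With this [eps] the detours use at most q / 4 (G r)^2, half of the lower bound q / 2 (G r)^2. The
   factor m + 1 counts the possible junctions, and [b] compares G (m + r) with G r. *)
pose eps := q / (4 * m.+1%:R * (b + 1)).
have m1 : 0 < m.+1%:R :> R by rewrite ltr0n.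
have eps0 : 0 < eps by rewrite divr_gt0 // !mulr_gt0 //; lra.
have [F [F0 tl]] := tail eps0.
pose C := 4 * m.+1%:R * (size F * (3 + m))%:R * b / q + 1.
exists C; first by rewrite lerDr !mulr_ge0 // invr_ge0 ltW.
move=> r r1.
have [s0 [X [Y [[ads0 uX uY] low]]]] := jumps_lower r ot.
pose s := undup (s0 ++ flatten [seq map (shift x) (pedges 0 kap) | x <- X]).
have ads : adm EL s.
  apply: adm_undup; rewrite all_cat; apply/andP; split; first by case/andP: ads0.
  apply/allP => e /flattenP[l /mapP[x _ ->]] /mapP[e' /(allP kE) e'E ->].
  by rewrite /bond_or_site ELshift e'E.
have {}low : 2^-1 * G r ^+ 2 <=
   \sum_(x <- X) \sum_(y <- Y) Pr pr s (jump_event r w0 x y).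
  by apply: (low s ads) => e es; rewrite mem_undup mem_cat es.
have up : q * (\sum_(x <- X) \sum_(y <- Y) Pr pr s (jump_event r w0 x y)) <=
   m.+1%:R * ((size F * (r + (m + r)).+1)%:R * G (r + (m + r)) + eps * (G r * G (m + r))).
  apply: le_trans (_ : \sum_(k <- 0 :: kap) \sum_(x <- X) \sum_(y <- Y)
      Pr pr s (two_legs r (m + r) (x + k) y) <= _).
    rewrite [leRHS]exchange_big /= mulr_sumr big_seq [leRHS]big_seq; apply: ler_sum => x xX.
    rewrite [leRHS]exchange_big /= mulr_sumr; apply: ler_sum => y _.
    apply: jump_upper => //; first exact: ltW.
    move=> e e1; rewrite mem_undup mem_cat; apply/orP; right; apply/flattenP.
    by exists (map (shift x) (pedges 0 kap)) => //; apply/mapP; exists x.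
  apply: le_trans (_ : \sum_(k <- 0 :: kap) ((size F * (r + (m + r)).+1)%:R * G (r + (m + r))
      + eps * (G r * G (m + r))) <= _).
    apply: ler_sum => k _.
    rewrite -(big_map (fun x => x + k) xpredT (fun x => \sum_(y <- Y) Pr pr s (two_legs r (m + r) x y))).
    apply: (two_legs_upper r (m + r) ads _ uY F0 tl); rewrite map_inj_uniq //; exact: addIr.
  by rewrite big_const_seq count_predT iter_addr_0 [leRHS]mulr_natl.
have g1 : G (m + r) <= b * G r by rewrite addnC; apply: G_add.
have g2 : G (r + (m + r)) <= b * G (2 * r).
  by rewrite addnCA addnn -mul2n addnC; apply: G_add.
have hs : (size F * (r + (m + r)).+1)%:R <= (size F * (3 + m))%:R * r%:R :> R.
  by rewrite -natrM ler_nat -mulnA leq_mul2l length_bound ?orbT.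
set a1 := (size F * (r + (m + r)).+1)%:R in up hs.
set a2 := (size F * (3 + m))%:R in hs C *.
have G0 := G_ge0 r; have G1 := G_ge0 (2 * r); have G2 := G_ge0 (r + (m + r)).
have G3 := G_ge0 (m + r).
have a10 : 0 <= a1 by apply: ler0n.
have a20 : 0 <= a2 by apply: ler0n.
have k1 : a1 * G (r + (m + r)) <= a2 * r%:R * (b * G (2 * r)) by apply: ler_pM.
have k2 : m.+1%:R * (eps * (G r * G (m + r))) <= q / 4 * G r ^+ 2.
  apply: le_trans (_ : m.+1%:R * (eps * (G r * ((b + 1) * G r))) <= _).
    apply: ler_wpM2l; first exact: ltW.
    apply: ler_wpM2l; first exact: ltW.
    apply: ler_wpM2l => //; lra.
  apply: eq_imp_le; rewrite /eps; field.
  by rewrite !gt_eqF //; lra.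
have k3 := ler_wpM2l (ltW m1) k1.
have k4 := ler_wpM2l (ltW q0) low.
have k5 : q / 4 * G r ^+ 2 <= m.+1%:R * (a2 * r%:R * (b * G (2 * r))) by lra.
have k6 : G r ^+ 2 <= (4 * m.+1%:R * a2 * b / q) * r%:R * G (2 * r).
  rewrite -(ler_pM2l (x := q / 4)); last by rewrite divr_gt0 //; lra.
  apply: le_trans k5 _; apply: eq_imp_le; field.
  by rewrite gt_eqF.
apply: le_trans k6 _; apply: ler_wpM2r => //; apply: ler_wpM2r => //.
by rewrite /C lerDl.
Qed.

Lemma sqr_le_expn2 k : (4 <= k)%N -> (k * k <= 2 ^ k)%N.
Proof.
elim: k => // k IH; rewrite leq_eqVlt => /orP[/eqP <- //|k4].
by have := IH k4; rewrite expnS; nia.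
Qed.

(** If G r > 4 C r for some r, then by [G_sq] the excess factor 2 over 2 C r is squared at each
    doubling of the radius. So G (2^k r) grows doubly exponentially in k, which a polynomial bound
    on balls excludes. *)
Lemma G_linear (c D : nat) : (forall r, (size (ball r) <= c * r.+1 ^ D)%N) ->
  exists2 C : R, 0 < C & forall r : nat, (1 <= r)%N -> G r <= C * r%:R.
Proof.
move=> hb; have [C C1 hC] := G_sq; exists (4 * C); first lra.
move=> r r1; rewrite leNgt; apply/negP => big.
have C0 : 0 < C by lra.
have r0 : 0 < r%:R :> R by rewrite ltr0n.
have dbl k : 2 ^+ (2 ^ k) * (2 * C * (2 ^ k * r)%:R) <= G (2 ^ k * r).
  elim: k => [|k IH]; first by rewrite expn0 mul1n expr1; lra.
  set t := (2 ^ k * r)%N in IH *.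
  have t1 : (1 <= t)%N by rewrite muln_gt0 expn_gt0.
  have t0 : 0 < t%:R :> R by rewrite ltr0n.
  have h := hC t t1.
  have -> : (2 ^ k.+1 * r = 2 * t)%N by rewrite expnS mulnA.
  rewrite expnS mulnC exprM natrM.
  set z := 2 ^+ (2 ^ k) in IH *.
  have z0 : 0 <= z by apply: exprn_ge0.
  rewrite -(ler_pM2l (x := C * t%:R)); last exact: mulr_gt0.
  apply: le_trans h; apply: le_trans (_ : (z * (2 * C * t%:R)) ^+ 2 <= _).
    by apply: eq_imp_le; ring.
  by rewrite ler_sqr ?nnegrE ?G_ge0 // mulr_ge0 // !mulr_ge0 // ltW.
(* This [k] gives L + k D < k^2 <= 2^k, so that 2^(2^k) exceeds the polynomial bound at radius 2^k
   r. *)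
pose L := (c * r.+1 ^ D)%N; pose k := (D + L + 4)%N.
have k4 : (4 <= k)%N by rewrite leq_addl.
have e1 : (L + k * D < 2 ^ k)%N.
  by apply: leq_trans (sqr_le_expn2 k4); rewrite /k; nia.
have e2 : (c * (2 ^ k * r).+1 ^ D <= 2 ^ (2 ^ k))%N.
  apply: leq_trans (_ : 2 ^ L * 2 ^ (k * D) <= _)%N; last by rewrite -expnD leq_exp2l // ltnW.
  apply: leq_trans (_ : L * 2 ^ (k * D) <= _)%N; last by rewrite leq_mul2r ltnW ?orbT // ltn_expl.
  rewrite /L -mulnA leq_mul2l expnM -expnMn; apply/orP; right.
  case: (D) => [//|D']; rewrite leq_exp2r // mulSn (mulnC r) -add1n leq_add2r.
  by rewrite expn_gt0.
have := le_trans (dbl k) (G_le_ball _).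
suff : (size (ball (2 ^ k * r)))%:R < 2 ^+ (2 ^ k) * (2 * C * (2 ^ k * r)%:R) :> R by lra.
apply: le_lt_trans (_ : (2 ^ (2 ^ k))%:R < _).
  by rewrite ler_nat; apply: leq_trans (hb _) e2.
rewrite natrX ltr_pMr ?exprn_gt0 //.
have : 1 <= (2 ^ k * r)%:R :> R by rewrite ler1n muln_gt0 expn_gt0.
nra.
Qed.

End BallGrowth.

(** * Branch points *)

Section BranchPoint.
Context {V : zmodType} (EL : pred {fset V}).
Notation E := {fset V}.
Implicit Types (x y z c : V) (w : E -> bool) (e : E).
Hypothesis EL2 : forall e, EL e -> #|` e| = 2%N.
Hypothesis ELshift : forall z e, EL (shift z e) = EL e.
Context (w1 w2 : V) (kap1 kap2 : seq V).
Hypotheses (kE1 : all EL (pedges 0 kap1)) (kw1 : last 0 kap1 = w1).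
Hypotheses (kE2 : all EL (pedges 0 kap2)) (kw2 : last 0 kap2 = w2).

Definition spoke x (kap : seq V) := map (+%R^~ x) kap.
(** Two fixed lattice paths from [x] to [x + w1] and to [x + w2]; opening them merges the cluster of
    0 with the two arms. *)
Definition spokes x := pedges x (spoke x kap1) ++ pedges x (spoke x kap2).
Definition hub x := x :: spoke x kap1 ++ spoke x kap2.

Lemma last_spoke x kap : last x (spoke x kap) = last 0 kap + x.
Proof. by rewrite -[RHS](last_map (+%R^~ x)) add0r. Qed.

Lemma pedges_spoke x kap : pedges x (spoke x kap) = map (shift x) (pedges 0 kap).
Proof. by rewrite -[x in pedges x](add0r x) pedges_shift. Qed.

Lemma spokes_EL x e : e \in spokes x -> EL e.
Proof.
rewrite mem_cat !pedges_spoke => /orP[] /mapP[e' e'k ->]; rewrite ELshift.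
  exact: (allP kE1).
exact: (allP kE2).
Qed.

Lemma spokes_sub x e a : e \in spokes x -> a \in e -> a \in hub x.
Proof.
rewrite mem_cat => /orP[] h /(pedges_sub h); rewrite !inE mem_cat => /orP[->//|->];
by rewrite ?orbT.
Qed.

Lemma hub_center x c : c \in hub x -> walk None x c (of_list (spokes x)).
Proof.
rewrite inE mem_cat orbA => /orP[ck|ck].
  apply: (@walk_vertex _ None x (spoke x kap1)); rewrite ?inE //.
  by apply/allP => e h; rewrite /of_list mem_cat h.
apply: (@walk_vertex _ None x (spoke x kap2)); rewrite ?inE ?ck ?orbT //.
by apply/allP => e h; rewrite /of_list mem_cat h orbT.
Qed.

Lemma hub_connected x c c' : c \in hub x -> c' \in hub x ->
  walk None c c' (of_list (spokes x)).
Proof.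
move=> /hub_center h /hub_center; apply: walk_trans; exact: walk_sym.
Qed.

Lemma hub_end1 x : x + w1 \in hub x.
Proof.
rewrite addrC -kw1 -last_spoke; have := mem_last x (spoke x kap1).
by rewrite !inE mem_cat => /orP[->|->]; rewrite ?orbT.
Qed.

Lemma hub_end2 x : x + w2 \in hub x.
Proof.
rewrite addrC -kw2 -last_spoke; have := mem_last x (spoke x kap2).
by rewrite !inE mem_cat => /orP[->|->]; rewrite ?orbT.
Qed.

Definition off_cluster x w := drop_edges w (touch None x w).

(* The cluster of 0 reaches x but no ghost; next to x start two arms to the
   ghost in two further clusters. *)
Definition double_arm n x w := let v := off_cluster 0 w in
  [/\ walk n 0 x w /\ ~ ghost None 0 w,
      ~ walk None 0 (x + w1) w /\ ghost None (x + w1) v,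
      ~ walk None 0 (x + w2) w, ~ walk None (x + w1) (x + w2) v &
      ghost None (x + w2) (off_cluster (x + w1) v)].

Definition joined n x w := exists2 w0, double_arm n x w0 & w = cup w0 (of_list (spokes x)).

Lemma joined_ghost n x w : joined n x w -> ghost None 0 w.
Proof.
move=> [w0 [[/walk_weak h0 _] [_ [y h1 h2]] _ _ _] ->]; exists y; last first.
  by apply: sub_cupl; move: h2 => /andP[].
apply: walk_trans (walk_incr (@sub_cupl _ _ _) h0) _.
apply: walk_trans (_ : walk None x (x + w1) _) _.
  by apply: walk_incr (hub_center (hub_end1 x)); apply: sub_cupr.
apply: walk_incr h1; apply: (sub_cfg_trans (v := w0)); last exact: sub_cupl.
exact: sub_drop.
Qed.

Section TwoHubs.
Context (n : option nat) (x y : V) (wx wy : E -> bool).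
Hypotheses (hx : double_arm n x wx) (hy : double_arm n y wy).
Hypothesis same : cup wx (of_list (spokes x)) = cup wy (of_list (spokes y)).
Hypothesis dis : forall c, c \in hub x -> c \in hub y -> False.

Let spokes_dis e : e \in spokes x -> e \in spokes y -> False.
Proof.
move=> ex ey; have : #|` e| = 2%N by apply: EL2; apply: spokes_EL ex.
case: (fset_0Vmem e) => [->|[a ae] _]; first by rewrite cardfs0.
exact: dis (spokes_sub ex ae) (spokes_sub ey ae).
Qed.

Let spokes_y : sub_cfg (of_list (spokes y)) wx.
Proof.
move=> e ey; have : cup wx (of_list (spokes x)) e.
  by rewrite same /cup (ey : of_list _ _) orbT.
by case/orP => // ex; case: (spokes_dis ex ey).
Qed.

Let spokes_x : sub_cfg (of_list (spokes x)) wy.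
Proof.
move=> e ex; have : cup wy (of_list (spokes y)) e.
  by rewrite -same /cup (ex : of_list _ _) orbT.
by case/orP => // ey; case: (spokes_dis ex ey).
Qed.

(** An edge open in [wx] but not in [wy] must be a spoke at [y], and a path avoiding the hub of [y]
    contains none. *)
Let transfer a q : all wx (pedges a q) -> (forall c, c \in a :: q -> c \notin hub y) ->
  all wy (pedges a q).
Proof.
move=> h1 h2; apply/allP => e eq_; have : cup wx (of_list (spokes x)) e.
  by rewrite /cup (allP h1).
rewrite same => /orP[//|ey].
have [b [c [eE ba cq]]] := pedges_mem eq_.
have cy : c \in hub y by apply: spokes_sub ey _; rewrite eE !inE eqxx orbT.
by have := h2 c; rewrite inE cq orbT cy => /(_ isT).
Qed.

Let transfer1 c : wx [fset c]%fset -> wy [fset c]%fset.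
Proof.
move=> h; have : cup wx (of_list (spokes x)) [fset c]%fset by rewrite /cup h.
rewrite same => /orP[//|/spokes_EL/EL2]; by rewrite cardfs1.
Qed.

(* If y's configuration connects 0 to the hub of x, then both arms at x must
   run through the hub of y, which joins them. *)
Lemma hub_blocked c : c \in hub x -> walk None 0 c wy -> False.
Proof.
move=> cx w0c.
case: hx => -[h1 h2] [h3 [g1 [q1 [a1 l1 _]] o1]] h4 h5 [g2 [q2 [a2 l2 _]] o2].
case: hy => -[_ nog] _ _ _ _.
have to_y a : a \in hub x -> walk None 0 a wy.
  move=> ax; apply: walk_trans w0c _; apply: walk_incr (hub_connected cx ax).
  exact: spokes_x.
have wx1 : all wx (pedges (x + w1) q1) by apply: sub_cfg_all a1; apply: sub_drop.
have wx2 : all wx (pedges (x + w2) q2).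
  apply: sub_cfg_all a2; apply: (sub_cfg_trans (v := off_cluster 0 wx)); exact: sub_drop.
(* An arm at [x] that missed the hub of [y] would be open in [wy] too and would connect 0 to the
   ghost there. *)
have hit z q g : all wx (pedges z q) -> last z q = g -> wx [fset g]%fset -> z \in hub x ->
    exists2 b, b \in z :: q & b \in hub y.
  move=> aq lq og zx.
  case: (pselect (exists2 b, b \in z :: q & b \in hub y)) => // nb; case: nog.
  exists g; last exact: transfer1.
  apply: walk_trans (to_y z zx) _; exists q; split => //.
  by apply: transfer => // b bq; apply/negP => by_; apply: nb; exists b.
have [b1 b1q b1y] := hit _ _ _ wx1 l1 (sub_drop o1) (hub_end1 x).
have o2' : wx [fset g2]%fset by move: o2 => /andP[/andP[]].
have [b2 b2q b2y] := hit _ _ _ wx2 l2 o2' (hub_end2 x).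
have off1 : ~ walk None 0 b1 wx.
  exact: (off_vertices (B := fun a => walk None 0 a wx) a1 h3).
have nB a : a \in hub y -> ~ walk None 0 a wx.
  move=> ay h; apply: off1; apply: walk_trans h _.
  by apply: walk_incr (hub_connected ay b1y); apply: spokes_y.
have off2 : ~ walk None (x + w1) b2 (off_cluster 0 wx).
  exact: (off_vertices (B := fun a => walk None (x + w1) a (off_cluster 0 wx)) a2 h5).
(* The spokes at [y] are open in [wx] and avoid the cluster of 0, so they join the two arms off that
   cluster, against [double_arm]. *)
apply: off2; apply: walk_trans (walk_vertex (n := None) a1 isT b1q) _.
apply: walk_incr (hub_connected b1y b2y) => e ey.
rewrite /off_cluster /drop_edges (spokes_y ey) /=; apply/negP => /asboolP[a ae].
by apply: nB; apply: spokes_sub ey ae.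
Qed.

End TwoHubs.

(** On a walk from 0 to [x], the part up to the first vertex of either hub is open in both
    configurations. Whichever hub this vertex belongs to, the configuration of the other branch
    point connects 0 to it, which [hub_blocked] forbids. *)
Lemma joined_close n x y w : joined n x w -> joined n y w ->
  exists2 c, c \in hub x & c \in hub y.
Proof.
move=> [wx hx ex] [wy hy ey].
case: (pselect (exists2 c, c \in hub x & c \in hub y)) => // nc; exfalso.
have dis c : c \in hub x -> c \in hub y -> False by move=> cx cy; apply: nc; exists c.
have same : cup wx (of_list (spokes x)) = cup wy (of_list (spokes y)) by rewrite -ex.
case: (hx) => -[[q [h1 h2 _]] _] _ _ _ _.
pose P v := (v \in hub x) || (v \in hub y).
have [|q1 [q2 [qE lP /allP oP]]] := @split_first _ P 0 q.
  by apply/hasP; exists x; [rewrite -h2 mem_last|rewrite /P inE eqxx].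
have hq1 : all wx (pedges 0 q1) by move: h1; rewrite qE pedges_cat all_cat => /andP[].
have hq1y : all wy (pedges 0 q1).
  apply/allP => e eq_; have : cup wx (of_list (spokes x)) e by rewrite /cup (allP hq1).
  rewrite same => /orP[//|ee].
  have [a [b [eE aq _]]] := pedges_mem eq_.
  have ay : a \in hub y by apply: spokes_sub ee _; rewrite eE !inE eqxx.
  by have := oP a aq; rewrite /= /P ay orbT.
case/orP: lP => lP.
  by apply: (hub_blocked hx hy same dis lP); exists q1.
apply: (hub_blocked hy hx (esym same) _ lP); last by exists q1.
by move=> c cy cx; apply: dis cx cy.
Qed.

End BranchPoint.

(** * Counting branch points *)

Section DoubleArm.
Context {R : realType} {V : zmodType} (EL : pred {fset V}).
Notation E := {fset V}.
Hypothesis EL2 : forall e, EL e -> #|` e| = 2%N.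
Hypothesis ELshift : forall z e, EL (shift z e) = EL e.
Context (pr : E -> R) (pr01 : forall e, 0 <= pr e <= 1).
Hypothesis prshift : forall z e, pr (shift z e) = pr e.
Context (tau : V -> R).
Hypothesis tau_ge0 : forall v, 0 <= tau v.
Hypothesis tau_ub : forall s n x y, adm EL s -> Pr pr s (walk n x y) <= tau (y - x).
Context (M : R).
Hypothesis M_ub : forall s a, adm EL s -> Pr pr s (ghost None a) <= M.

Lemma M_ge0 : 0 <= M.
Proof. by apply: le_trans (M_ub 0 (s := [::]) _) => //; apply: Pr_ge0. Qed.

(** The ghost arm leaves the tree at [b] and costs [M]; what remains is an open triangle with
    displacement [z - z']. The sum measures how often a second arm, started at [z'], runs into the
    cluster of [z]. *)
Lemma ghost_tree s z z' U eps : adm EL s -> uniq U ->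
  (forall w b, supported s w -> walk None z b w -> b \in U) ->
  open_triangle_le tau (z - z') eps ->
  \sum_(a <- U) tau (a - z') * Pr pr s (fun w => ghost None z w /\ walk None z a w)
  <= M * eps.
Proof.
move=> ads uU hU ot.
apply: le_trans (_ : M * \sum_(b <- U) \sum_(a <- U) tau (b - z) * tau (a - z') *
    tau ((a - z') - (b - z) - (z - z')) <= _); last first.
  apply: ler_wpM2l; first exact: M_ge0.
  have := ot _ _ (uniq_shift z uU) (uniq_shift z' uU); rewrite big_map.
  by under eq_bigr do rewrite big_map.
rewrite exchange_big mulr_sumr /=; apply: ler_sum => a _; rewrite mulr_sumr.
apply: le_trans (_ : tau (a - z') * \sum_(b <- U) tau (b - z) * (M * tau (a - b)) <= _).
  apply: ler_wpM2l => //.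
  apply: le_trans (_ : \sum_(b <- U) Pr pr s
     (boxes [:: walk None z b; ghost None b; walk None b a]) <= _).
    rewrite /Pr -Ex_sum; apply: Ex_le_supp => // w sw.
    apply: ind_le_sum => -[g h]; have [b hb] := tree_ghost_boxes g h.
    by exists b => //; apply: (hU w) => //; case: hb => I [J [hI _ _ /(walk_incr hI)]].
  apply: ler_sum => b _.
  apply: le_trans (boxes_walk pr01 tau_ub _ _ _ _ ads) _; apply: ler_wpM2l => //.
  apply: le_trans (boxes_cons pr01 _ _ (@ghost_incr _ _ _)) _.
  by apply: ler_pM; rewrite ?Pr_ge0 //; [apply: M_ub|apply: (boxes_walk1 pr01 tau_ub)].
rewrite mulr_sumr; apply: eq_imp_le; apply: eq_bigr => b _.
have -> : a - z' - (b - z) - (z - z') = a - b.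
  by rewrite !opprB addrAC !addrA !subrK.
ring.
Qed.

(** Here [B] is fixed, standing for explored clusters. An arm is lost only by hitting some [a] in
    [B], from which the ghost must still be reached, whence the factor [M]. *)
Lemma ghost_off_lower s z B U m : adm EL s -> m <= Pr pr s (ghost None z) ->
  (forall a, B a -> a \in U) ->
  m - M * \sum_(a <- U) ind (B a) * tau (a - z) <=
  ind (~ B z) * Ex pr s (fun w => ind (ghost None z (drop_edges w (touching B)))).
Proof.
move=> ads hm hU; rewrite -ExZ lerBlDr; apply: le_trans hm _.
apply: le_trans (_ : Ex pr s (fun w => ind (~ B z) * ind (ghost None z (drop_edges w (touching B)))
   + \sum_(a <- U) ind (B a) * ind (boxes [:: walk None z a; ghost None a] w)) <= _).
  apply: Ex_le => // w.
  have S0 : 0 <= \sum_(a <- U) ind (B a) * ind (boxes [:: walk None z a; ghost None a] w) :> R.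
    by apply: sumr_ge0 => a _; rewrite mulr_ge0 ?ind_ge0.
  case: (pselect (ghost None z w)) => [h|h]; last first.
    by rewrite (ind_false h) addr_ge0 // mulr_ge0 ?ind_ge0.
  rewrite (ind_true h); have [[h1 h2]|[a Ba h1]] := ghost_cut B h.
    by rewrite !ind_true // mul1r lerDl.
  rewrite -[1]add0r lerD ?mulr_ge0 ?ind_ge0 //.
  rewrite -(ind_true (R := R) h); under eq_bigr do rewrite -ind_and.
  by apply: ind_le_sum => _; exists a => //; apply: hU.
rewrite ExD lerD2l Ex_sum mulr_sumr; apply: ler_sum => a _; rewrite ExZ.
rewrite mulrCA; apply: ler_wpM2l; first exact: ind_ge0.
apply: le_trans (boxes_walk pr01 tau_ub _ _ _ _ ads) _; rewrite mulrC ler_wpM2r //.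
apply: le_trans (M_ub a ads); apply: Pr_le => // w; exact: boxes1 (@ghost_incr _ _ _).
Qed.

Definition arms (B : V -> Prop) z1 z2 v : Prop := [/\ ~ B z1 /\ ghost None z1 v,
  ~ B z2, ~ walk None z1 z2 v & ghost None z2 (off_cluster z1 v)].

(** The subtracted terms are, in order, the losses when the second arm runs into the cluster of the
    first, the first arm into [B], and the second arm into [B]. The cluster of the first arm is
    explored, so that the second starts afresh off both. *)
Lemma arms_lower s z1 z2 B U m eps : adm EL s -> uniq U -> 0 <= m ->
  m <= Pr pr s (ghost None z1) -> m <= Pr pr s (ghost None z2) ->
  (forall a, B a -> a \in U) ->
  (forall w b, supported s w -> walk None z1 b w -> b \in U) ->
  open_triangle_le tau (z1 - z2) eps ->
  m ^+ 2 - eps * M ^+ 2 - m * M * (\sum_(a <- U) ind (B a) * tau (a - z1))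
    - M ^+ 2 * (\sum_(a <- U) ind (B a) * tau (a - z2)) <=
  Ex pr s (fun w => ind (arms B z1 z2 (drop_edges w (touching B)))).
Proof.
move=> ads uU m0 hm1 hm2 hBU hU ot.
set T1 := \sum_(a <- U) _ * tau (a - z1); set T0 := \sum_(a <- U) _ * tau (a - z2).
pose q : E -> bool := fun e => ~~ touching B e.
pose s' := seq.filter q s.
have ads' : adm EL s' by apply: adm_filter.
have filt f : Ex pr s (fun w => f (drop_edges w (touching B))) = Ex pr s' f.
  exact: (Ex_filter pr s q f).
rewrite (filt (fun v => ind (arms B z1 z2 v))).
pose F v v' : R := ind (~ B z1 /\ ghost None z1 v) * ind (~ B z2 /\ ~ walk None z1 z2 v) *
  ind (ghost None z2 v').
have -> : Ex pr s' (fun v => ind (arms B z1 z2 v)) =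
    Ex pr s' (fun v => F v (drop_edges v (touch None z1 v))).
  apply: eq_Ex => v; rewrite /F -!ind_and; congr ind; apply/propext.
  by split=> [[[? ?] ? ? ?]|[[[? ?] [? ?]] ?]].
rewrite (@Ex_stop _ _ pr s' (touch None z1) F); last first.
  move=> w w' h; split; first by move=> e; rewrite (touch_eq h).
  move=> v; rewrite /F; congr (ind _ * ind _ * _); apply/propext.
    by rewrite (touch_ghost h).
  by rewrite !(touch_walk _ (@short_rcons _ _) h).
apply: le_trans (_ : Ex pr s' (fun v => ind (~ B z1) * ind (ghost None z1 v) *
    (m - M * T0 - M * \sum_(a <- U) ind (walk None z1 a v) * tau (a - z2))) <= _); last first.
  apply: Ex_le_supp => // v sv; rewrite /F.
  have sv' : supported s v by move=> e /sv; rewrite mem_filter => /andP[].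
  rewrite ExZ (ind_and (~ B z1)) -(mulrA (ind _ * ind _)); apply: ler_wpM2l; first by rewrite mulr_ge0 ?ind_ge0.
  pose B' a := B a \/ walk None z1 a v.
  have := @ghost_off_lower s z2 B' U m ads hm2 _.
  rewrite -(filt (fun v' => ind (ghost None z2 (drop_edges v' (touch None z1 v))))).
  have eqd w : drop_edges (drop_edges w (touching B)) (touch None z1 v) =
      drop_edges w (touching B').
    apply/funext => e; rewrite /drop_edges -andbA -negb_or; congr (_ && ~~ _).
    apply/orP/asboolP => [[/asboolP[a ae Ba]|/asboolP[a ae wa]]|[a ae [Ba|wa]]].
    - by exists a => //; left.
    - by exists a => //; right.
    - by left; apply/asboolP; exists a.
    - by right; apply/asboolP; exists a.
  under [in X in _ -> X]eq_Ex do rewrite eqd.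
  have -> : (~ B z2 /\ ~ walk None z1 z2 v) = (~ B' z2).
    apply/propext; rewrite /B'; tauto.
  move=> h; apply: le_trans (h _); last first.
    by move=> a [/hBU//|]; apply: hU.
  rewrite -addrA lerD2l -opprD lerN2 -mulrDr; apply: ler_wpM2l; first exact: M_ge0.
  rewrite -big_split /=; apply: ler_sum => a _; rewrite -mulrDl; apply: ler_wpM2r => //.
  case: (pselect (B' a)) => [Ba|nBa]; last by rewrite ind_false // addr_ge0 ?ind_ge0.
  rewrite (ind_true Ba); case: Ba => Ba; rewrite (ind_true Ba) ?lerDl ?lerDr; exact: ind_ge0.
set Q1 := ind (~ B z1) * Pr pr s' (ghost None z1).
have -> : Ex pr s' (fun v => ind (~ B z1) * ind (ghost None z1 v) *
    (m - M * T0 - M * \sum_(a <- U) ind (walk None z1 a v) * tau (a - z2))) =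
   (m - M * T0) * Q1 - M * ind (~ B z1) *
    \sum_(a <- U) tau (a - z2) * Pr pr s' (fun w => ghost None z1 w /\ walk None z1 a w).
  rewrite /Q1 /Pr.
  have -> : Ex pr s' (fun v => ind (~ B z1) * ind (ghost None z1 v) *
      (m - M * T0 - M * \sum_(a <- U) ind (walk None z1 a v) * tau (a - z2))) =
    Ex pr s' (fun v => (m - M * T0) * (ind (~ B z1) * ind (ghost None z1 v)) -
      M * ind (~ B z1) * \sum_(a <- U) tau (a - z2) * ind (ghost None z1 v /\ walk None z1 a v)).
    apply: eq_Ex => v; rewrite mulrBr; congr (_ - _); first by rewrite mulrC.
    rewrite !mulr_sumr; apply: eq_bigr => a _; rewrite ind_and; ring.
  rewrite ExB !ExZ Ex_sum; congr (_ - _ * _).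
  by apply: eq_bigr => a _; rewrite ExZ.
have M0 := M_ge0.
have T00 : 0 <= T0 by apply: sumr_ge0 => a _; rewrite mulr_ge0 ?ind_ge0.
have Q1M : Q1 <= M.
  rewrite /Q1 -[leRHS]mul1r; apply: ler_pM; rewrite ?ind_ge0 ?ind_le1 ?Pr_ge0 //.
  exact: M_ub.
have Q1m : m - M * T1 <= Q1.
  have := @ghost_off_lower s z1 B U m ads hm1 hBU.
  by rewrite (filt (fun v => ind (ghost None z1 v))).
have tr : \sum_(a <- U) tau (a - z2) *
    Pr pr s' (fun w => ghost None z1 w /\ walk None z1 a w) <= M * eps.
  apply: ghost_tree => // w b sw; apply: hU => e /sw.
  by rewrite mem_filter => /andP[].
set S := \sum_(a <- U) _ * Pr _ _ _ in tr *.
have S0 : 0 <= S by apply: sumr_ge0 => a _; rewrite mulr_ge0 // Pr_ge0.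
have i0 := ind_ge0 (R := R) (~ B z1); have i1 := ind_le1 (R := R) (~ B z1).
have e1 : M * ind (~ B z1) * S <= M * (M * eps).
  rewrite -mulrA; apply: ler_wpM2l => //; apply: le_trans tr.
  by rewrite -[leRHS]mul1r; apply: ler_wpM2r.
have e2 : m * (m - M * T1) <= m * Q1 by apply: ler_wpM2l.
have e3 : M * T0 * Q1 <= M * T0 * M by apply: ler_wpM2l => //; apply: mulr_ge0.
rewrite !expr2; nra.
Qed.

Context (w1 w2 : V) (kap1 kap2 : seq V).
Hypotheses (kE1 : all EL (pedges 0 kap1)) (kw1 : last 0 kap1 = w1).
Hypotheses (kE2 : all EL (pedges 0 kap2)) (kw2 : last 0 kap2 = w2).
Hypotheses (ot1 : open_triangle_le tau w1 10^-1) (ot2 : open_triangle_le tau w2 10^-1).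
Hypothesis ot12 : open_triangle_le tau (w1 - w2) 10^-1.
Context (p : R).
Hypotheses (p_gt0 : 0 < p) (hp : forall e, EL e -> p <= pr e).

Definition lonely n x (w : E -> bool) := ~ ghost None 0 w /\ walk n 0 x w.

(** This is the side condition [D] for BK: it has to survive the tree estimate, so that the losses
    are bounded by a multiple of the sum over lonely points itself. *)
Lemma lonely_decr : decreasing (fun w : E -> bool => ~ ghost None 0 w).
Proof. by move=> u v uv h g; apply: h; apply: ghost_incr g. Qed.

Definition arm_loss n w0 s U x := \sum_(a <- U) tau (a - x - w0) *
  Pr pr s (fun w => ~ ghost None 0 w /\ walk n 0 x w /\ walk None 0 a w).

Lemma double_arm_lower n x s U m : adm EL s -> uniq U -> 0 <= m ->
  m <= Pr pr s (ghost None (x + w1)) -> m <= Pr pr s (ghost None (x + w2)) ->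
  (forall w b, supported s w -> walk None 0 b w -> b \in U) ->
  (forall w b, supported s w -> walk None (x + w1) b w -> b \in U) ->
  (m ^+ 2 - 10^-1 * M ^+ 2) * Pr pr s (lonely n x)
   - m * M * arm_loss n w1 s U x
   - M ^+ 2 * arm_loss n w2 s U x
  <= Pr pr s (double_arm w1 w2 n x).
Proof.
move=> ads uU m0 hm1 hm2 hU0 hU1.
pose F w v : R := ind (lonely n x w) * ind (arms (fun a => walk None 0 a w) (x + w1) (x + w2) v).
have -> : Pr pr s (double_arm w1 w2 n x) =
    Ex pr s (fun w => F w (drop_edges w (touch None 0 w))).
  apply: eq_Ex => w; rewrite /F -ind_and; congr ind; apply/propext.
  rewrite /double_arm /arms /lonely.
  by split=> [[[? ?] [? ?] ? ? ?]|[[? ?] [[? ?] ? ? ?]]].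
rewrite (@Ex_stop _ _ pr s (touch None 0) F); last first.
  move=> w w' h; split; first by move=> e; rewrite (touch_eq h).
  have wE : (fun a => walk None 0 a w) = (fun a => walk None 0 a w').
    by apply/funext => a; apply/propext; apply: touch_walk (@short_rcons _ _) h.
  move=> v; rewrite /F wE; congr (ind _ * _); apply/propext; rewrite /lonely.
  by rewrite (touch_ghost h) (touch_walk (n := n) x _ h).
have -> : (m ^+ 2 - 10^-1 * M ^+ 2) * Pr pr s (lonely n x)
   - m * M * arm_loss n w1 s U x
   - M ^+ 2 * arm_loss n w2 s U x =
  Ex pr s (fun w => ind (lonely n x w) * (m ^+ 2 - 10^-1 * M ^+ 2
     - m * M * (\sum_(a <- U) ind (walk None 0 a w) * tau (a - (x + w1)))
     - M ^+ 2 * (\sum_(a <- U) ind (walk None 0 a w) * tau (a - (x + w2))))).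
  rewrite /Pr -!ExZ.
  have sE w0 : arm_loss n w0 s U x = Ex pr s (fun w => ind (lonely n x w) *
      \sum_(a <- U) ind (walk None 0 a w) * tau (a - (x + w0))).
    under [RHS]eq_Ex do rewrite mulr_sumr.
    rewrite Ex_sum; apply: eq_bigr => a _; rewrite /Pr -ExZ; apply: eq_Ex => w.
    have -> : ind (~ ghost None 0 w /\ walk n 0 x w /\ walk None 0 a w) =
       ind (lonely n x w) * ind (walk None 0 a w) :> R.
      by rewrite -ind_and; congr ind; apply/propext; rewrite /lonely; tauto.
    by rewrite opprD addrA; ring.
  rewrite !sE -!ExZ -!ExB; apply: eq_Ex => w; ring.
apply: Ex_le_supp => // w sw; rewrite /F ExZ; apply: ler_wpM2l; first exact: ind_ge0.
apply: arms_lower => //.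
  by move=> a; apply: hU0 sw.
by rewrite opprD addrACA subrr add0r.
Qed.

Definition hub_offsets := [seq k - k' | k <- hub kap1 kap2 0, k' <- hub kap1 kap2 0].

Lemma hub_shift x : hub kap1 kap2 x = map (+%R^~ x) (hub kap1 kap2 0).
Proof.
rewrite /hub /= add0r map_cat /spoke -!map_comp; congr (_ :: _ ++ _);
by apply: eq_map => k /=; rewrite addr0.
Qed.

(** Two branch points of one configuration have hubs with a common vertex, so all of them lie within
    [hub_offsets] of any one. The indicator stays because a branch point connects 0 to the ghost. *)
Lemma joined_count n L w : uniq L ->
  \sum_(x <- L) ind (joined w1 w2 kap1 kap2 n x w) <=
  (size hub_offsets)%:R * ind (ghost None 0 w) :> R.
Proof.
move=> uL.
case: (pselect (exists x, joined w1 w2 kap1 kap2 n x w)) => [[x0 j0]|nj]; last first.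
  rewrite big1 ?mulr_ge0 ?ind_ge0 // => x _; apply: ind_false => j.
  by apply: nj; exists x.
rewrite (ind_true (joined_ghost kw1 j0)) mulr1.
apply: le_trans (_ : \sum_(x <- L) ((x - x0 \in hub_offsets) : nat)%:R <= _).
  apply: ler_sum => x _; rewrite -ind_bool; apply: ind_le => j.
  have [c] := joined_close EL2 ELshift kE1 kw1 kE2 kw2 j j0.
  rewrite (hub_shift x) (hub_shift x0) => /mapP[k kh ->] /mapP[k' k'h e].
  apply/allpairsP; exists (k', k); split => //=.
  apply/eqP; rewrite subr_eq addrAC eq_sym subr_eq -e addrC; exact/eqP.
exact: sum_mem_le.
Qed.

Lemma branch_bound_fin n L m s : uniq L -> 0 <= m -> 9/10 * M <= m -> m <= M -> adm EL s ->
  (forall w x, supported s w -> walk n 0 x w -> x \in L) ->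
  (forall x, x \in L -> [/\ m <= Pr pr s (ghost None (x + w1)),
      m <= Pr pr s (ghost None (x + w2)) & {subset spokes kap1 kap2 x <= s}]) ->
  p ^+ (size kap1 + size kap2) * (2^-1 * M ^+ 2 * \sum_(x <- L) Pr pr s (lonely n x)) <=
  (size hub_offsets)%:R * M.
Proof.
move=> uL m0 mM mM1 ads hL hx; have M0 := M_ge0.
have mM' : m ^+ 2 >= (9/10 * M) ^+ 2 by rewrite ler_sqr ?nnegrE // mulr_ge0 //; lra.
set k := (size kap1 + size kap2)%N; set N := \sum_(x <- L) Pr pr s (lonely n x).
have N0 : 0 <= N by apply: sumr_ge0 => x _; apply: Pr_ge0.
have q0 : 0 <= p ^+ k by apply: exprn_ge0; apply: ltW.
pose U := undup (vertices 0 s ++ flatten [seq vertices (x + w1) s | x <- L]).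
have uU : uniq U by apply: undup_uniq.
have low : 2^-1 * M ^+ 2 * N <= \sum_(x <- L) Pr pr s (double_arm w1 w2 n x).
  have tr w0 (ot : open_triangle_le tau w0 10^-1) :=
    @tree_sum _ _ _ _ pr01 _ tau_ge0 tau_ub s n 0 _ w0 10^-1 L U L ads lonely_decr uL uU hL ot.
  set S := (fun w0 => \sum_(x <- L) arm_loss n w0 s U x).
  have {}tr w0 : open_triangle_le tau w0 10^-1 -> S w0 <= 10^-1 * N by exact: tr.
  have S0 w0 : 0 <= S w0.
    by do 2 (apply: sumr_ge0 => ? _); rewrite mulr_ge0 // Pr_ge0.
  (* Two nearly maximal arms give 81/100; each of the three losses takes 1/10, which leaves more
     than 1/2. *)
  apply: le_trans (_ : (m ^+ 2 - 10^-1 * M ^+ 2) * N - m * M * S w1 - M ^+ 2 * S w2 <= _).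
    have t1 := tr w1 ot1; have t2 := tr w2 ot2.
    have M20 : 0 <= M ^+ 2 by apply: exprn_ge0.
    have a1 : m * M * S w1 <= M ^+ 2 * (10^-1 * N).
      rewrite expr2; apply: ler_pM => //; first exact: mulr_ge0.
      by apply: ler_wpM2r.
    have a2 : M ^+ 2 * S w2 <= M ^+ 2 * (10^-1 * N) by apply: ler_wpM2l.
    have a3 := ler_wpM2r N0 mM'.
    have e81 : (9/10 : R) ^+ 2 = 81/100 by rewrite expr2; field.
    rewrite exprMn e81 in a3.
    have -> : (m ^+ 2 - 10^-1 * M ^+ 2) * N = m ^+ 2 * N - 10^-1 * (M ^+ 2 * N) by ring.
    have b1 : M ^+ 2 * (10^-1 * N) = 10^-1 * (M ^+ 2 * N) by ring.
    have b2 : 2^-1 * M ^+ 2 * N = 2^-1 * (M ^+ 2 * N) by ring.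
    have b3 : 81/100 * M ^+ 2 * N = 81/100 * (M ^+ 2 * N) by ring.
    rewrite b1 in a1 a2; rewrite b3 in a3; rewrite b2.
    have X0 : 0 <= M ^+ 2 * N by apply: mulr_ge0.
    move: a1 a2 a3 X0; set X := M ^+ 2 * N; set Y := m ^+ 2 * N.
    set A := m * M * S w1; set B := M ^+ 2 * S w2; lra.
  apply: le_trans (_ : \sum_(x <- L) ((m ^+ 2 - 10^-1 * M ^+ 2) * Pr pr s (lonely n x)
   - m * M * arm_loss n w1 s U x
   - M ^+ 2 * arm_loss n w2 s U x) <= _).
    by rewrite !sumrB -!mulr_sumr.
  rewrite big_seq [leRHS]big_seq; apply: ler_sum => x xL; have [h1 h2 _] := hx x xL.
  apply: double_arm_lower => // w b sw hb; rewrite mem_undup mem_cat.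
    by rewrite (walk_vertices sw hb).
  apply/orP; right; apply/flattenP; exists (vertices (x + w1) s).
    by apply/mapP; exists x.
  exact: walk_vertices sw hb.
apply: le_trans (ler_wpM2l q0 low) _; rewrite mulr_sumr.
apply: le_trans (_ : \sum_(x <- L) Pr pr s (joined w1 w2 kap1 kap2 n x) <= _).
  rewrite big_seq [leRHS]big_seq; apply: ler_sum => x xL; have [_ _ sub] := hx x xL.
  have sz : size (spokes kap1 kap2 x) = k by rewrite size_cat !size_pedges !size_map.
  pose f w : R := ind (joined w1 w2 kap1 kap2 n x w).
  have := @Ex_open_list _ _ _ pr01 p s (spokes kap1 kap2 x) f (ltW p_gt0).
  rewrite sz => ope; apply: le_trans (ope _ sub _); last by move=> w; apply: ind_ge0.
    apply: ler_wpM2l => //; apply: Ex_le => // w; apply: ind_le => hw.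
    by exists w => //; rewrite cupC.
  by move=> e /(spokes_EL ELshift kE1 kE2); apply: hp.
apply: le_trans (_ : (size hub_offsets)%:R * Pr pr s (ghost None 0) <= _); last first.
  by apply: ler_wpM2l => //; apply: M_ub.
rewrite /Pr -Ex_sum -ExZ; apply: Ex_le => // w; exact: joined_count.
Qed.

Hypothesis M_approx : forall eps, 0 < eps -> exists2 s, adm EL s & M - eps < Pr pr s (ghost None 0).

(** One factor [M] cancels against the ghost connection made by opening the spokes. [s0] supplies,
    at each [x], the spokes and two translates of a list on which the arm probability is within a
    tenth of [M]. *)
Lemma branch_bound n L : uniq L ->
  (forall s w x, adm EL s -> supported s w -> walk n 0 x w -> x \in L) ->
  exists2 s0, adm EL s0 & forall s, adm EL s -> {subset s0 <= s} ->
  M * \sum_(x <- L) Pr pr s (lonely n x) <=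
  2 * (size hub_offsets)%:R / p ^+ (size kap1 + size kap2).
Proof.
move=> uL hL; have M0 := M_ge0.
have q0 : 0 < p ^+ (size kap1 + size kap2) by apply: exprn_gt0.
have [M00|Mn0] := eqVneq M 0.
  by exists [::] => // s _ _; rewrite M00 mul0r divr_ge0 ?mulr_ge0 // ltW.
have Mgt : 0 < M by rewrite lt_neqAle eq_sym Mn0.
have [|s1 ads1 hs1] := M_approx (eps := 10^-1 * M); first by apply: mulr_gt0 => //; lra.
set m := Pr pr s1 (ghost None 0) in hs1.
pose s0 := undup (flatten [seq map (shift (x + w1)) s1 ++ map (shift (x + w2)) s1 ++
   spokes kap1 kap2 x | x <- L]).
have all_sh z : all (bond_or_site EL) (map (shift z) s1).
  by case/andP: (adm_shift ELshift z ads1).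
exists s0.
  apply: adm_undup; apply/allP => e /flattenP[l /mapP[x _ ->]].
  rewrite 2!mem_cat => /or3P[/(allP (all_sh _))//|/(allP (all_sh _))//|ex].
  by rewrite /bond_or_site (spokes_EL ELshift kE1 kE2 ex).
move=> s ads ss.
have sub0 x e : x \in L -> e \in map (shift (x + w1)) s1 ++ map (shift (x + w2)) s1 ++
   spokes kap1 kap2 x -> e \in s.
  move=> xL el; apply: ss; rewrite mem_undup; apply/flattenP; eexists; last exact: el.
  by apply/mapP; exists x.
have trans z : {subset map (shift z) s1 <= s} -> m <= Pr pr s (ghost None z).
  move=> sub; rewrite /m -(Pr_shift_ghost prshift z) add0r.
  apply: Pr_subset sub => //; first exact: ghost_incr.
    exact: (adm_uniq (adm_shift ELshift z ads1)).
  exact: (adm_uniq ads).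
have hx x : x \in L -> [/\ m <= Pr pr s (ghost None (x + w1)),
      m <= Pr pr s (ghost None (x + w2)) & {subset spokes kap1 kap2 x <= s}].
  move=> xL; split; [apply: trans|apply: trans|] => e e1; apply: (sub0 x e xL);
  by rewrite 2!mem_cat e1 ?orbT.
have mM : 9/10 * M <= m by lra.
have hLs w x := hL s w x ads.
have := branch_bound_fin uL (Pr_ge0 pr01 _ _) mM (M_ub 0 ads1) ads hLs hx.
set N := \sum_(x <- L) _; set q := p ^+ _ in q0 *; set K := (size hub_offsets)%:R => h.
rewrite -(ler_pM2l (x := 2^-1 * M * q)); last by rewrite !mulr_gt0 // invr_gt0; lra.
have -> : 2^-1 * M * q * (2 * K / q) = K * M by field; rewrite gt_eqF.
by apply: le_trans h; apply: eq_imp_le; ring.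
Qed.

End DoubleArm.

(** * The ghost field and cluster volume *)

Section MoreExpectation.
Context {R : realFieldType} {E : choiceType}.
Implicit Types (pr : E -> R) (s T : seq E).

Lemma Ex_zero pr s (q : E -> bool) f : (forall e, e \in s -> ~~ q e -> pr e = 0) ->
  Ex pr s f = Ex pr (seq.filter q s) f.
Proof.
elim: s f => [//|e s IH] f h /=; have {}IH f' : Ex pr s f' = Ex pr (seq.filter q s) f'.
  by apply: IH => e' es; apply: h; rewrite inE es orbT.
case qe : (q e) => /=; first by rewrite !IH.
by rewrite !IH h ?inE ?eqxx ?qe // mul0r add0r subr0 mul1r.
Qed.

Lemma Ex_edge pr s e : (forall e, 0 <= pr e <= 1) -> uniq s ->
  Ex pr s (fun w => ind (w e)) <= pr e.
Proof.
move=> pr01 us; have /andP[p0 p1] := pr01 e.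
have -> : Ex pr s (fun w => ind (w e)) = Ex pr (seq.filter (pred1 e) s) (fun w => ind (w e)).
  by rewrite -Ex_filter; apply: eq_Ex => w; rewrite /keep /= eqxx andbT.
have [es|/negP es] := boolP (e \in s).
  rewrite filter_pred1_uniq //= ind_true /open_edge ?eqxx // ind_false //.
  by rewrite mulr1 mulr0 addr0.
rewrite (_ : seq.filter _ s = [::]) /= ?ind_false //.
apply/eqP; rewrite -size_eq0 size_filter -leqn0 leqNgt -has_count.
by apply/negP => /hasP[f fs /eqP fe]; case: es; rewrite -fe.
Qed.

Lemma Ex_all_closed pr s T (h : R) : (forall e, 0 <= pr e <= 1) -> uniq T ->
  {subset T <= s} -> (forall e, e \in T -> pr e = h) ->
  Ex pr s (fun w => ind (forall e, e \in T -> ~~ w e)) <= (1 - h) ^+ size T.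
Proof.
move=> pr01; elim: s T => [|e s IH] T uT Ts hT.
  case: T uT Ts hT => [|e T] _ Ts _; first by rewrite expr0 ind_le1.
  by have := Ts e; rewrite inE eqxx => /(_ isT).
have p0 : 0 <= 1 - pr e by case/andP: (pr01 e); rewrite subr_ge0.
rewrite /=; have [eT|neT] := boolP (e \in T).
  rewrite [X in _ * X + _](_ : _ = 0); last first.
    rewrite -[RHS](Ex_const pr s); apply: eq_Ex => w; apply: ind_false => /(_ e eT).
    by rewrite /open_edge eqxx.
  rewrite mulr0 add0r hT //.
  have -> : size T = (size (rem e T)).+1 by rewrite (perm_size (perm_to_rem eT)).
  rewrite exprS; apply: ler_wpM2l; first by rewrite -(hT e eT).
  apply: le_trans (_ : Ex pr s (fun w => ind (forall e', e' \in rem e T -> ~~ w e')) <= _).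
    by apply: Ex_le => // w; apply: ind_le => h1 e' /mem_rem; apply: h1.
  apply: IH; first exact: rem_uniq.
    move=> e'; rewrite mem_rem_uniq // inE => /andP[ne /Ts].
    by rewrite inE (negPf ne).
  by move=> e' /mem_rem; apply: hT.
have Ts' : {subset T <= s}.
  move=> e' e'T; have := Ts e' e'T; rewrite inE => /orP[/eqP ee|//].
  by rewrite -ee e'T in neT.
have -> : Ex pr s (fun w => ind (forall e', e' \in T -> ~~ open_edge e w e')) =
    Ex pr s (fun w => ind (forall e', e' \in T -> ~~ w e')).
  apply: eq_Ex => w; congr ind; apply/propext; split => h1 e' e'T; have := h1 e' e'T.
    by rewrite /open_edge negb_or => /andP[].
  rewrite /open_edge negb_or => ->; rewrite andbT.
  by apply: contraNneq neT => <-.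
by rewrite -mulrDl addrC subrK mul1r; apply: IH.
Qed.

End MoreExpectation.

Section Bonds.
Context {V : choiceType}.
Notation E := {fset V}.
Implicit Types w : E -> bool.

Definition bond (e : E) := #|` e| != 1%N.

Lemma walk_bonds n (x y : V) w : walk n x y w -> walk n x y (keep w bond).
Proof.
move=> [q0 [/uniq_walk[q [h1 h2 h3 h4 _]] h5 h6]]; exists q; split.
- apply/allP => e eq_; rewrite /keep (allP h2 e eq_) /=.
  have [a [b [ab ae be]]] := pedges_card h1 eq_.
  apply/negP => /cardfs1P[c ec]; move: ae be ab; rewrite ec !inE => /eqP -> /eqP ->.
  by rewrite eqxx.
- by rewrite h3.
- exact: short_leq h6.
Qed.

Lemma walk_bondsE n (x y : V) w : walk n x y (keep w bond) <-> walk n x y w.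
Proof. by split; [apply: walk_incr; apply: sub_keep|apply: walk_bonds]. Qed.

Definition escape (X : seq V) (o : V) w := exists2 y, y \notin X & walk None o y w.

Definition large n (o : V) w := exists Y : seq V,
  [/\ uniq Y, size Y = n & forall y, y \in Y -> walk None o y w].

(** A simple walk inside [X] has fewer edges than [X] has points, so without escape the cluster of
    [o] is contained in a ball of fixed radius. *)
Lemma no_escape_short X o w y : ~ escape X o w -> walk None o y w ->
  walk (Some (size X)) o y w.
Proof.
move=> ne [q0 [/uniq_walk[q [h1 h2 h3 h4 _]] h5 h6]]; exists q; split; rewrite ?h3 //=.
apply: ltnW; rewrite -[(size q).+1]/(size (o :: q)); apply: uniq_leq_size => // c cq.
case: (boolP (c \in X)) => // cX; case: ne; exists c => //.
exact: (walk_vertex (n := None) h2).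
Qed.

End Bonds.

(** * Magnetization and its doubling inequality *)

Section Magnetization.
Context {R : realType} {V : zmodType} (EL : pred {fset V}).
Notation E := {fset V}.
Hypothesis EL2 : forall e, EL e -> #|` e| = 2%N.
Hypothesis ELshift : forall z e, EL (shift z e) = EL e.
Context (pc : R) (tau : V -> R).
Hypothesis pc01 : 0 <= pc <= 1.
Hypothesis tau_ge0 : forall v, 0 <= tau v.
Hypothesis tau_ub : forall s n x y, adm EL s -> Pr (fun=> pc) s (walk n x y) <= tau (y - x).
Context (ball : nat -> seq V).
Hypothesis ballP : forall (r : nat) s w x y, adm EL s -> supported s w ->
  walk (Some r) x y w -> y - x \in ball r.
Context (w1 w2 : V) (kap1 kap2 : seq V).
Hypotheses (kE1 : all EL (pedges 0 kap1)) (kw1 : last 0 kap1 = w1).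
Hypotheses (kE2 : all EL (pedges 0 kap2)) (kw2 : last 0 kap2 = w2).
Hypotheses (ot1 : open_triangle_le tau w1 10^-1) (ot2 : open_triangle_le tau w2 10^-1).
Hypothesis ot12 : open_triangle_le tau (w1 - w2) 10^-1.
Context (p0 p : R).
Hypotheses (p0_gt0 : 0 < p0) (p0p : p0 <= p) (ppc : p <= pc).
Hypothesis no_percolation : forall eta, 0 < eta -> exists X : seq V, forall s,
  adm EL s -> Pr (fun=> p) s (escape X 0) <= eta.

Let p01 : 0 <= p <= 1.
Proof. by case/andP: pc01 => _ h; apply/andP; split; move: p0_gt0 p0p ppc; lra. Qed.

Definition law t (e : E) : R := if bond e then p else 1 - expR (- t).

Lemma law01 t : 0 <= t -> forall e, 0 <= law t e <= 1.
Proof.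
move=> t0 e; rewrite /law; case: ifP => _ //.
have h1 := expR_gt0 (- t); have : expR (- t) <= 1 by rewrite expR_le1 oppr_le0.
by move=> h2; apply/andP; split; lra.
Qed.

Lemma law_shift t z e : law t (shift z e) = law t e.
Proof. by rewrite /law /bond card_shift. Qed.

Lemma law_EL t e : EL e -> p0 <= law t e.
Proof. by move=> /EL2 e2; rewrite /law /bond e2. Qed.

Lemma law_bonds t s f :
  Ex (law t) s (fun w => f (keep w bond)) = Ex (fun=> p) (seq.filter bond s) f.
Proof.
rewrite Ex_filter; apply: eq_Ex_pr => e; rewrite mem_filter /law => /andP[-> _] //.
Qed.

Lemma law_tau t s n x y : adm EL s -> Pr (law t) s (walk n x y) <= tau (y - x).
Proof.
move=> ads; have -> : Pr (law t) s (walk n x y) = Pr (fun=> p) (seq.filter bond s) (walk n x y).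
  rewrite /Pr -(law_bonds t s (fun w => ind (walk n x y w))); apply: eq_Ex => w.
  by congr ind; apply/propext; split => /walk_bondsE.
have := tau_ub n x y (adm_filter bond ads); apply: le_trans.
apply: Ex_le_pr => // u v uv; apply: ind_le; exact: walk_incr.
Qed.

Lemma law_escape t s X eta : adm EL s ->
  (forall s, adm EL s -> Pr (fun=> p) s (escape X 0) <= eta) ->
  Pr (law t) s (escape X 0) <= eta.
Proof.
move=> ads h; apply: le_trans (h _ (adm_filter bond ads)).
rewrite /Pr -(law_bonds t s (fun w => ind (escape X 0 w))) le_eqVlt.
apply/orP; left; apply/eqP; apply: eq_Ex => w; congr ind; apply/propext.
by split => -[y yX] /walk_bondsE; exists y.
Qed.

Definition mag_spec t m := (forall s a, adm EL s -> Pr (law t) s (ghost None a) <= m) /\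
  forall eps, 0 < eps -> exists2 s, adm EL s & m - eps < Pr (law t) s (ghost None 0).

Lemma mag_exists t : exists m, 0 <= t -> mag_spec t m.
Proof.
case: (lerP 0 t) => t0; last by exists 0 => h; move: t0; lra.
have [||m [m1 m2]] := @lub_exists R _ (adm EL) (fun s => Pr (law t) s (ghost None 0)) 1.
- by exists [::].
- by move=> s _; apply: (Pr_le1 (law01 t0)).
exists m => _; split; last by move=> eps /m2[s ads h]; exists s.
move=> s a ads.
have := Pr_shift_ghost (law_shift t) (- a) s None a; rewrite subrr => <-.
by apply: m1; apply: adm_shift.
Qed.

Definition mag t := projT1 (cid (mag_exists t)).
Lemma magP t : 0 <= t -> mag_spec t (mag t).
Proof. exact: projT2 (cid (mag_exists t)). Qed.

Lemma mag_ge0 t : 0 <= t -> 0 <= mag t.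
Proof.
move=> t0; have [h _] := magP t0.
by apply: le_trans (h [::] 0 isT) => //; apply: (Pr_ge0 (law01 t0)).
Qed.

Definition sprinkle t (e : E) : R := if bond e then 0 else 1 - expR (- t).
Definition bond_law (e : E) : R := if bond e then p else 0.

Lemma sprinkle01 t : 0 <= t -> forall e, 0 <= sprinkle t e <= 1.
Proof.
by move=> t0 e; have := law01 t0 e; rewrite /sprinkle /law; case: ifP => //; rewrite lexx ler01.
Qed.

Lemma law_double t s f : Ex (law (t + t)) s f =
  Ex (law t) s (fun w => Ex (sprinkle t) s (fun u => f (cup w u))).
Proof.
apply: Ex_cup => e; rewrite /law /sprinkle; case: ifP => _; first by rewrite subr0 mulr1.
by rewrite (opprD t) expRD; ring.
Qed.

Lemma law_recombine t s f : Ex (law t) s f =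
  Ex bond_law s (fun w => Ex (sprinkle t) s (fun u => f (cup w u))).
Proof.
apply: Ex_cup => e; rewrite /law /sprinkle /bond_law.
by case: ifP => _; rewrite subr0 ?mulr1 ?mul1r.
Qed.

Lemma sprinkle_sites t s f :
  Ex (sprinkle t) s f = Ex (sprinkle t) s (fun u => f (keep u (fun e => ~~ bond e))).
Proof.
rewrite Ex_filter; apply: Ex_zero => e _; rewrite negbK /sprinkle => -> //.
Qed.

Lemma ghost_cup (w u : E -> bool) (x : V) : (forall e, u e -> ~~ bond e) -> ghost None x (cup w u) ->
  exists2 y, walk None x y (keep w bond) & w [fset y]%fset || u [fset y]%fset.
Proof.
move=> us [y /walk_bonds h1 h2]; exists y => //; apply: walk_incr h1 => e.
rewrite /keep /cup => /andP[/orP[->//|/us /negPf ->]] //.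
Qed.

(** At 2t the ghosts are the union of two independent fields of intensity t, and each of them is
    reached with probability at most [mag t]. *)
Lemma mag_double t : 0 <= t -> mag (t + t) <= 2 * mag t.
Proof.
move=> t0; have tt0 : 0 <= t + t by apply: addr_ge0.
apply/ler_addgt0Pr => eps e0; have [_ /(_ eps e0)[s ads hs]] := magP tt0.
suff : Pr (law (t + t)) s (ghost None 0) <= 2 * mag t by move: hs; lra.
have hm := (magP t0).1 s 0 ads.
apply: le_trans (_ : Pr (law t) s (ghost None 0) + Ex (law t) s (fun w =>
  Ex (sprinkle t) s (fun u => ind (ghost None 0 (cup (keep w bond) u)))) <= _).
  rewrite /Pr law_double -ExD; apply: Ex_le; first exact: law01.
  move=> w; rewrite -(Ex_const (sprinkle t) s (ind (ghost None 0 w))) -ExD.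
  rewrite sprinkle_sites [leRHS]sprinkle_sites; apply: Ex_le; first exact: sprinkle01.
  move=> u; set v := keep u _.
  case: (pselect (ghost None 0 (cup w v))) => [h|h]; last first.
    by rewrite (ind_false h) addr_ge0 ?ind_ge0.
  rewrite (ind_true h); have [|y hy /orP[wy|vy]] := ghost_cup _ h.
  - by move=> e /andP[].
  - rewrite ind_true ?lerDl ?ind_ge0 //; exists y => //; exact: walk_incr (@sub_keep _ _ _) hy.
  - rewrite [X in _ <= _ + X]ind_true ?lerDr ?ind_ge0 //; exists y.
      by apply: walk_incr hy; apply: sub_cupl.
    by rewrite /cup vy orbT.
suff : Ex (law t) s (fun w => Ex (sprinkle t) s (fun u => ind (ghost None 0 (cup (keep w bond) u))))
    = Pr (law t) s (ghost None 0) by move=> ->; move: hm; lra.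
rewrite /Pr [RHS]law_recombine.
rewrite (law_bonds t s (fun w => Ex (sprinkle t) s (fun u => ind (ghost None 0 (cup w u))))).
rewrite [RHS](@Ex_zero _ _ bond_law s bond); last by move=> e _; rewrite /bond_law => /negPf ->.
by apply: eq_Ex_pr => e; rewrite mem_filter /bond_law => /andP[->].
Qed.

Let C := 2 * (size (hub_offsets kap1 kap2))%:R / p0 ^+ (size kap1 + size kap2).

(** A ghost connection at 2t that is absent at t uses a point of a lonely cluster marked by the
    second field, which marks each point with probability at most t; [branch_bound] controls [mag t]
    times the expected number of such points. *)
Lemma mag_step t : 0 <= t -> mag t * mag (t + t) <= mag t ^+ 2 + C * t.
Proof.
move=> t0; have tt0 : 0 <= t + t by apply: addr_ge0.
have a0 := mag_ge0 t0; have b0 := mag_ge0 tt0.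
have [hub happ] := magP t0.
apply/ler_addgt0Pr => eps e0.
(* Spent twice: on the approximation of [mag (t + t)] and on clusters escaping from [X]. All other
   clusters live in the finite list [L]. *)
pose eta := eps / (2 * (mag t + 1)).
have eta0 : 0 < eta by rewrite divr_gt0 // mulr_gt0 //; lra.
have [X hX] := no_percolation eta0.
pose n := Some (size X); pose L := undup (ball (size X)).
have hL s w x : adm EL s -> supported s w -> walk n 0 x w -> x \in L.
  by move=> ads sw h; rewrite mem_undup; have := ballP ads sw h; rewrite subr0.
have [s0 ads0 hs0] := branch_bound EL2 ELshift (law01 t0) (law_shift t) tau_ge0
  (law_tau t) hub kE1 kw1 kE2 kw2 ot1 ot2 ot12 p0_gt0 (law_EL t) happ (undup_uniq _) hL.
have [_ /(_ eta eta0)[s1 ads1 hs1]] := magP tt0.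
pose s := undup (s0 ++ s1).
have ads : adm EL s.
  by apply: adm_undup; rewrite all_cat; apply/andP; split; [case/andP: ads0|case/andP: ads1].
have {}hs0 : mag t * \sum_(x <- L) Pr (law t) s (lonely n x) <= C.
  by apply: hs0 => // e es; rewrite mem_undup mem_cat es.
have {}hs1 : mag (t + t) - eta < Pr (law (t + t)) s (ghost None 0).
  apply: lt_le_trans hs1 _; apply: (Pr_subset (law01 tt0) (@ghost_incr _ _ _)).
  - exact: (adm_uniq ads1).
  - exact: (adm_uniq ads).
  - by move=> e es; rewrite mem_undup mem_cat es orbT.
set N := \sum_(x <- L) _ in hs0.
have N0 : 0 <= N by apply: sumr_ge0 => x _; apply: (Pr_ge0 (law01 t0)).
have up : Pr (law (t + t)) s (ghost None 0) <= mag t + eta + t * N.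
  apply: le_trans (_ : Pr (law t) s (ghost None 0) + Pr (law t) s (escape X 0) +
     t * N <= _); last first.
    by rewrite lerD2r lerD //; [apply: hub|apply: law_escape].
  rewrite /N mulr_sumr /Pr law_double -ExD.
  under [X in _ <= _ + X]eq_bigr do rewrite -ExZ.
  rewrite -Ex_sum -ExD; apply: Ex_le_supp; first exact: law01.
  move=> w sw.
  apply: le_trans (_ : Ex (sprinkle t) s (fun u => ind (ghost None 0 w) + ind (escape X 0 w) +
     \sum_(x <- L) ind (lonely n x w) * ind (u [fset x]%fset)) <= _).
    rewrite sprinkle_sites [leRHS]sprinkle_sites; apply: Ex_le; first exact: sprinkle01.
    move=> u; set v := keep u _.
    set S := \sum_(x <- L) _.
    have S0 : 0 <= S by apply: sumr_ge0 => x _; rewrite mulr_ge0 ?ind_ge0.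
    have i1 := ind_ge0 (R := R) (ghost None 0 w); have i2 := ind_ge0 (R := R) (escape X 0 w).
    case: (pselect (ghost None 0 w)) => gw.
      rewrite (ind_true gw); apply: le_trans (ind_le1 _) _.
      by rewrite -addrA lerDl addr_ge0.
    case: (pselect (escape X 0 w)) => ew.
      rewrite (ind_true ew); apply: le_trans (ind_le1 _) _.
      by rewrite addrAC lerDr addr_ge0.
    rewrite -[leLHS]add0r lerD ?addr_ge0 // /S.
    under eq_bigr do rewrite -ind_and.
    apply: ind_le_sum => h; have [|y hy wvy] := ghost_cup _ h; first by move=> e /andP[].
    have {}hy : walk None 0 y w by apply: walk_incr hy; apply: sub_keep.
    have hyn := no_escape_short ew hy.
    exists y; first exact: hL ads sw hyn.
    split => //; case/orP: wvy => // wy; case: gw; by exists y.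
  rewrite ExD Ex_const lerD2l Ex_sum; apply: ler_sum => x _.
  rewrite ExZ mulrC; apply: ler_wpM2r; first exact: ind_ge0.
  apply: le_trans (Ex_edge _ (sprinkle01 t0) (adm_uniq ads)) _.
  rewrite /sprinkle /bond cardfs1 /= lerBlDr -lerBlDl.
  by have := expR_ge1Dx (- t); lra.
have e1 : mag t * mag (t + t) <= mag t * (mag t + 2 * eta + t * N).
  by apply: ler_wpM2l => //; move: hs1 up; lra.
have e2 : mag t * (2 * eta) <= eps.
  rewrite /eta; have -> : mag t * (2 * (eps / (2 * (mag t + 1)))) = eps * (mag t / (mag t + 1)).
    by field; apply/negP => /eqP; lra.
  by rewrite ger_pMr // ler_pdivrMr; lra.
have e3 : t * (mag t * N) <= t * C by apply: ler_wpM2l.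
rewrite expr2; nra.
Qed.

Lemma C_ge0 : 0 <= C.
Proof. by rewrite divr_ge0 ?mulr_ge0 // exprn_ge0 // ltW. Qed.

(** Let a = mag t and b = mag (2t), with b >= a. Since b <= 2a, b^2 - a^2 = (b - a)(b + a) <= 3 a (b
    - a), and a (b - a) <= C t is [mag_step]. This is the discrete form of a bound on the derivative
    of the square. *)
Lemma mag_sqr_double t : 0 <= t -> mag (t + t) ^+ 2 <= mag t ^+ 2 + 3 * C * t.
Proof.
move=> t0; have h1 := mag_double t0; have h2 := mag_step t0.
have a0 := mag_ge0 t0; have b0 := mag_ge0 (addr_ge0 t0 t0).
have c0 : 0 <= C * t by apply: mulr_ge0 => //; apply: C_ge0.
rewrite !expr2 in h2 *; case: (lerP (mag (t + t)) (mag t)) => h; nra.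
Qed.

(** Reaching the ghost takes either leaving [X] or a ghost at one of the finitely many points of
    [X]; the second probability vanishes with t. *)
Lemma mag_small eta : 0 < eta -> exists2 t0, 0 < t0 & forall t, 0 <= t -> t <= t0 -> mag t <= eta.
Proof.
move=> eta0; have [|X hX] := no_percolation (eta := eta / 4); first by rewrite divr_gt0.
exists (eta / (4 * ((size X)%:R + 1))).
  by rewrite divr_gt0 // mulr_gt0 // ltr_wpDl.
move=> t t0 ht; apply/ler_addgt0Pr => eps e0.
have [_ /(_ eps e0)[s ads hs]] := magP t0.
suff : Pr (law t) s (ghost None 0) <= eta by move: hs; lra.
apply: le_trans (_ : Pr (law t) s (escape X 0) +
   \sum_(x <- X) Ex (law t) s (fun w => ind (w [fset x]%fset)) <= _).
  rewrite /Pr -Ex_sum -ExD; apply: Ex_le; first exact: law01.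
  move=> w; have S0 : 0 <= \sum_(x <- X) ind (w [fset x]%fset) :> R.
    by apply: sumr_ge0 => x _; apply: ind_ge0.
  case: (pselect (escape X 0 w)) => ew.
    by rewrite (ind_true ew); apply: le_trans (ind_le1 _) _; rewrite lerDl.
  rewrite (ind_false ew) add0r; apply: ind_le_sum => -[y hy wy]; exists y => //.
  by case: (boolP (y \in X)) => // yX; case: ew; exists y.
apply: le_trans (_ : eta / 4 + \sum_(x <- X) t <= _).
  rewrite lerD //; first exact: law_escape.
  apply: ler_sum => x _; apply: le_trans (Ex_edge _ (law01 t0) (adm_uniq ads)) _.
  rewrite /law /bond cardfs1 /=; by have := expR_ge1Dx (- t); lra.
rewrite big_const_seq count_predT iter_addr_0 -mulr_natl.
have x0 : 0 <= (size X)%:R :> R by apply: ler0n.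
have : (size X)%:R * t <= eta / 4; last by lra.
apply: le_trans (_ : ((size X)%:R + 1) * (eta / (4 * ((size X)%:R + 1))) <= _).
  apply: ler_pM => //; lra.
by apply: eq_imp_le; field; apply/negP => /eqP; lra.
Qed.

(** Halving t repeatedly telescopes the increments 3 C t / 2^j to at most 3 C t, and the value left
    at t / 2^k vanishes. *)
Lemma mag_sqr_le t : 0 <= t -> mag t ^+ 2 <= 3 * C * t.
Proof.
move=> t0.
have it k : mag t ^+ 2 <= mag (t / 2 ^+ k) ^+ 2 + 3 * C * (t - t / 2 ^+ k).
  elim: k => [|k IH]; first by rewrite expr0 divr1 subrr mulr0 addr0.
  apply: le_trans IH _.
  have h0 : 0 <= t / 2 ^+ k.+1 by rewrite divr_ge0 // exprn_ge0.
  have hE : t / 2 ^+ k = t / 2 ^+ k.+1 + t / 2 ^+ k.+1.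
    have q0 : 2 ^+ k != 0 :> R by rewrite expf_neq0 // pnatr_eq0.
    by rewrite exprS; field.
  have := mag_sqr_double h0; rewrite -hE => h.
  have h0' : 0 <= t / 2 ^+ k by rewrite divr_ge0 // exprn_ge0.
  move: h; rewrite hE; set y := t / _; have := C_ge0; nra.
apply/ler_addgt0Pr => eps e0.
(* A value at most 1 and at most [eps] has a square at most [eps]. *)
have [|t1 t10 ht1] := @mag_small (Num.min 1 eps); first by rewrite lt_min ltr01.
have [k hk] : exists k : nat, t / 2 ^+ k <= t1.
  exists (Num.bound (t / t1)); rewrite ler_pdivrMr ?exprn_gt0 // mulrC -ler_pdivrMr //.
  have := archi_boundP (divr_ge0 t0 (ltW t10)) => /ltW /le_trans; apply.
  by rewrite -natrX ler_nat ltnW // ltn_expl.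
have hk0 : 0 <= t / 2 ^+ k by rewrite divr_ge0 // exprn_ge0.
have h1 : mag (t / 2 ^+ k) <= Num.min 1 eps by apply: ht1.
have {h1} [h1 h2] : mag (t / 2 ^+ k) <= 1 /\ mag (t / 2 ^+ k) <= eps.
  by move: h1; rewrite le_min => /andP[].
have h3 := mag_ge0 hk0; have := it k; have := C_ge0.
rewrite !expr2; nra.
Qed.

(** At intensity 1/n, a cluster of n sites misses the ghost with probability at most exp(-1) <= 1/2.
    Ghost loops are added at every vertex that the bonds in [s] can reach. *)
Lemma large_mag s n : adm EL s -> all EL s -> (0 < n)%N ->
  Pr (fun=> p) s (large n 0) <= 2 * mag n%:R^-1.
Proof.
move=> ads sEL n0; set t := n%:R^-1.
have nR : 0 < n%:R :> R by rewrite ltr0n.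
have t0 : 0 <= t by rewrite invr_ge0 ltW.
pose U := vertices 0 s; pose sites := [seq [fset v]%fset | v <- U].
have ads' : adm EL (s ++ sites).
  rewrite /adm cat_uniq (adm_uniq ads) map_inj_uniq ?undup_uniq /=; last exact: fset1_inj.
  rewrite all_cat andbT; apply/and3P; split.
  - apply/hasPn => e /mapP[v _ ->]; apply/negP => /(allP sEL)/EL2; by rewrite cardfs1.
  - by case/andP: ads.
  - by apply/allP => e /mapP[v _ ->]; rewrite /bond_or_site /site cardfs1 eqxx orbT.
have := (magP t0).1 _ 0 ads'; rewrite /Pr Ex_cat => h.
suff : Ex (fun=> p) s (fun w => ind (large n 0 w)) * 2^-1 <=
    Ex (law t) s (fun u => Ex (law t) sites (fun v => ind (ghost None 0 (cup u v)))).
  by move: h; lra.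
rewrite (@eq_Ex_pr _ _ (fun=> p) (law t)); last first.
  by move=> e /(allP sEL)/EL2 e2; rewrite /law /bond e2.
rewrite -ExZr; apply: Ex_le_supp; first exact: law01.
move=> w sw; case: (pselect (large n 0 w)) => [lw|nl]; last first.
  rewrite (ind_false nl) mul0r; apply: Ex_ge0; first exact: law01.
  by move=> v _; apply: ind_ge0.
rewrite (ind_true lw) mul1r; have [Y [uY sY hY]] := lw.
pose T := [seq [fset v]%fset | v <- Y].
apply: le_trans (_ : 1 - Ex (law t) sites (fun v => ind (forall e, e \in T -> ~~ v e)) <= _).
  have : Ex (law t) sites (fun v => ind (forall e, e \in T -> ~~ v e)) <=
      (1 - (1 - expR (- t))) ^+ size T.
    apply: Ex_all_closed; first exact: law01.
    - by rewrite map_inj_uniq //; apply: fset1_inj.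
    - move=> e /mapP[y yY ->]; apply/mapP; exists y => //.
      exact: walk_vertices sw (hY y yY).
    - by move=> e /mapP[y yY ->]; rewrite /law /bond cardfs1.
  rewrite size_map sY opprB addrCA subrr addr0 -expRM_natl.
  have -> : n%:R * - t = -1 by rewrite /t mulrN divff // gt_eqF.
  have : expR (-1) * 2 <= 1 :> R; last by lra.
  rewrite -[leRHS](expRxMexpNx_1 (1 : R)) mulrC; apply: ler_wpM2r; first exact: expR_ge0.
  by have := expR_ge1Dx (1 : R).
rewrite -(Ex_const (law t) sites 1) -ExB; apply: Ex_le; first exact: law01.
move=> v; case: (pselect (forall e, e \in T -> ~~ v e)) => hv.
  by rewrite (ind_true hv) subrr ind_ge0.
rewrite (ind_false hv) subr0 ind_true //.
have [y yY vy] : exists2 y, y \in Y & v [fset y]%fset.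
  case: (pselect (exists2 y, y \in Y & v [fset y]%fset)) => // ne; case: hv.
  move=> e /mapP[y yY ->]; apply/negP => vy; apply: ne; by exists y.
exists y; last by rewrite /cup vy orbT.
by apply: walk_incr (hY y yY); apply: sub_cupl.
Qed.

Lemma large_sqr s n : adm EL s -> all EL s -> (0 < n)%N ->
  Pr (fun=> p) s (large n 0) ^+ 2 * n%:R <= 12 * C.
Proof.
move=> ads sEL n0; have h := large_mag ads sEL n0.
have nR : 0 < n%:R :> R by rewrite ltr0n.
have t0 : 0 <= n%:R^-1 :> R by rewrite invr_ge0 ltW.
have h2 := mag_sqr_le t0; have m0 := mag_ge0 t0.
have P0 := Pr_ge0 (pr := fun=> p) (fun=> p01) s (large n 0).
rewrite -ler_pdivlMr //.
apply: le_trans (_ : (2 * mag n%:R^-1) ^+ 2 <= _).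
  by rewrite ler_sqr ?nnegrE // mulr_ge0.
by rewrite exprMn expr2; move: h2; lra.
Qed.

End Magnetization.

(** * Arms *)

Section Arms.
Context {V : choiceType}.
Notation E := {fset V}.
Implicit Types (x y z u : V) (w : E -> bool) (r : nat).

Definition at_dist r x y w :=
  walk (Some r) x y w /\ forall k, (k < r)%N -> ~ walk (Some k) x y w.

Definition arm r x w := exists y, at_dist r x y w.

Lemma at_dist_inj r r' x y w : at_dist r x y w -> at_dist r' x y w -> r = r'.
Proof.
move=> [h1 h2] [h1' h2']; case: (ltngtP r r') => // h; first by case: (h2' _ h).
by case: (h2 _ h).
Qed.

(** From level [j] on, a shortest path avoids the ball of radius j - 1, or it could be shortened,
    and removing edges never shortens distances. So the tail is an arm of exact length r - j in the
    unexplored edges. *)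
Lemma at_dist_split r j x z w : (j <= r)%N -> at_dist r x z w ->
  exists u, [/\ at_dist j x u w, walk (Some (r - j)%N) u z w &
    forall m, j = m.+1 -> at_dist (r - j) u z (drop_edges w (touch (Some m) x w))].
Proof.
move=> jr [[q [h1 h2 h3]] hmin].
have sq : size q = r.
  apply/eqP; rewrite eqn_leq (h3 : (size q <= r)%N) leqNgt; apply/negP => lt; apply: (hmin _ lt).
  by exists q; split => //=.
move: h1 h2; rewrite -{1 2}(cat_take_drop j q) pedges_cat all_cat last_cat => /andP[k1 k2] k3.
set u := last x (take j q) in k2 k3; exists u.
have wu : walk (Some j) x u w.
  by exists (take j q); split => //=; rewrite size_take_min geq_minl.
have wz : walk (Some (r - j)%N) u z w.
  by exists (drop j q); split => //=; rewrite size_drop sq.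
split => //.
  split => // k kj hk; apply: (hmin (k + (r - j))%N).
    by rewrite -[X in (_ < X)%N](subnKC jr) ltn_add2r.
  exact: walk_cat hk wz.
move=> m jm; split.
  exists (drop j q); split => //; last by rewrite /= size_drop sq.
  apply: off_pedges => // c cq wc.
  have [r1 [r2 [rE lc]]] := split_mem cq.
  apply: (hmin (m + size r2)%N).
    rewrite -[X in (_ < X)%N](subnKC jr) {1}jm addSn ltnS leq_add2l.
    by rewrite -sq -size_drop rE size_cat leq_addl.
  apply: walk_cat wc _; exists r2; split => //=.
    by move: k2; rewrite rE pedges_cat all_cat lc => /andP[].
  by rewrite -k3 rE last_cat lc.
move=> k kj /(walk_incr (@sub_drop _ _ _)) hk; apply: (hmin (j + k)%N).
  by rewrite -ltn_subRL.
exact: walk_cat wu hk.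
Qed.

Lemma arm_le r r' x w : (r' <= r)%N -> arm r x w -> arm r' x w.
Proof. by move=> h [z /(at_dist_split h) [u [hu _ _]]]; exists u. Qed.

Lemma touch_at_dist m k x w w' y : (k <= m.+1)%N ->
  (forall e, touch (Some m) x w e -> w e = w' e) ->
  at_dist k x y w <-> at_dist k x y w'.
Proof.
move=> km h; have H i : (i <= m.+1)%N -> walk (Some i) x y w <-> walk (Some i) x y w'.
  move=> im; apply: touch_walk h => q z /= qi; rewrite -ltnS -(size_rcons q z).
  exact: leq_trans qi im.
rewrite /at_dist (H k) //; split=> -[h1 h2]; split => // i ik wi; apply: (h2 i ik);
by apply/H => //; apply: leq_trans (ltnW ik) km.
Qed.

End Arms.

Lemma sum_ind_le1 (R : realFieldType) (T : eqType) (r : seq T) (P : T -> Prop) : uniq r ->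
  (forall i j, P i -> P j -> i = j) -> \sum_(i <- r) ind (P i) <= 1 :> R.
Proof.
move=> ur h; case: (pselect (exists2 i, i \in r & P i)) => [[i ir Pi]|ne].
  rewrite (bigD1_seq i) //= big1 ?addr0 ?ind_le1 // => j ji.
  by apply: ind_false => Pj; move: ji; rewrite (h _ _ Pi Pj) eqxx.
rewrite big_seq big1 // => i ir; apply: ind_false => Pi; apply: ne; by exists i.
Qed.

Section ArmBound.
Context {R : realType} {V : zmodType} (EL : pred {fset V}).
Notation E := {fset V}.
Context (p : R) (p01 : 0 <= p <= 1).
Notation PrP := (Pr (fun=> p)).
Definition bonds (s : seq E) := uniq s && all EL s.
Context (K : R).
(** This is P(|C(o)| >= n) <= K / sqrt n without the square root: [y] is any positive number at most
    sqrt n. *)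
Hypothesis volume : forall s o n (y : R), bonds s -> 0 < y -> y ^+ 2 <= n%:R ->
  PrP s (large n o) * y <= K.

Let prp : forall e : E, 0 <= (fun=> p) e <= 1. Proof. by []. Qed.

Definition level s x j (w : E -> bool) : R := \sum_(v <- vertices x s) ind (at_dist j x v w).

Lemma level_sum s x n (w : E -> bool) r : uniq r -> ~ large n.+1 x w ->
  \sum_(j <- r) level s x j w <= n%:R.
Proof.
move=> ur nl; rewrite /level exchange_big /=.
pose Y := seq.filter (fun v => `[< walk None x v w >]) (vertices x s).
have sY : (size Y <= n)%N.
  rewrite leqNgt; apply/negP => lt; apply: nl; exists (take n.+1 Y); split.
  - by rewrite take_uniq // filter_uniq // undup_uniq.
  - by rewrite size_takel.
  - by move=> y /mem_take; rewrite mem_filter => /andP[/asboolP].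
apply: le_trans (_ : \sum_(v <- vertices x s) ((`[< walk None x v w >] : nat)%:R) <= _).
  apply: ler_sum => v _; case: (pselect (walk None x v w)) => wv.
    rewrite asboolT //; apply: sum_ind_le1 => // i j; exact: at_dist_inj.
  by rewrite big1 // => j _; apply: ind_false => -[/walk_weak].
rewrite -natr_sum ler_nat; apply: leq_trans sY.
rewrite size_filter -sum1_count [X in (_ <= X)%N]big_mkcond leq_eqVlt; apply/orP; left.
by apply/eqP; apply: eq_bigr => v _; case: (asbool _).
Qed.

Section Step.
Context (rho : nat) (a : R).
Hypotheses (rho1 : (1 <= rho)%N) (a0 : 0 < a).
Hypothesis IH : forall s x, bonds s -> PrP s (arm rho x) <= a ^+ 3 / rho%:R.

Let beta : R := 18 * rho%:R / a ^+ 4.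

(** Asking for the first such level makes the events for different [j] disjoint, so that summing
    over [j] costs no factor. *)
Definition thin s x j (w : E -> bool) := level s x j w <= beta /\
  forall i, (rho <= i < j)%N -> beta < level s x i w.

(** Past the explored thin level, one of at most [beta] vertices needs an arm of length [rho] in the
    unexplored edges. These form a random subgraph, which is why [IH] is assumed for every list and
    every start. The factor [arm rho] is kept because level [j] is then not empty and j >= rho. *)
Lemma thin_arm s x j : bonds s -> (rho <= j < 2 * rho)%N ->
  PrP s (fun w => thin s x j w /\ arm (3 * rho) x w) <=
  beta * (a ^+ 3 / rho%:R) * PrP s (fun w => thin s x j w /\ arm rho x w).
Proof.
move=> bs /andP[rj j2]; set U := vertices x s.
have A0 : 0 <= a ^+ 3 / rho%:R by rewrite divr_ge0 // exprn_ge0 // ltW.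
have b0 : 0 <= beta by apply: divr_ge0; [exact: mulr_ge0|exact: exprn_ge0 (ltW a0)].
(* [j] is positive because [rho] is, so j = m + 1 and the edges touching the ball of radius m
   determine level [j]. *)
case: j rj j2 => [|m] rj j2; first by move: rj; rewrite leqNgt rho1.
pose F w v : R := ind (thin s x m.+1 w) * \sum_(u <- U) ind (at_dist m.+1 x u w) * ind (arm rho u v).
apply: le_trans (_ : Ex (fun=> p) s (fun w => F w (drop_edges w (touch (Some m) x w))) <= _).
  apply: Ex_le_supp => // w sw; rewrite /F.
  case: (pselect (thin s x m.+1 w)) => th; last first.
    by rewrite !ind_false ?mul0r //; case.
  rewrite (ind_true th) mul1r; under eq_bigr do rewrite -ind_and.
  apply: ind_le_sum => -[_ [z hz]].
  have mR : (m.+1 <= 3 * rho)%N.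
    by apply: ltnW; apply: leq_trans j2 _; rewrite leq_mul2r orbT.
  have [u [hu _ hoff]] := at_dist_split mR hz; exists u.
    by case: hu => /(walk_vertices sw).
  split => //; apply: (@arm_le _ (3 * rho - m.+1)); last by exists z; apply: hoff.
  rewrite leq_subRL // addnC; apply: leq_trans (_ : rho + 2 * rho <= _)%N.
    by rewrite leq_add2l ltnW.
  by rewrite -mulSn.
rewrite (@Ex_stop _ _ _ s (touch (Some m) x) F); last first.
  move=> w w' h; split; first by move=> e; rewrite (touch_eq h).
  have dE k v : (k <= m.+1)%N -> ind (at_dist k x v w) = ind (at_dist k x v w') :> R.
    by move=> km; congr ind; apply/propext; exact: (touch_at_dist v km h).
  have lE k : (k <= m.+1)%N -> level s x k w = level s x k w'.
    by move=> km; apply: eq_bigr => v _; apply: dE.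
  move=> v; rewrite /F; congr (ind _ * _); last by apply: eq_bigr => u _; rewrite dE.
  apply/propext; rewrite /thin lE //; split=> -[h1 h2]; split => // i /[dup] /h2 + /andP[_ im].
    by rewrite lE // ltnW.
  by rewrite lE // ltnW.
rewrite /Pr -ExZ; apply: Ex_le => // w; rewrite /F ExZ ind_and.
case: (pselect (thin s x m.+1 w)) => [th|nth]; last by rewrite (ind_false nth) !mul0r mulr0.
rewrite (ind_true th) !mul1r Ex_sum.
apply: le_trans (_ : \sum_(u <- U) ind (at_dist m.+1 x u w) * (a ^+ 3 / rho%:R) <= _).
  apply: ler_sum => u _; rewrite ExZ; apply: ler_wpM2l; first exact: ind_ge0.
  pose q (e : E) := ~~ touch (Some m) x w e.
  rewrite (Ex_filter (fun=> p) s q (fun v => ind (arm rho u v))).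
  apply: IH; case/andP: bs => us /allP sE; rewrite /bonds filter_uniq //=.
  by apply/allP => e; rewrite mem_filter => /andP[_ /sE].
rewrite -mulr_suml -/(level s x m.+1 w).
case: (pselect (arm rho x w)) => [ar|nar].
  by rewrite (ind_true ar) mulr1; apply: ler_wpM2r => //; case: th.
rewrite (ind_false nar) mulr0 [X in X * _](_ : _ = 0) ?mul0r //.
rewrite /level big1 // => u _; apply: ind_false => hu; apply: nar.
by apply: arm_le rj _; exists u.
Qed.

Lemma thin_exists s x w n : n%:R < rho%:R * beta -> ~ large n.+1 x w ->
  exists2 j, j \in index_iota rho (2 * rho) & thin s x j w.
Proof.
move=> hn nl.
pose P j := (rho <= j < 2 * rho)%N && (level s x j w <= beta).
case: (pselect (exists j, P j)) => [exP|nP].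
  case: (ex_minnP exP) => j /andP[jr jb] jmin; exists j; first by rewrite mem_index_iota.
  split => // i /andP[ri ij]; rewrite ltNge; apply/negP => ib.
  have [_ j2] := andP jr.
  have Pi : P i by rewrite /P ri ib andbT /=; apply: ltn_trans ij j2.
  by have := jmin i Pi; rewrite leqNgt ij.
exfalso; have := @level_sum s x n w (index_iota rho (2 * rho)) (iota_uniq _ _) nl.
apply/negP; rewrite -ltNge; apply: lt_le_trans hn _.
apply: le_trans (_ : \sum_(j <- index_iota rho (2 * rho)) beta <= _).
  rewrite big_const_seq count_predT iter_addr_0 size_iota mul2n -addnn addnK.
  by rewrite mulr_natl.
rewrite big_seq [leRHS]big_seq; apply: ler_sum => j; rewrite mem_index_iota => jr.
rewrite leNgt; apply/negP => lt; apply: nP; exists j; rewrite /P jr; exact: ltW.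
Qed.

Lemma arm_step s x : bonds s -> K + 54 <= a ->
  PrP s (arm (3 * rho) x) <= a ^+ 3 / (3 * rho)%:R.
Proof.
move=> bs Ka.
have r0 : 0 < rho%:R :> R by rewrite ltr0n.
(* Large clusters cost K / y = K a^2 / (3 rho), and n <= y^2 < 2 y^2 = rho beta forces a thin level
   otherwise. That case costs beta (a^3 / rho)^2 = 54 a^2 / (3 rho), so K + 54 <= a closes the
   induction. *)
pose y : R := 3 * rho%:R / a ^+ 2.
have y0 : 0 < y by rewrite divr_gt0 ?mulr_gt0 ?exprn_gt0.
have y20 : 0 <= y ^+ 2 by apply: exprn_ge0; apply: ltW.
pose n := Num.trunc (y ^+ 2).
have /andP[n1 n2] := truncn_itv y20; rewrite -/n in n1 n2.
have rb : rho%:R * beta = 2 * y ^+ 2.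
  by rewrite /beta /y; field; rewrite gt_eqF.
have hn : n%:R < rho%:R * beta.
  by rewrite rb; apply: le_lt_trans n1 _; have : 0 < y ^+ 2 by [apply: exprn_gt0]; lra.
have hv := volume x bs y0 (ltW n2).
have hA := IH x bs.
have A0 : 0 <= a ^+ 3 / rho%:R by rewrite divr_ge0 // exprn_ge0 // ltW.
have b0 : 0 <= beta by apply: divr_ge0; [exact: mulr_ge0|exact: exprn_ge0 (ltW a0)].
have up : PrP s (arm (3 * rho) x) <= PrP s (large n.+1 x) +
    beta * (a ^+ 3 / rho%:R) * (a ^+ 3 / rho%:R).
  apply: le_trans (_ : PrP s (large n.+1 x) + \sum_(j <- index_iota rho (2 * rho))
      PrP s (fun w => thin s x j w /\ arm (3 * rho) x w) <= _).
    rewrite /Pr -Ex_sum -ExD; apply: Ex_le => // w.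
    set S := \sum_(j <- _) _.
    have S0 : 0 <= S by apply: sumr_ge0 => *; apply: ind_ge0.
    case: (pselect (large n.+1 x w)) => lw.
      by rewrite (ind_true lw); apply: le_trans (ind_le1 _) _; rewrite lerDl.
    rewrite (ind_false lw) add0r; apply: ind_le_sum => ar.
    by have [j jr th] := thin_exists s hn lw; exists j.
  rewrite lerD2l.
  apply: le_trans (_ : \sum_(j <- index_iota rho (2 * rho)) beta * (a ^+ 3 / rho%:R) *
      PrP s (fun w => thin s x j w /\ arm rho x w) <= _).
    rewrite big_seq [leRHS]big_seq; apply: ler_sum => j; rewrite mem_index_iota => jr.
    exact: thin_arm.
  rewrite -mulr_sumr; apply: ler_wpM2l; first exact: mulr_ge0.
  apply: le_trans hA; rewrite /Pr -Ex_sum; apply: Ex_le => // w.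
  under eq_bigr do rewrite ind_and; rewrite -mulr_suml -[leRHS]mul1r.
  apply: ler_wpM2r; first exact: ind_ge0.
  rewrite big_seq; apply: le_trans (_ : \sum_(j <- index_iota rho (2 * rho))
    ind ((rho <= j)%N /\ thin s x j w) <= _).
    rewrite [leRHS]big_seq; apply: ler_sum => j; rewrite mem_index_iota => /andP[jr _].
    by apply: ind_le.
  apply: sum_ind_le1; first exact: iota_uniq.
  move=> i j [ri [hi hi']] [rj [hj hj']]; case: (ltngtP i j) => // ij.
    by have := hj' i; rewrite ri ij => /(_ isT); rewrite ltNge hi.
  by have := hi' j; rewrite rj ij => /(_ isT); rewrite ltNge hj.
apply: le_trans up _.
have e1 : PrP s (large n.+1 x) <= K / y by rewrite ler_pdivlMr.
have e2 : K / y + beta * (a ^+ 3 / rho%:R) * (a ^+ 3 / rho%:R) =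
    (K + 54) * (a ^+ 2 / (3 * rho)%:R).
  by rewrite natrM /beta /y; field; rewrite !gt_eqF.
apply: le_trans (_ : (K + 54) * (a ^+ 2 / (3 * rho)%:R) <= _).
  by rewrite -e2 lerD2r.
rewrite (exprS a 2) -mulrA; apply: ler_wpM2r => //.
by rewrite divr_ge0 // exprn_ge0 // ltW.
Qed.

End Step.

Theorem arm_bound : exists2 C : R, 0 < C & forall s x r, bonds s -> (1 <= r)%N ->
  PrP s (arm r x) <= C / r%:R.
Proof.
have K0 : 0 <= K.
  have := @volume [::] 0 1 1 isT ltr01; rewrite expr1n mulr1 => /(_ (lexx _)).
  by apply: le_trans; apply: (Pr_ge0 prp).
pose a := K + 54; have a1 : 1 <= a by rewrite /a; lra.
have a0 : 0 < a by lra.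
have pow k s x : bonds s -> PrP s (arm (3 ^ k) x) <= a ^+ 3 / (3 ^ k)%:R.
  elim: k s x => [|k IH] s x bs.
    by rewrite expn0 divr1; apply: le_trans (Pr_le1 prp _ _) _; apply: exprn_ege1.
  by rewrite expnS; apply: arm_step => //; rewrite expn_gt0.
exists (3 * a ^+ 3); first by rewrite mulr_gt0 // exprn_gt0.
move=> s x r bs r1; have := @trunc_log_bounds 3 r isT r1.
set k := trunc_log 3 r => /= /andP[k1 k2].
apply: le_trans (_ : PrP s (arm (3 ^ k) x) <= _).
  by apply: (Pr_le prp) => w; apply: arm_le.
apply: le_trans (pow k s x bs) _.
have t0 : 0 < (3 ^ k)%:R :> R by rewrite ltr0n expn_gt0.
have r0 : 0 < r%:R :> R by rewrite ltr0n.
have X0 : 0 <= a ^+ 3 by apply: exprn_ge0; apply: ltW.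
have rt : r%:R <= 3 * (3 ^ k)%:R :> R by rewrite -natrM ler_nat -expnS; apply: ltnW.
rewrite ler_pdivrMr // mulrAC ler_pdivlMr //.
have -> : 3 * a ^+ 3 * (3 ^ k)%:R = a ^+ 3 * (3 * (3 ^ k)%:R) by ring.
exact: ler_wpM2l.
Qed.

End ArmBound.

(** * The triangle condition *)

(** The form is the sum over equivalence classes of the squared total weight; the induction removes
    the class of the first point. *)
Lemma equivalence_psd (R : realFieldType) (T : Type) (e : T -> T -> Prop) (c : T -> R)
    (Z : seq T) : (forall x, e x x) -> (forall x y, e x y -> e y x) ->
  (forall x y z, e x y -> e y z -> e x z) ->
  0 <= \sum_(i <- Z) \sum_(j <- Z) c i * c j * ind (e i j).
Proof.
move=> er es et; have [n] := ubnP (size Z); elim: n Z => // n IH [|z Z] sZ.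
  by rewrite big_nil.
pose q i := `[< e z i >].
have hsplit Y : \sum_(i <- Y) \sum_(j <- Y) c i * c j * ind (e i j) =
    (\sum_(i <- Y | q i) c i) ^+ 2 +
    \sum_(i <- seq.filter (predC q) Y) \sum_(j <- seq.filter (predC q) Y) c i * c j * ind (e i j).
  rewrite (bigID q) /=; congr (_ + _).
    rewrite expr2 mulr_suml; apply: eq_bigr => i /asboolP zi.
    rewrite mulr_sumr (bigID q) /= [X in _ + X]big1 ?addr0.
      by apply: eq_bigr => j /asboolP zj; rewrite ind_true ?mulr1 //; exact: et (es _ _ zi) zj.
    move=> j /asboolP zj; rewrite ind_false ?mulr0 // => ij; apply: zj; exact: et zi ij.
  rewrite big_filter; apply: eq_bigr => i /asboolP zi.
  rewrite (bigID q) /= big1 ?add0r ?big_filter //.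
  move=> j /asboolP zj; rewrite ind_false ?mulr0 // => ij; apply: zi.
  exact: et zj (es _ _ ij).
rewrite hsplit; apply: addr_ge0; first exact: sqr_ge0.
apply: IH; rewrite /= (_ : q z) /=; last exact/asboolP.
by apply: (@leq_ltn_trans (size Z)) => //; rewrite size_filter count_size.
Qed.

Section Triangle.
Context {R : realType} {V : zmodType} (EL : pred {fset V}).
Notation E := {fset V}.
Hypothesis ELshift : forall z e, EL (shift z e) = EL e.
Context (p : R) (p01 : 0 <= p <= 1).

Let prp : forall e : E, 0 <= (fun=> p) e <= 1. Proof. by []. Qed.

Notation PrP := (Pr (fun=> p)).

Lemma tau_exists (v : V) : exists t, (forall s, adm EL s -> PrP s (walk None 0 v) <= t) /\
  forall eps, 0 < eps -> exists2 s, adm EL s & t - eps < PrP s (walk None 0 v).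
Proof.
apply: (@lub_exists R _ (adm EL) (fun s => PrP s (walk None 0 v)) 1); first by exists [::].
by move=> s _; apply: (Pr_le1 prp).
Qed.

(** The two-point function on finite lists. It is compared with the probability of the connection
    event only to import the triangle condition. *)
Definition tau v := projT1 (cid (tau_exists v)).

Lemma tau_sup v : (forall s, adm EL s -> PrP s (walk None 0 v) <= tau v) /\
  forall eps, 0 < eps -> exists2 s, adm EL s & tau v - eps < PrP s (walk None 0 v).
Proof. exact: projT2 (cid (tau_exists v)). Qed.

Lemma tau_ge0 v : 0 <= tau v.
Proof. by have [h _] := tau_sup v; apply: le_trans (h [::] isT); apply: (Pr_ge0 prp). Qed.

Lemma tau0 : 1 <= tau 0.
Proof.
have [h _] := tau_sup 0; apply: le_trans (h [::] isT).
by rewrite /Pr /= ind_true //; apply: walk_refl.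
Qed.

Lemma tau_le v t : (forall s, adm EL s -> PrP s (walk None 0 v) <= t) -> tau v <= t.
Proof.
move=> h; apply/ler_addgt0Pr => eps e0; have [_ /(_ eps e0)[s ads hs]] := tau_sup v.
by have := h s ads; lra.
Qed.

Lemma tau_le1 v : tau v <= 1.
Proof. by apply: tau_le => s _; apply: (Pr_le1 prp). Qed.

Lemma tau_ub s n x y : adm EL s -> PrP s (walk n x y) <= tau (y - x).
Proof.
move=> ads; have [h _] := tau_sup (y - x).
apply: le_trans (h _ (adm_shift ELshift (- x) ads)).
have := Pr_shift_walk (pr := fun=> p) (fun _ _ => erefl) (- x) s None x y; rewrite subrr => ->.
by apply: (Pr_le prp) => w; apply: walk_weak.
Qed.

Lemma tauN v : tau (- v) = tau v.
Proof.
suff H u : tau (- u) <= tau u by apply: le_anti; rewrite H -{1}(opprK v) H.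
apply: tau_le => s ads; have := tau_ub None (- u) 0 ads; rewrite sub0r opprK.
apply: le_trans; apply: (Pr_le prp) => w; exact: walk_sym.
Qed.

Lemma tau_approx (L : seq (V * V)) del : 0 < del -> exists2 s0, adm EL s0 &
  forall s, adm EL s -> {subset s0 <= s} -> forall q, q \in L ->
    tau (q.2 - q.1) - del <= PrP s (walk None q.1 q.2).
Proof.
move=> d0; elim: L => [|[x y] L [s0 ads0 h0]]; first by exists [::].
have [_ /(_ del d0)[s1 ads1 h1]] := tau_sup (y - x).
pose s2 := undup (map (shift x) s1 ++ s0).
have ads2 : adm EL s2.
  apply: adm_undup; rewrite all_cat; apply/andP; split; last by case/andP: ads0.
  by case/andP: (adm_shift ELshift x ads1).
exists s2 => // s ads sub q; rewrite inE => /orP[/eqP ->|qL] /=; last first.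
  by apply: h0 => // e es; apply: sub; rewrite mem_undup mem_cat es orbT.
apply: le_trans (ltW h1) _.
have := Pr_shift_walk (pr := fun=> p) (fun _ _ => erefl) x s1 None 0 (y - x).
rewrite add0r subrK => <-; apply: (Pr_subset prp (@walk_incr _ _ _ _)).
- exact: (adm_uniq (adm_shift ELshift x ads1)).
- exact: (adm_uniq ads).
- by move=> e es; apply: sub; rewrite mem_undup mem_cat es.
Qed.

(** Connection is an equivalence relation, so [tau] is a limit of averages of nonnegative forms. By
    the choice of [del], a negative value [S] would persist on one finite list. *)
Lemma tau_psd (Z : seq (V * R)) :
  0 <= \sum_(i <- Z) \sum_(j <- Z) i.2 * j.2 * tau (j.1 - i.1).
Proof.
set S := \sum_(i <- Z) _.
pose D := \sum_(i <- Z) \sum_(j <- Z) `|i.2 * j.2|.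
have D0 : 0 <= D by do 2 (apply: sumr_ge0 => ? _).
rewrite leNgt; apply/negP => S0.
pose del := - S / (2 * (D + 1)).
have d0 : 0 < del by rewrite divr_gt0 ?oppr_gt0 // mulr_gt0 //; lra.
pose L := [seq (i.1, j.1) | i <- Z, j <- Z].
have [s ads h] := @tau_approx L del d0.
pose Q := \sum_(i <- Z) \sum_(j <- Z) i.2 * j.2 * PrP s (walk None i.1 j.1).
have Q0 : 0 <= Q.
  rewrite /Q; have -> : \sum_(i <- Z) \sum_(j <- Z) i.2 * j.2 * PrP s (walk None i.1 j.1) =
      Ex (fun=> p) s (fun w => \sum_(i <- Z) \sum_(j <- Z) i.2 * j.2 * ind (walk None i.1 j.1 w)).
    rewrite Ex_sum; apply: eq_bigr => i _; rewrite Ex_sum; apply: eq_bigr => j _.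
    by rewrite ExZ.
  apply: (Ex_ge0 prp) => w _.
  apply: (@equivalence_psd R _ (fun i j => walk None i.1 j.1 w) (fun i => i.2)).
  - by move=> x; apply: walk_refl.
  - by move=> x y; apply: walk_sym.
  - by move=> x y z; apply: walk_trans.
have : Q - S <= del * D.
  rewrite /Q /S -sumrB /D mulr_sumr big_seq [leRHS]big_seq; apply: ler_sum => i iZ.
  rewrite -sumrB mulr_sumr big_seq [leRHS]big_seq; apply: ler_sum => j jZ.
  rewrite -mulrBr; apply: le_trans (ler_norm _) _; rewrite normrM mulrC; apply: ler_wpM2r => //.
  have h1 := tau_ub None i.1 j.1 ads.
  have := h s ads (fun e es => es) (i.1, j.1); rewrite /= => /(_ _) h2.
  have {}h2 : tau (j.1 - i.1) - del <= PrP s (walk None i.1 j.1).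
    by apply: h2; apply/allpairsP; exists (i, j).
  by rewrite ler_norml; apply/andP; split; lra.
have : del * D <= - S / 2.
  have -> : - S / 2 = del * (D + 1).
    by rewrite /del; field; apply/negP => /eqP; lra.
  by apply: ler_wpM2l; [exact: ltW|lra].
lra.
Qed.

Definition tri (z : V * V) := tau z.1 * tau (z.2 - z.1) * tau z.2.
Context (T : R).
Hypothesis triangle : forall Z, uniq Z -> \sum_(z <- Z) tri z <= T.

Lemma tri_pairs X Y : uniq X -> uniq Y ->
  \sum_(x <- X) \sum_(y <- Y) tri (x, y) = \sum_(z <- [seq (x, y) | x <- X, y <- Y]) tri z.
Proof. by move=> uX uY; rewrite big_allpairs. Qed.

(** [F] collects the first coordinates of a finite set of pairs carrying the sum up to [eps]; pairs
    with first point outside [F] are disjoint from that set. *)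
Lemma triangle_tail eps : 0 < eps -> exists F : seq V, 0 \in F /\ tail_le tau F eps.
Proof.
move=> e0; have [||m [m1 m2]] := @lub_exists R _ (fun Z : seq (V * V) => uniq Z)
    (fun Z => \sum_(z <- Z) tri z) T.
- by exists [::].
- exact: triangle.
have [Z uZ hZ] := m2 eps e0.
exists (0 :: map fst Z); split; first by rewrite inE eqxx.
set F := _ :: _; move=> X Y uX uY.
have -> : \sum_(x <- X) \sum_(y <- Y) ((x \notin F) : nat)%:R * (tau x * tau (y - x) * tau y) =
    \sum_(z <- [seq (x, y) | x <- seq.filter (fun x => x \notin F) X, y <- Y]) tri z.
  rewrite big_allpairs big_filter [RHS]big_mkcond /=; apply: eq_bigr => x _.
  case: (x \notin F); first by apply: eq_bigr => y _; rewrite mul1r.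
  by rewrite big1 // => y _; rewrite mul0r.
set W := flatten _.
have : \sum_(z <- Z ++ W) tri z <= m.
  apply: m1; rewrite cat_uniq uZ /=; apply/andP; split.
    apply/hasPn => -[x y] /allpairsP[[x' y'] /= [+ _ [-> _]]].
    rewrite mem_filter inE negb_or => /andP[/andP[_ xZ] _]; apply: contra xZ => xyZ.
    by apply/mapP; exists (x', y).
  by apply: allpairs_uniq; rewrite ?filter_uniq // => -[a b] [c d] _ _ [-> ->].
by rewrite big_cat /=; move: hZ; lra.
Qed.

(** The term x = y = v of the tail is tau(v)^2 tau(0), and tau(0) >= 1. *)
Lemma tau_decay eta : 0 < eta -> exists F : seq V, forall v, v \notin F -> tau v <= eta.
Proof.
move=> e0; have [|F [_ hF]] := @triangle_tail (eta ^+ 2); first exact: exprn_gt0.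
exists F => v vF; have := hF [:: v] [:: v] isT isT; rewrite !big_seq1 vF mul1r subrr.
have := tau0; have := tau_ge0 v => h1 h2 h3.
rewrite -(ler_pXn2r (n := 2)) ?nnegrE //; last exact: ltW.
apply: le_trans h3; rewrite expr2 mulrAC -[leLHS]mulr1.
by apply: ler_wpM2l => //; apply: mulr_ge0.
Qed.

(* The Cauchy-Schwarz inequality for the form with kernel tau, with the
   geometric mean split by a free parameter t. *)
Lemma tau_cauchy w X A t :
  2 * t * (\sum_(x <- X) \sum_(a <- A) tau x * tau a * tau (a - x - w)) <=
  t ^+ 2 * (\sum_(x <- X) \sum_(y <- X) tri (x, y)) + \sum_(a <- A) \sum_(b <- A) tri (a, b).
Proof.
(* Weights t tau(x) at x and -tau(a) at a - w: the cross terms are the open triangle, the others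
   closed triangles. *)
pose Z := [seq (x, t * tau x) | x <- X] ++ [seq (a - w, - tau a) | a <- A].
have := tau_psd Z; rewrite /Z big_cat !big_map /=.
under eq_bigr do rewrite big_cat !big_map /=.
under [X in _ + X]eq_bigr do rewrite big_cat !big_map /=.
rewrite !big_split /=.
have -> : \sum_(i <- X) \sum_(j <- X) t * tau i * (t * tau j) * tau (j - i) =
    t ^+ 2 * \sum_(x <- X) \sum_(y <- X) tri (x, y).
  rewrite mulr_sumr; apply: eq_bigr => x _; rewrite mulr_sumr; apply: eq_bigr => y _.
  by rewrite /tri /=; ring.
have -> : \sum_(i <- A) \sum_(j <- A) - tau i * - tau j * tau (j - w - (i - w)) =
    \sum_(a <- A) \sum_(b <- A) tri (a, b).
  apply: eq_bigr => a _; apply: eq_bigr => b _.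
  by rewrite opprB addrA subrK /tri /=; ring.
have -> : \sum_(i <- A) \sum_(j <- X) - tau i * (t * tau j) * tau (j - (i - w)) =
    - (t * \sum_(x <- X) \sum_(a <- A) tau x * tau a * tau (a - x - w)).
  rewrite exchange_big mulr_sumr -sumrN; apply: eq_bigr => x _.
  rewrite mulr_sumr -sumrN; apply: eq_bigr => a _.
  have -> : tau (x - (a - w)) = tau (a - x - w) by rewrite -tauN opprB addrAC.
  ring.
have -> : \sum_(i <- X) \sum_(j <- A) t * tau i * - tau j * tau (j - w - i) =
    - (t * \sum_(x <- X) \sum_(a <- A) tau x * tau a * tau (a - x - w)).
  rewrite mulr_sumr -sumrN; apply: eq_bigr => x _.
  rewrite mulr_sumr -sumrN; apply: eq_bigr => a _.
  by rewrite addrAC; ring.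
lra.
Qed.

(** The sum is cut by membership of x and a in [F]. If one of them is outside, [tau_cauchy] pairs a
    small closed sum with a bounded one; if both are inside, only finitely many differences a - x
    occur, and tau (a - x - w) is small for w outside a finite set. *)
Lemma triangle_open eps : 0 < eps -> exists F : seq V, forall w, w \notin F ->
  open_triangle_le tau w eps.
Proof.
move=> e0; have T0 : 0 <= T by have := triangle (Z := [::]) isT; rewrite big_nil.
(* The two parts with a point outside [F] together cost del (1 + T) = eps / 2. *)
pose del := eps / (2 * (1 + T)).
have d0 : 0 < del by rewrite divr_gt0 // mulr_gt0 //; lra.
have [|F [_ hF]] := @triangle_tail (del ^+ 2); first exact: exprn_gt0.
pose eta := eps / (2 * ((size F)%:R ^+ 2 + 1)).
have f0 : 0 <= (size F)%:R ^+ 2 :> R by apply: exprn_ge0.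
have eta0 : 0 < eta by rewrite divr_gt0 // mulr_gt0 //; lra.
have [F2 hF2] := tau_decay eta0.
(* Excluded are the w for which a - x - w falls into [F2] for some a, x in [F]. *)
exists [seq u - f | u <- [seq a - x | a <- F, x <- F], f <- F2] => w wF X A uX uA.
pose FG X A := \sum_(x <- X) \sum_(a <- A) tau x * tau a * tau (a - x - w).
pose FF X := \sum_(x <- X) \sum_(y <- X) tri (x, y).
have FF_T X' : uniq X' -> FF X' <= T.
  move=> uX'; rewrite /FF tri_pairs //; apply: triangle.
  by apply: allpairs_uniq => // -[a b] [c d] _ _ [-> ->].
pose inF := fun x : V => x \in F; pose outF := fun x : V => x \notin F.
have FF_tail X' : uniq X' -> FF (seq.filter outF X') <= del ^+ 2.
  move=> uX'; apply: le_trans (hF (seq.filter outF X') (seq.filter outF X') _ _); rewrite ?filter_uniq //.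
  rewrite /FF !big_filter; apply: eq_imp_le; apply: eq_bigr => x xF.
  by rewrite !big_filter; apply: eq_bigr => y _; rewrite (xF : (x \notin F) = true) mul1r.
have split1 : FG X A = FG (seq.filter inF X) (seq.filter inF A) + FG (seq.filter inF X) (seq.filter outF A)
    + FG (seq.filter outF X) A.
  rewrite /FG !big_filter (bigID inF) /=; congr (_ + _).
  rewrite -big_split /=; apply: eq_bigr => x _.
  by rewrite !big_filter (bigID inF).
set Xi := seq.filter inF X; set Xo := seq.filter outF X.
set Ai := seq.filter inF A; set Ao := seq.filter outF A.
(* The closed sum over the outer points is at most del^2; the parameter balances it against [T], so
   it is 1 / del here and del below, where the outer points are those of [A]. *)
have c1 : FG Xo A <= del * (1 + T) / 2.
  have h := tau_cauchy w Xo A del^-1.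
  have h1 := FF_tail X uX; have h2 := FF_T A uA.
  have h3 : del^-1 ^+ 2 * FF Xo <= 1.
    rewrite -(mulVf (x := del ^+ 2)) ?expf_neq0 ?gt_eqF // exprVn.
    by apply: ler_wpM2l => //; rewrite invr_ge0 exprn_ge0 // ltW.
  rewrite -(ler_pM2l (x := 2 * del^-1)); last by rewrite mulr_gt0 // invr_gt0.
  apply: le_trans h _; have -> : 2 * del^-1 * (del * (1 + T) / 2) = 1 + T.
    by field; rewrite gt_eqF.
  exact: lerD.
have c2 : FG Xi Ao <= del * (1 + T) / 2.
  have h := tau_cauchy w Xi Ao del.
  have h1 := FF_tail A uA; have h2 := FF_T _ (filter_uniq inF uX).
  rewrite -(ler_pM2l (x := 2 * del)); last by rewrite mulr_gt0.
  apply: le_trans h _; have -> : 2 * del * (del * (1 + T) / 2) = del ^+ 2 * T + del ^+ 2.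
    by field.
  by apply: lerD => //; apply: ler_wpM2l => //; apply: exprn_ge0; apply: ltW.
have c3 : FG Xi Ai <= eps / 2.
  apply: le_trans (_ : \sum_(x <- Xi) \sum_(a <- Ai) eta <= _).
    rewrite /FG big_seq [leRHS]big_seq; apply: ler_sum => x; rewrite mem_filter => /andP[xF _].
    rewrite big_seq [leRHS]big_seq; apply: ler_sum => a; rewrite mem_filter => /andP[aF _].
    have h : tau (a - x - w) <= eta.
      apply: hF2; apply: contra wF => h; apply/allpairsP; exists (a - x, a - x - w).
      split => //=; first by apply/allpairsP; exists (a, x).
      by rewrite opprB addrC subrK.
    have := tau_le1 x; have := tau_le1 a; have := tau_ge0 x; have := tau_ge0 a.
    move=> a0 x0 a1 x1; apply: le_trans h; rewrite -[leRHS]mul1r; apply: ler_wpM2r.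
      exact: tau_ge0.
    by rewrite -[leRHS]mulr1; apply: ler_pM.
  have sz Y : uniq Y -> (size (seq.filter inF Y) <= size F)%N.
    move=> uY; apply: uniq_leq_size; first exact: filter_uniq.
    by move=> y; rewrite mem_filter => /andP[].
  under eq_bigr do rewrite big_const_seq count_predT iter_addr_0.
  rewrite big_const_seq count_predT iter_addr_0 -mulrnA.
  apply: le_trans (_ : eta *+ (size F * size F) <= _).
    by apply: ler_wpMn2l; [exact: ltW|apply: leq_mul; exact: sz].
  rewrite -mulr_natr natrM -expr2 /eta.
  have -> : eps / 2 = eps / (2 * ((size F)%:R ^+ 2 + 1)) * ((size F)%:R ^+ 2 + 1).
    by field; apply/negP => /eqP; lra.
  by apply: ler_wpM2l; [exact: ltW|lra].
have c4 : del * (1 + T) = eps / 2 by rewrite /del; field; apply/negP => /eqP; lra.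
rewrite -/(FG X A) split1; lra.
Qed.

End Triangle.

(** * Lattices and events *)

Lemma cardfs2_pair (K : choiceType) (e : {fset K}) : #|` e| = 2%N ->
  exists x y, e = [fset x; y]%fset.
Proof.
move=> e2; case: (fset_0Vmem e) e2 => [->|[x xe]]; first by rewrite cardfs0.
rewrite (cardfsD1 x) xe => -[/eqP/cardfs1P[y ey]]; exists x, y.
by rewrite -(fsetD1K xe) ey.
Qed.

Section LatticeGraph.
Context (d : nat) (L : lattice d).
Notation V := (Zd d).
Notation E := {fset V}.

Definition is_edge (e : E) : bool := `[< edge_set L e >].

Lemma is_edge_card e : is_edge e -> #|` e| = 2%N.
Proof. by move/asboolP; apply: edge_card2. Qed.

Lemma is_edge_shift z e : is_edge (shift z e) = is_edge e.
Proof.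
have H z' e' : is_edge e' -> is_edge (shift z' e').
  move=> h; have [x [y eE]] := cardfs2_pair (is_edge_card h); apply/asboolP.
  by rewrite eE shift2; apply: edge_translation; rewrite -eE; apply/asboolP.
by apply/idP/idP => [/(H (- z))|]; [rewrite shiftNK|apply: H].
Qed.

Lemma edge_path (w : V) : exists kap, all is_edge (pedges 0 kap) /\ last 0 kap = w.
Proof.
have [s [h1 h2]] := edge_connected L 0 w; exists s; split => //.
by rewrite -path_pedges.
Qed.

Definition coord_box (M : nat) (r : nat) : seq V :=
  [seq \row_i ((f i : nat)%:Z - (M * r)%:Z) | f : {ffun 'I_d -> 'I_(2 * (M * r)).+1}].

Lemma coord_boxP M r (v : V) : (forall i, `|v ord0 i| <= (M * r)%:Z) -> v \in coord_box M r.
Proof.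
move=> h.
have hlt i : (absz (v ord0 i + (M * r)%N%:Z)%R < (2 * (M * r)).+1)%N.
  have := h i; rewrite ler_norml => /andP[h1 h2].
  rewrite ltnS -lez_nat gez0_abs; last by move: h1; rewrite -subr_ge0 opprK.
  by rewrite mul2n -addnn PoszD lerD2r.
rewrite /coord_box; apply/fintype.imageP; exists [ffun i => Ordinal (hlt i)] => //.
apply/rowP => i; rewrite !mxE ffunE /= gez0_abs ?addrK //.
have := h i; rewrite ler_norml => /andP[h1 h2].
by move: h1; rewrite -subr_ge0 opprK.
Qed.

Lemma size_coord_box M r : size (coord_box M r) = ((2 * (M * r)).+1 ^ d)%N.
Proof. by rewrite size_image card_ffun !card_ord. Qed.

Lemma balls_exist : exists2 M : nat, (0 < M)%N &
  forall x q (w : E -> bool), (forall e, w e -> is_edge e \/ site e) -> all w (pedges x q) ->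
  forall r, (size q <= r)%N -> last x q - x \in coord_box M r.
Proof.
have [M hM] := edge_bounded L; exists M.+1 => // x q w hw hq r qr.
apply: coord_boxP => i.
apply: le_trans (_ : (M.+1 * size q)%:Z <= _); last by rewrite lez_nat leq_mul2l qr orbT.
elim: q x hq {qr} => [|y q IH] x /=; first by rewrite subrr mxE normr0.
move=> /andP[wxy hq].
have -> : last y q - x = (last y q - y) + (y - x) by rewrite addrA subrK.
rewrite mxE mulnS addnC PoszD; apply: le_trans (ler_normD _ _) _; apply: lerD; first exact: IH.
case: (hw _ wxy) => [/asboolP h|/cardfs1P[c hc]].
  have := hM x y h i; rewrite distrC !mxE => /le_trans; apply.
  by rewrite lez_nat.
have xc : x \in [fset c]%fset by rewrite -hc !inE eqxx.
have yc : y \in [fset c]%fset by rewrite -hc !inE eqxx orbT.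
by move: xc yc; rewrite !inE => /eqP -> /eqP ->; rewrite subrr mxE normr0.
Qed.

Lemma outside (F : seq V) : (0 < d)%N -> exists v, v \notin F.
Proof.
move=> d0; pose f k : V := \row_i (k : nat)%:Z.
have finj : injective f.
  by move=> k l /rowP /(_ (Ordinal d0)); rewrite !mxE => -[].
case: (pselect (exists v, v \notin F)) => // nv; exfalso.
have sub : {subset map f (iota 0 (size F).+1) <= F}.
  by move=> v _; case: (boolP (v \in F)) => // vF; case: nv; exists v.
have un : uniq (map f (iota 0 (size F).+1)) by rewrite map_inj_uniq // iota_uniq.
by have := uniq_leq_size un sub; rewrite size_map size_iota ltnn.
Qed.

Lemma lift_edges (s : seq E) : all is_edge s -> exists t : seq (edge L), map val t = s.
Proof.
elim: s => [|e s IH] /=; first by exists [::].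
move=> /andP[/asboolP he /IH[t ht]].
by exists ((exist _ e (mem_set he) : edge L) :: t); rewrite /= ht.
Qed.

Definition opened (G : set (edge L)) (w : config L) : E -> bool :=
  fun e => `[< exists2 f : edge L, G f /\ w f & val f = e >].

Lemma opened_adjacent G w u v :
  `[< Defs.adjacent (Defs.open_edges G w) u v >] = opened G w [fset u; v]%fset.
Proof. by apply/asbool_equiv_eq; split => -[f h1 h2]; exists f. Qed.

Lemma opened_path G w x q :
  path (fun u v => `[< Defs.adjacent (Defs.open_edges G w) u v >]) x q =
  all (opened G w) (pedges x q).
Proof. by rewrite (eq_path (opened_adjacent G w)) path_pedges. Qed.

Lemma opened_walk G w x y : walk None x y (opened G w) <-> connected_in G w x y.
Proof.
by split=> -[q]; [move=> [h1 h2 _]|move=> [h1 h2]]; exists q; split; rewrite ?opened_path // -opened_path.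
Qed.

Lemma opened_edge G w e : opened G w e -> is_edge e.
Proof. by move=> /asboolP[f _ <-]; apply/asboolP; apply: set_mem (valP f). Qed.

Definition restrict (t : seq (edge L)) (w : config L) : E -> bool :=
  fun e => has (fun f => w f && (val f == e)) t.

Lemma restrict_cons f t w : restrict (f :: t) w =
  if w f then open_edge (val f) (restrict t w) else restrict t w.
Proof.
by apply/funext => e; rewrite /restrict /=; case: (w f); rewrite //= /open_edge eq_sym.
Qed.

Lemma restrict_sub t w : sub_cfg (restrict t w) (opened setT w).
Proof. by move=> e /hasP[f ft /andP[wf /eqP fe]]; apply/asboolP; exists f. Qed.

Lemma measurable_edge (f : edge L) (b : bool) : measurable [set w : config L | w f = b].
Proof. by apply: sub_sigma_algebra; exists f, b. Qed.

Lemma measurable_local (A : (E -> bool) -> Prop) t : measurable [set w | A (restrict t w)].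
Proof.
elim: t A => [|f t IH] A.
  case: (pselect (A none)) => h; [rewrite (_ : [set w | _] = setT)|rewrite (_ : [set w | _] = set0)] => //.
    by apply/seteqP; split.
  by apply/seteqP; split.
rewrite (_ : [set w | _] = ([set w | w f = true] `&` [set w | A (open_edge (val f) (restrict t w))])
  `|` ([set w | w f = false] `&` [set w | A (restrict t w)])).
  apply: measurableU; apply: measurableI; try exact: measurable_edge.
    exact: (IH (fun v => A (open_edge (val f) v))).
  exact: IH.
apply/seteqP; split => w /=; rewrite restrict_cons.
  by case: (w f) => h; [left|right].
by case=> -[->].
Qed.

Section Law.
Context (R : realType) (P : R -> probability (config L) R) (hP : percolation_measures P).
Context (p : R) (p01 : 0 <= p <= 1).

Let cyl (B : {fset edge L}) (b : edge L -> bool) : set (config L) :=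
  [set w | forall e, e \in B -> w e = b e].

Let weight (B : {fset edge L}) (b : edge L -> bool) : R :=
  \prod_(e <- B) (if b e then p else 1 - p).

(** The coins of [t] are exposed one at a time and then recorded in the cylinder, hence a cylinder
    disjoint from [t] in the statement; for empty [t] this is the defining equation of the
    measure. *)
Lemma cylinder_prob (B : {fset edge L}) b (t : seq (edge L)) (A : (E -> bool) -> Prop) :
  uniq t -> (forall f, f \in t -> f \notin B) ->
  P p (cyl B b `&` [set w | A (restrict t w)]) =
  (weight B b * Pr (fun=> p) (map val t) A)%:E.
Proof.
have mcyl (C : {fset edge L}) c : measurable (cyl C c).
  rewrite (_ : cyl C c = \bigcap_(e in [set` C]) [set w | w e = c e]).
    by apply: fin_bigcap_measurable => // e _; apply: measurable_edge.
  by apply/seteqP; split => w h e; [move=> eC; apply: h|apply: h].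
elim: t B b A => [|f t IH] B b A /=.
  move=> _ _; rewrite /Pr /=; case: (pselect (A none)) => h.
    rewrite (ind_true h) mulr1 (_ : _ `&` _ = cyl B b); first exact: hP.
    by apply/seteqP; split => [w []|w].
  rewrite (ind_false h) mulr0 (_ : _ `&` _ = set0) ?measure0 //.
  by apply/seteqP; split => // w [].
move=> /andP[ft ut] hB.
have fB : f \notin B by apply: hB; rewrite inE eqxx.
pose b1 v e := if e == f then v else b e.
pose B' := (f |` B)%fset.
have hB' f' : f' \in t -> f' \notin B'.
  move=> f't; rewrite !inE negb_or hB ?inE ?f't ?orbT // andbT.
  by apply: contraNneq ft => <-.
have wE v : weight B' (b1 v) = (if v then p else 1 - p) * weight B b.
  rewrite /weight /B' big_fsetU1 //= {1}/b1 eqxx; congr (_ * _).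
  rewrite big_seq [RHS]big_seq; apply: eq_bigr => e eB; rewrite /b1.
  by case: eqP eB fB => [->|//] -> .
have cylE v : cyl B' (b1 v) =
    [set w : config L | w f = v] `&` cyl B b.
  apply/seteqP; split => w.
    move=> h; split => /=; first by rewrite h ?/b1 ?eqxx // !inE eqxx.
    move=> e eB; rewrite h; last by rewrite !inE eB orbT.
    by rewrite /b1; case: eqP eB fB => [->|//] ->.
  move=> [/= h1 h2] e; rewrite !inE => /orP[/eqP ->|eB]; first by rewrite /b1 eqxx.
  by rewrite /b1; case: eqP eB fB => [->|_ eB _]; [move=> ->|exact: h2].
have := IH B' (b1 true) (fun v => A (open_edge (val f) v)) ut hB'.
have := IH B' (b1 false) A ut hB'.
rewrite !wE !cylE => h0 h1.
set S := _ `&` [set w : config L | A (restrict (f :: t) w)].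
have -> : S = ([set w : config L | w f = true] `&` cyl B b `&`
     [set w : config L | A (open_edge (val f) (restrict t w))]) `|`
   ([set w : config L | w f = false] `&` cyl B b `&`
     [set w : config L | A (restrict t w)]).
  apply/seteqP; split => w; rewrite /S /= restrict_cons.
    by case: (w f) => -[h2 h3]; [left|right].
  by case=> -[[-> h2] h3].
have m1 : measurable [set w : config L | A (open_edge (val f) (restrict t w))].
  exact: (measurable_local (fun v => A (open_edge (val f) v))).
have m0 := measurable_local A t.
set S1 := _ `&` [set w | A (open_edge _ _)]; set S0 := _ `&` [set w | A (restrict t w)].
have -> : P p (S1 `|` S0) = (P p S1 + P p S0)%E.
  apply: measureU.
  - by apply: measurableI => //; rewrite -cylE.
  - by apply: measurableI => //; rewrite -cylE.
  - by apply/seteqP; split => // w [[[/= h2 _] _] [[/= h3 _] _]]; rewrite h2 in h3.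
rewrite h0 h1 -EFinD; congr EFin; rewrite /Pr /=; ring.
Qed.

Lemma local_prob t A : uniq t -> P p [set w : config L | A (restrict t w)] = (Pr (fun=> p) (map val t) A)%:E.
Proof.
move=> ut; have := @cylinder_prob fset0 (fun=> true) t A ut (fun f _ => erefl).
rewrite /weight big_seq_fset0 mul1r => <-; congr (P p _).
by apply/seteqP; split => [w h|w [_ h]].
Qed.

End Law.

End LatticeGraph.

(** * Ball, arm and connection events through finitely many edges *)

Section Events.
Context (d : nat) (L : lattice d).
Notation V := (Zd d).
Notation E := {fset V}.
Notation is_edge := (is_edge L).
Context (M : nat) (M_gt0 : (0 < M)%N).
Hypothesis boxP : forall x q (w : E -> bool), (forall e, w e -> is_edge e \/ site e) ->
  all w (pedges x q) -> forall r, (size q <= r)%N -> last x q - x \in coord_box d M r.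

Lemma region_exists r : exists t : seq (edge L), uniq t /\
  forall f a b, a \in coord_box d M r -> b \in coord_box d M r ->
    val f = [fset a; b]%fset -> f \in t.
Proof.
pose l := undup [seq [fset a; b]%fset | a <- coord_box d M r, b <- coord_box d M r].
have [t ht] := lift_edges (filter_all is_edge l).
exists t; split; first by apply: (@map_uniq _ _ val); rewrite ht filter_uniq // undup_uniq.
move=> f a b ar br fab.
have : val f \in map val t.
  rewrite ht mem_filter; apply/andP; split; first by apply/asboolP; apply: set_mem (valP f).
  by rewrite mem_undup fab; apply/allpairsP; exists (a, b).
by move=> /mapP[g gt /val_inj ->].
Qed.

Definition region r := projT1 (cid (region_exists r)).
Definition region_in (G : set (edge L)) r := [seq f <- region r | `[< G f >]].

Lemma region_uniq G r : uniq (region_in G r).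
Proof. by rewrite filter_uniq //; case: (projT2 (cid (region_exists r))). Qed.

Lemma regionP r f a b : a \in coord_box d M r -> b \in coord_box d M r ->
  val f = [fset a; b]%fset -> f \in region r.
Proof. by case: (projT2 (cid (region_exists r))) => _; apply. Qed.

Lemma local_walk G w r k y : (k <= r)%N ->
  walk (Some k) 0 y (opened G w) <-> walk (Some k) 0 y (restrict (region_in G r) w).
Proof.
move=> kr; split; last first.
  apply: walk_incr => e /hasP[f]; rewrite mem_filter => /andP[/asboolP Gf _] /andP[wf /eqP fe].
  by apply/asboolP; exists f.
move=> [q [h1 h2 h3]]; exists q; split => //; apply/allP => e eq_.
have inbox c : c \in 0 :: q -> c \in coord_box d M r.
  move=> /split_mem[q1 [q2 [qE lc]]].
  have hq1 : all (opened G w) (pedges 0 q1) by move: h1; rewrite qE pedges_cat all_cat => /andP[].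
  rewrite -lc -[last 0 q1]subr0; apply: (boxP _ hq1); first by move=> e' /opened_edge; left.
  by apply: leq_trans kr; apply: leq_trans h3; rewrite qE size_cat leq_addr.
have /asboolP[f [Gf wf] fe] := allP h1 e eq_.
apply/hasP; exists f; last by rewrite wf fe eqxx.
have [a [b [eE aq bq]]] := pedges_mem eq_.
rewrite mem_filter; apply/andP; split; first exact/asboolP.
apply: (@regionP r f a b); rewrite ?fe //; apply: inbox; first exact: mem_belast.
by rewrite inE bq orbT.
Qed.

Lemma local_arm G w r : arm r 0 (opened G w) <-> arm r 0 (restrict (region_in G r) w).
Proof.
by split=> -[y [h1 h2]]; exists y; split; try (by apply/(local_walk G w y (leqnn r)));
  move=> k kr /(local_walk G w y (ltnW kr)); apply: h2.
Qed.

Section Law.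
Context (R : realType) (P : R -> probability (config L) R) (hP : percolation_measures P).

Lemma gdist_le (G : set (edge L)) (w : config L) x y k : (gdist R G w x y <= k%:R%:E)%E <-> walk (Some k) x y (opened G w).
Proof.
split; last first.
  move=> [q [h1 h2 h3]]; apply: le_trans (_ : (size q)%:R%:E <= _)%E; last by rewrite lee_fin ler_nat.
  apply: ereal_inf_lbound; exists q => //; split => //.
  by rewrite opened_path.
move=> h; case: (pselect (walk (Some k) x y (opened G w))) => // nw; exfalso.
have : (k.+1%:R%:E <= gdist R G w x y)%E.
  apply: le_ereal_inf_tmp => _ [q [h1 h2] <-]; rewrite lee_fin ler_nat ltnNge; apply/negP => qk.
  by apply: nw; exists q; split => //; rewrite -opened_path.
by move=> /le_trans /(_ h); rewrite lee_fin ler_nat ltnn.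
Qed.

Lemma gdist_eq (G : set (edge L)) (w : config L) x y r : gdist R G w x y = r%:R%:E <-> at_dist r x y (opened G w).
Proof.
split=> [h|[h1 h2]].
  split; first by apply/gdist_le; rewrite h.
  by move=> k kr /gdist_le; rewrite h lee_fin ler_nat leqNgt kr.
apply/eqP; rewrite eq_le; apply/andP; split; first exact/gdist_le.
apply: le_ereal_inf_tmp => _ [q [h3 h4] <-]; rewrite lee_fin ler_nat leqNgt; apply/negP => qr.
apply: (h2 _ qr); apply/gdist_le; apply: ereal_inf_lbound; by exists q.
Qed.

(** This reduces the supremum over all edge sets, infinite ones included, to finite lists, on which
    [arm_bound] is uniform. *)
Lemma H_eventE G r : H_event R r G = [set w | arm r 0 (restrict (region_in G r) w)].
Proof.
apply/seteqP; split => w /=.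
  by move=> [y /gdist_eq hy]; apply/local_arm; exists y.
by move=> /local_arm[y hy]; exists y; apply/gdist_eq.
Qed.

Section FixedP.
Context (p : R) (p01 : 0 <= p <= 1).

Lemma H_event_prob G r :
  P p (H_event R r G) = (Pr (fun=> p) (map val (region_in G r)) (arm r 0))%:E.
Proof. by rewrite H_eventE; apply: local_prob => //; apply: region_uniq. Qed.

Lemma bonds_lift (t : seq (edge L)) : uniq t -> bonds is_edge (map val t).
Proof.
move=> ut; rewrite /bonds map_inj_uniq ?ut /=; last exact: val_inj.
by apply/allP => e /mapP[f _ ->]; apply/asboolP; apply: set_mem (valP f).
Qed.

Lemma expected_ball_prob r : expected_ball_size (P p) r =
  (\sum_(x <- undup (coord_box d M r))
     Pr (fun=> p) (map val (region_in setT r)) (walk (Some r) 0 x))%:E.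
Proof.
set t := region_in setT r; set B := undup (coord_box d M r).
have ballE w : counting (R := R) (ball_in R setT w 0 r) =
    (\sum_(x <- B) (\1_[set w | walk (Some r) 0 x (restrict t w)] w : R)%:E)%E.
  pose l := [seq x <- B | `[< walk (Some r) 0 x (restrict t w) >]].
  have -> : ball_in R setT w 0 r = [set` [fset x in l]%fset].
    apply/seteqP; split => x /=.
      move=> /gdist_le h; rewrite inE mem_filter; apply/andP; split.
        by apply/asboolP/local_walk.
      rewrite mem_undup -[x]subr0; case: h => q [h1 <- h3]; apply: (boxP _ h1) => //.
      by move=> e /opened_edge; left.
    by rewrite inE mem_filter => /andP[/asboolP/(local_walk _ _ _ (leqnn r))/gdist_le].
  rewrite /counting asboolT; last exact: finite_fset.
  rewrite set_fsetK card_fseq undup_id ?filter_uniq ?undup_uniq // sumEFin; congr EFin.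
  rewrite size_filter -sum1_count big_mkcond natr_sum; apply: eq_bigr => x _.
  rewrite indicE /=; case: (pselect (walk (Some r) 0 x (restrict t w))) => h.
    by rewrite asboolT // mem_set.
  by rewrite asboolF // memNset.
rewrite /expected_ball_size; under eq_integral do rewrite ballE.
have mW x : measurable [set w | walk (Some r) 0 x (restrict t w)] by apply: measurable_local.
rewrite ge0_integral_sum //; last first.
  by move=> x; apply/measurable_EFinP; apply: measurable_indic.
rewrite -sumEFin; apply: eq_bigr => x _; rewrite integral_indic // setIT.
by apply: local_prob => //; apply: region_uniq.
Qed.

Lemma connection_eventE x y : connection_event x y = [set w : config L | walk None x y (opened setT w)].
Proof. by apply/seteqP; split => w /=; move/opened_walk. Qed.

Lemma opened_restrict (t : seq (edge L)) (w : config L) :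
  all (opened setT w) (map val t) = all (restrict t w) (map val t).
Proof.
apply/idP/idP => /allP h; apply/allP => e et; last exact: restrict_sub (h e et).
have /asboolP[f [_ wf] fe] := h e et; have /mapP[g gt ge] := et.
apply/hasP; exists f; last by rewrite wf fe eqxx.
by have <- : g = f by apply: val_inj; rewrite -ge fe.
Qed.

(** Vertex sequences are countable, and openness of a fixed sequence depends on finitely many
    edges. *)
Lemma measurable_connection x y : measurable (connection_event x y : set (config L)).
Proof.
rewrite connection_eventE.
rewrite (_ : [set w | _] = \bigcup_(q : seq V) [set w : config L |
    all (opened setT w) (pedges x q) /\ last x q = y]); last first.
  apply/seteqP; split => w /=; first by move=> [q [h1 h2 _]]; exists q.
  by move=> [q _ [h1 h2]]; exists q.
apply: countable_bigcupT_measurable => [|q]; first exact: countableP.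
case: (pselect (last x q = y)) => lq; last first.
  by rewrite (_ : [set w | _] = set0) //; apply/seteqP; split => // w [].
case: (boolP (all is_edge (pedges x q))) => [/lift_edges[t ht]|ne]; last first.
  rewrite (_ : [set w | _] = set0) //; apply/seteqP; split => // w /= [h _].
  by move/negP: ne; apply; apply: sub_cfg_all h; apply: opened_edge.
rewrite (_ : [set w | _] = [set w | all (restrict t w) (map val t)]).
  exact: (measurable_local (fun v => all v (map val t))).
by apply/seteqP; split => w /=; rewrite -ht opened_restrict; [case|].
Qed.

Lemma local_prob_le s (A : (E -> bool) -> Prop) (S : set (config L)) : adm is_edge s ->
  (forall w, A w -> A (keep w bond)) -> increasing A -> measurable S ->
  (forall w, A (opened setT w) -> S w) -> ((Pr (fun=> p) s A)%:E <= P p S)%E.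
Proof.
move=> ads Ab iA mS hS.
have -> : Pr (fun=> p) s A = Pr (fun=> p) (seq.filter bond s) A.
  rewrite /Pr -Ex_filter; apply: eq_Ex => w; congr ind; apply/propext; split; first exact: Ab.
  by apply: iA; apply: sub_keep.
have sE : all is_edge (seq.filter bond s).
  apply/allP => e; rewrite mem_filter => /andP[eb es]; case/andP: ads => _ /allP/(_ e es).
  by rewrite /bond_or_site /site => /orP[//|h]; rewrite /bond h in eb.
have [t ht] := lift_edges sE; rewrite -ht -(local_prob hP p01) //; last first.
  by apply: (@map_uniq _ _ val); rewrite ht filter_uniq // (adm_uniq ads).
apply: le_measure; rewrite ?inE //; first exact: measurable_local.
by move=> w /= h; apply: hS; apply: iA h; apply: restrict_sub.
Qed.

Lemma connection_prob s n x y : adm is_edge s ->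
  ((Pr (fun=> p) s (walk n x y))%:E <= P p (connection_event x y))%E.
Proof.
move=> ads; apply: local_prob_le => //.
- by move=> w; apply: walk_bonds.
- exact: walk_incr.
- exact: measurable_connection.
- by move=> w /walk_weak h; rewrite connection_eventE.
Qed.

Lemma coord_box_norm r (v : V) i : v \in coord_box d M r -> `|v ord0 i| <= (M * r)%N%:Z.
Proof.
move=> /fintype.imageP[f _ ->]; rewrite mxE; have := ltn_ord (f i); rewrite ltnS.
move: (nat_of_ord (f i)) => k; move: (M * r)%N => m km.
rewrite ler_norml; apply/andP; split; first by rewrite lerBrDr addNr.
by rewrite lerBlDr -PoszD lez_nat addnn -mul2n.
Qed.

Lemma coord_box_le r r' : (r <= r')%N -> {subset coord_box d M r <= coord_box d M r'}.
Proof.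
move=> rr v hv; apply: coord_boxP => i; apply: le_trans (coord_box_norm i hv) _.
by rewrite lez_nat leq_mul2l rr orbT.
Qed.

Lemma coord_box_cover (X : seq V) : exists r, {subset X <= coord_box d M r}.
Proof.
exists (\sum_(v <- X) \sum_(i < d) absz (v ord0 i))%N => v vX; apply: coord_boxP => i.
rewrite -abszE lez_nat; apply: leq_trans (_ : 1 * \sum_(v <- X) \sum_(i < d) absz (v ord0 i) <= _)%N.
  rewrite mul1n (big_rem v vX) /= (bigD1 i) //= -addnA; exact: leq_addr.
by rewrite leq_mul2r M_gt0 orbT.
Qed.

Definition far k : set (config L) :=
  \bigcup_y (if y \in coord_box d M k then set0 else connection_event 0 y).

Lemma farP k w : far k w <-> escape (coord_box d M k) 0 (opened setT w).
Proof.
split=> [[y _]|[y yB wy]].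
  case: ifP => // yB; rewrite connection_eventE => wy; exists y => //; by rewrite yB.
by exists y => //; rewrite (negPf yB) connection_eventE.
Qed.

Lemma measurable_far k : measurable (far k).
Proof.
apply: countable_bigcupT_measurable => [|y]; first exact: countableP.
case: ifP => _ //; exact: measurable_connection.
Qed.

Lemma far_infinite : \bigcap_k far k = infinite_cluster_event (L := L).
Proof.
apply/seteqP; split => w.
  move=> h fin; have /finite_seqP[X hX] := fin.
  have [r hr] := coord_box_cover X.
  have /farP[y yB wy] := h r I.
  have : [set u | connected_in setT w 0 u] y by apply/opened_walk.
  by rewrite hX /= => /hr; apply/negP.
move=> h k _; apply/farP.
case: (pselect (escape (coord_box d M k) 0 (opened setT w))) => // ne; case: h.
apply: (sub_finite_set (B := [set` coord_box d M k])); last exact: finite_seq.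
move=> y /opened_walk wy /=; case: (boolP (y \in coord_box d M k)) => // yB.
by case: ne; exists y.
Qed.

(** The events of leaving ever larger boxes decrease to the infinite cluster event, so their
    probabilities tend to 0; every finite list inherits the bound. *)
Lemma no_percolation_of : P p (infinite_cluster_event (L := L)) = 0%E ->
  forall eta : R, 0 < eta -> exists X : seq V, forall s, adm is_edge s ->
    Pr (fun=> p) s (escape X 0) <= eta.
Proof.
move=> h0 eta eta0.
have hc : (P p \o far) k @[k --> \oo] --> (0 : \bar R)%E.
  rewrite -h0 -far_infinite; apply: nonincreasing_cvg_mu.
  - by apply: le_lt_trans (probability_le1 _ (measurable_far _)) _; rewrite ltry.
  - exact: measurable_far.
  - by apply: bigcap_measurable => // k _; exact: measurable_far.
  - move=> k l kl; apply/subsetPset => w /farP[y yB wy]; apply/farP; exists y => //.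
    by apply: contra yB; apply: coord_box_le.
have [k hk] : exists k, (P p (far k) <= eta%:E)%E.
  have [k hk] := filter_ex (cvgr_lt _ (fine_cvg hc) _ eta0).
  exists k; rewrite -[leLHS]fineK ?fin_num_measure //; last exact: measurable_far.
  by rewrite lee_fin; apply: ltW.
exists (coord_box d M k) => s ads; rewrite -lee_fin; apply: le_trans hk.
apply: local_prob_le => //.
- by move=> w [y yB wy]; exists y => //; apply: walk_bonds.
- by move=> u v uv [y yB wy]; exists y => //; exact: (walk_incr uv wy).
- exact: measurable_far.
- by move=> w /farP.
Qed.

End FixedP.
End Law.
End Events.

(** * Conclusion *)

Lemma Pr_shift_large (R : realFieldType) (V : zmodType) (p : R) z (s : seq {fset V}) n (x : V) :
  Pr (fun=> p) (map (shift z) s) (large n (x + z)) = Pr (fun=> p) s (large n x).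
Proof.
rewrite /Pr (Ex_map s _ (shiftNK z) (shiftKN z)) //; apply: eq_Ex => w.
congr ind; apply/propext; split=> -[Y [uY sY hY]].
  exists (map (fun y => y - z) Y); split; first exact: uniq_shift.
    by rewrite size_map.
  by move=> y /mapP[y' /hY h ->]; apply/(walk_shiftE z); rewrite subrK.
exists (map (+%R^~ z) Y); split; rewrite ?size_map //.
  by rewrite map_inj_uniq // => a b /addIr.
by move=> y /mapP[y' /hY h ->]; apply/walk_shiftE.
Qed.

Lemma le_half_sub (F : realFieldType) (x del p : F) : del <= x / 2 -> x - del < p -> x / 2 <= p.
Proof. lra. Qed.

Section Main.
Context (R : realType) (d : nat) (d_gt0 : (0 < d)%N) (L : lattice d).
Notation V := (Zd d).
Notation E := {fset V}.
Notation is_edge := (is_edge L).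
Context (P : R -> probability (config L) R) (hP : percolation_measures P).
Notation pc := (p_c P).
Hypothesis htriangle : triangle_condition (P pc).

(** The supremum provides non-percolating p arbitrarily close to p_c. The value 0 is set apart
    because opening paths requires a positive lower bound on the edge probability. *)
Lemma p_c_cases : pc = 0 \/ 0 < pc <= 1 /\ forall del : R, 0 < del -> exists p : R,
  [/\ 0 <= p <= 1, P p (infinite_cluster_event (L := L)) = 0%E, pc - del < p & p <= pc].
Proof.
pose A := [set p : R | 0 <= p <= 1 /\ P p (infinite_cluster_event (L := L)) = 0%E].
(* [sup] of the empty set is 0 by convention, which falls under the first case. *)
have [A0|/set0P[q Aq]] := eqVneq A set0; first by left; rewrite /p_c -/A A0 sup0.
have hs : has_sup A by split; [exists q|exists 1 => p [/andP[]]].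
have ub p : A p -> p <= pc by move=> Ap; apply: sup_upper_bound hs p Ap.
have pc0 : 0 <= pc by apply: le_trans (ub q Aq); case: Aq => /andP[].
have pc1 : pc <= 1 by apply: ge_sup; [exists q|move=> p [/andP[]]].
move: pc0; rewrite le_eqVlt => /orP[/eqP <-|pc0]; [by left|right; split; first by rewrite pc0].
move=> del d0; have [p Ap hp] := sup_adherent d0 hs; exists p; split => //; try by case: Ap.
exact: ub.
Qed.

Lemma triangle_sums (pc01 : 0 <= pc <= 1) : exists T, forall Z, uniq Z ->
  \sum_(z <- Z) tri is_edge pc01 z <= T.
Proof.
have htri := htriangle; rewrite /triangle_condition in htri.
set S := (X in (X < _)%E) in htri.
have tau_conn x y : ((tau is_edge pc01 (y - x))%:E <= P pc (connection_event x y))%E.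
  rewrite -[leRHS]fineK ?fin_num_measure ?lee_fin //; last exact: measurable_connection.
  apply: tau_le => s ads; rewrite -lee_fin fineK ?fin_num_measure //; last exact: measurable_connection.
  have := connection_prob hP pc01 None x y (adm_shift (@is_edge_shift _ L) x ads).
  have := Pr_shift_walk (pr := fun=> pc) (fun _ _ => erefl) x s None 0 (y - x).
  by rewrite add0r subrK => ->.
exists (fine S) => Z uZ.
have S0 : (0 <= S)%E by apply: esum_ge0 => xy _; rewrite !mule_ge0 // measure_ge0.
rewrite -lee_fin fineK; last by rewrite ge0_fin_numE.
apply: esum_ge; exists [set` Z]; first by split => //; exact: finite_seq.
rewrite -fsbig_seq // -sumEFin; apply: lee_sum => -[x y] _ /=.
rewrite /tri /= !EFinM; apply: lee_pmul; rewrite ?mule_ge0 ?lee_fin ?tau_ge0 //.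
  apply: lee_pmul; rewrite ?lee_fin ?tau_ge0 //.
  by have := tau_conn 0 x; rewrite subr0.
by have := tau_conn 0 y; rewrite subr0.
Qed.

Lemma Ex_closed s (f : (E -> bool) -> R) : Ex (fun=> 0) s f = f none.
Proof. by elim: s f => [//|e s IH] f /=; rewrite !IH mul0r add0r subr0 mul1r. Qed.

Theorem main_bounds : exists2 C : R, 0 < C & forall r : nat, (1 <= r)%N ->
  (expected_ball_size (P pc) r <= (C * r%:R)%:E)%E /\
  forall G, (P pc (H_event R r G) <= (C / r%:R)%:E)%E.
Proof.
have [M M0 boxP] := balls_exist L.
have walk_none n (y : V) : walk n 0 y none -> y = 0.
  by move=> [[|v q] [//= h1 <- _]].
case: p_c_cases => [pc0|[/andP[pc0 pc1] papprox]].
  (* At p_c = 0 every coin is closed: the ball is {0} and no point is at distance r >= 1. *)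
  have pc01 : 0 <= pc <= 1 by rewrite pc0 lexx ler01.
  exists 1 => // r r1; rewrite (expected_ball_prob boxP hP pc01); split.
    rewrite lee_fin mul1r; apply: le_trans (_ : 1 <= _); last by rewrite ler1n.
    rewrite pc0; under eq_bigr do rewrite /Pr Ex_closed.
    apply: sum_ind_le1; first exact: undup_uniq.
    by move=> x y /walk_none -> /walk_none ->.
  move=> G; rewrite (H_event_prob boxP hP pc01) lee_fin pc0 /Pr Ex_closed.
  rewrite ind_false ?divr_ge0 // => -[y [/walk_none -> h]].
  by apply: (h 0%N r1); apply: walk_refl.
have pc01 : 0 <= pc <= 1 by rewrite ltW.
have [T hT] := triangle_sums pc01.
have shiftE := @is_edge_shift _ L; have cardE := @is_edge_card _ L.
have ballP (r : nat) s w x y : adm is_edge s -> supported s w -> walk (Some r) x y w ->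
    y - x \in coord_box d M r.
  move=> ads sw [q [h1 <- h3]]; apply: (boxP _ _ w _ h1) => // e /sw es.
  by case/andP: ads => _ /allP/(_ e es)/orP[]; [left|right].
have tg0 := tau_ge0 is_edge pc01.
have tub := tau_ub shiftE pc01.
have prp (e : E) : 0 <= (fun=> pc) e <= 1 by [].
have prs z (e : E) : (fun=> pc) (shift z e) = (fun=> pc) e by [].
have q4 : 0 < 4^-1 :> R by rewrite invr_gt0.
have q10 : 0 < 10^-1 :> R by rewrite invr_gt0.
have [F4 hF4] := triangle_open shiftE hT q4.
have [w0 hw0] := outside F4 d_gt0.
have szb r : (size (coord_box d M r) <= (2 * M).+1 ^ d * r.+1 ^ d)%N.
  rewrite size_coord_box -expnMn; rewrite leq_exp2r //.
  by rewrite mulnS (mulSn (2 * M)) mulnA addSn ltnS addnA leq_addl.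
have [C1 C10 hC1] := G_linear shiftE prp prs tg0 tub ballP pc0 (fun e _ => lexx pc)
  (edge_path L) (fun eps e0 => triangle_tail hT e0) (ex_intro _ w0 (hF4 w0 hw0)) szb.
have [F hF] := triangle_open shiftE hT q10.
have [w1 hw1] := outside F d_gt0.
(* Avoiding w1 - F keeps w1 - w2 out of [F], so that the interference between the two arms is small
   too. *)
have [w2] := outside (F ++ [seq w1 - f | f <- F]) d_gt0.
rewrite mem_cat negb_or => /andP[hw2 hw12].
have hw3 : w1 - w2 \notin F.
  by apply: contra hw12 => h; apply/mapP; exists (w1 - w2) => //; rewrite opprB addrC subrK.
have [kap1 [kE1 kw1]] := edge_path L w1; have [kap2 [kE2 kw2]] := edge_path L w2.
(* Only p >= p_c / 2 will occur, so the price of opening a path is bounded uniformly in p. *)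
pose p0 := pc / 2; have p00 : 0 < p0 by rewrite divr_gt0.
(* The summand 1 gives K >= 1, so that a bound of (Q y)^2 by K yields Q y <= K. *)
pose K := 12 * (2 * (size (hub_offsets kap1 kap2))%:R / p0 ^+ (size kap1 + size kap2)) + 1.
have K1 : 1 <= K.
  by rewrite lerDr mulr_ge0 // divr_ge0 ?mulr_ge0 // exprn_ge0 // ltW.
have vol s o n (y : R) : bonds is_edge s -> 0 < y -> y ^+ 2 <= n%:R ->
    Pr (fun=> pc) s (large n o) * y <= K.
  move=> /andP[us sE] y0 yn.
  have n0 : (0 < n)%N by rewrite -(ltr0n R); apply: lt_le_trans yn; apply: exprn_gt0.
  pose s' := map (shift (- o)) s.
  have sE' : all is_edge s'.
    by apply/allP => e /mapP[e' /(allP sE) h ->]; rewrite is_edge_shift.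
  have ads' : adm is_edge s'.
    rewrite /adm map_inj_uniq ?us; last exact: can_inj (shiftNK _).
    by apply/allP => e /(allP sE') h; rewrite /bond_or_site h.
  rewrite -(Pr_shift_large pc (- o) s n o) subrr -/s'.
  suff h (eps : R) : 0 < eps -> Pr (fun=> pc) s' (large n 0) * y <= K + eps.
    exact/ler_addgt0Pr.
  move=> e0.
  (* The first entry keeps p above [p0]; the second makes the error from [Ex_lipschitz], multiplied
     by [y], at most [eps]. *)
  have del0 : 0 < Num.min p0 (eps / ((size s')%:R * y + 1)).
    by rewrite lt_min p00 divr_gt0 // ltr_wpDl // mulr_ge0 // ltW.
  have [p [p01 hinf pl pu]] := papprox _ del0.
  set del := Num.min _ _ in del0 pl.
  have [d1 d2] : del <= p0 /\ del <= eps / ((size s')%:R * y + 1).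
    by split; rewrite /del ge_min lexx ?orbT.
  have p0p : p0 <= p by exact: le_half_sub d1 pl.
  have sq := large_sqr cardE shiftE pc01 tg0 tub ballP kE1 kw1 kE2 kw2 (hF _ hw1) (hF _ hw2)
    (hF _ hw3) p00 p0p pu (no_percolation_of M0 hP p01 hinf) ads' sE' n0.
  have lip : Pr (fun=> pc) s' (large n 0) <= Pr (fun=> p) s' (large n 0) + (size s')%:R * del.
    apply: Ex_lipschitz => // [e|w]; last by rewrite ind_ge0 ind_le1.
    by rewrite ger0_norm ?subr_ge0 // lerBlDl -lerBlDr ltW.
  set Q := Pr (fun=> p) s' (large n 0) in sq lip.
  have Q0 : 0 <= Q by apply: Pr_ge0.
  have QK : Q * y <= K.
    rewrite -(ler_pXn2r (n := 2)) ?nnegrE //; first last.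
    - by apply: le_trans K1.
    - by rewrite mulr_ge0 // ltW.
    apply: le_trans (_ : K <= _); last by rewrite ler_eXnr.
    rewrite exprMn; apply: le_trans (_ : Q ^+ 2 * n%:R <= _).
      by apply: ler_wpM2l => //; apply: exprn_ge0.
    by apply: le_trans sq _; rewrite /K lerDl.
  have sd : (size s')%:R * del * y <= eps.
    have sy : 0 <= (size s')%:R * y by rewrite mulr_ge0 // ltW.
    rewrite mulrAC; apply: le_trans (_ : (size s')%:R * y * (eps / ((size s')%:R * y + 1)) <= _).
      exact: ler_wpM2l.
    by rewrite mulrCA ger_pMr // ler_pdivrMr ?mul1r ?lerDl // ltr_wpDl.
  by apply: le_trans (ler_wpM2r (ltW y0) lip) _; rewrite mulrDl lerD.
have [C2 C20 hC2] := arm_bound pc01 vol.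
exists (C1 + C2); first exact: addr_gt0.
move=> r r1; have r0 : 0 < r%:R :> R by rewrite ltr0n.
split.
  rewrite (expected_ball_prob boxP hP pc01) lee_fin.
  have bds := bonds_lift (region_uniq M [set: edge L] r).
  have /andP[us sE] := bds.
  have ads : adm is_edge (map val (region_in (L := L) M setT r)).
    by rewrite /adm us; apply/allP => e /(allP sE) h; rewrite /bond_or_site h.
  apply: le_trans (G_ub shiftE prp prs ballP r 0 ads (undup_uniq _)) _.
  apply: le_trans (hC1 r r1) _; apply: ler_wpM2r => //; by rewrite lerDl ltW.
move=> G; rewrite (H_event_prob boxP hP pc01) lee_fin.
apply: le_trans (hC2 _ 0 r (bonds_lift (region_uniq M G r)) r1) _.
by apply: ler_wpM2r; rewrite ?invr_ge0 ?lerDr ltW.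
Qed.

End Main.

Theorem theorem1p2 (R : realType) (d : nat) (d_gt6 : (6 < d)%N) (L : lattice d)
    (P : R -> probability (config L) R) (hP : percolation_measures P)
    (htriangle : triangle_condition (P (p_c P))) :
  exists2 C : R, 0 < C &
    forall r : nat, (1 <= r)%N ->
      [/\ (expected_ball_size (P (p_c P)) r <= (C * r%:R)%:E)%E,
          (Gamma (P (p_c P)) r <= (C / r%:R)%:E)%E &
          (P (p_c P) (H_event R r [set: edge L]) <= (C / r%:R)%:E)%E].
Proof.
have d0 : (0 < d)%N by apply: leq_trans d_gt6.
have [C C0 hC] := main_bounds d0 hP htriangle; exists C => // r r1.
have [h1 h2] := hC r r1; split => //.
by apply: ge_ereal_sup => _ [G _ <-].
Qed.
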